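(* Let $\mathscr D\subseteq\mathbb R^n$ be measurable, let $\mathscr F_1,\dots,\mathscr F_n$ be spaces of exponential sums, and let $d_1,\dots,d_n\in\mathbb N$ with $d_i\ge 1$. Then \[ E_{\mathscr D}(\mathscr F_1^{d_1},\dots,\mathscr F_n^{d_n})=\sqrt{d_1d_2\cdots d_n}\;E_{\mathscr D}(\mathscr F_1,\dots,\mathscr F_n). \]
   Context: A space of exponential sums is specified by a finite set $A\subset\mathbb Z^n$ (the support) and coefficients $\alpha:A\to(0,\infty)$: $\mathscr E_{A,\alpha}$ is the real inner product space of functions $\mathbb R^n\to\mathbb R$ having orthonormal basis $\{\alpha_{\mathbf a}e^{\mathbf a\cdot\mathbf x}\}_{\mathbf a\in A}$, where $\mathbf a\cdot\mathbf x=a_1x_1+\dots+a_nx_n$. Aronszajn multiplication: $\mathscr E_{A,\alpha}=\mathscr E_{B,\beta}\mathscr E_{C,\gamma}$ means $A=B+C$ (Minkowski sum) and $\alpha_{\mathbf a}^2=\sum_{\mathbf b\in B,\mathbf c\in C,\ \mathbf b+\mathbf c=\mathbf a}\beta_{\mathbf b}^2\gamma_{\mathbf c}^2$ for every $\mathbf a\in A$. Powers are defined by $\mathscr F^1=\mathscr F$ and $\mathscr F^d=\mathscr F\,\mathscr F^{d-1}$. For spaces $\mathscr F_i=\mathscr E_{A_i,\alpha_i}$ ($i=1,\dots,n$) and measurable $\mathscr D\subseteq\mathbb R^n$, $E_{\mathscr D}(\mathscr F_1,\dots,\mathscr F_n)$ denotes the expected number of solutions $\mathbf x\in\mathscr D$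 of the system $\sum_{\mathbf a\in A_i}f_{i,\mathbf a}\alpha_{i,\mathbf a}e^{\mathbf a\cdot\mathbf x}=0$, $i=1,\dots,n$, where the $f_{i,\mathbf a}$ are i.i.d. real standard normal random variables. *)

(* Defs.v *)
From HB Require Import structures.
From mathcomp Require Import all_boot all_order all_algebra.
From mathcomp Require Import all_classical all_reals all_analysis.
From mathcomp Require Import normal_distribution.

Set Implicit Arguments.
Unset Strict Implicit.
Unset Printing Implicit Defensive.
Import Order.TTheory GRing.Theory Num.Theory.
Local Open Scope classical_set_scope.
Local Open Scope ring_scope.

(* Exponents a in Z^n are row vectors 'rV[int]_n; points x in R^n are
   n.-tuples of reals (which carry the product Borel sigma-algebra). *)

Definition dotZ (R : realType) (n : nat) (a : 'rV[int]_n) (x : n.-tuple R) : R :=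
  \sum_(i < n) (a 0 i)%:~R * tnth x i.

(* A space of exponential sums E_{A,alpha}: support A (finite, listed without
   repetition) and coefficients alpha (only the values on A matter). *)
Record espace (n : nat) (R : realType) := ESpace {
  supp : seq 'rV[int]_n;
  coef : 'rV[int]_n -> R }.

Definition espace_valid n (R : realType) (F : espace n R) : Prop :=
  [/\ uniq (supp F), supp F != [::] & forall a, a \in supp F -> 0 < coef F a].

Definition esmul n (R : realType) (F G : espace n R) : espace n R :=
  ESpace (undup [seq b + c | b <- supp F, c <- supp G])
    (fun a => Num.sqrt (\sum_(b <- supp F) \sum_(c <- supp G | b + c == a)
                          (coef F b ^+ 2 * coef G c ^+ 2))).

Definition espow n (R : realType) (F : espace n R) (d : nat) : espace n R :=
  iter d.-1 (esmul F) F.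

Definition mutually_independent (d : measure_display) (T : measurableType d)
    (R : realType) (P : probability T R) (n : nat)
    (K : 'I_n -> 'rV[int]_n -> bool) (X : 'I_n -> 'rV[int]_n -> T -> R) : Prop :=
  forall (J : seq ('I_n * 'rV[int]_n)) (B : 'I_n * 'rV[int]_n -> set R),
    uniq J -> all (fun k => K k.1 k.2) J -> (forall k, measurable (B k)) ->
    P (\bigcap_(k in [set` J]) (X k.1 k.2 @^-1` B k)) =
    (\prod_(k <- J) P (X k.1 k.2 @^-1` B k))%E.

Definition iid_std_normal (d : measure_display) (T : measurableType d)
    (R : realType) (P : probability T R) (n : nat)
    (K : 'I_n -> 'rV[int]_n -> bool) (X : 'I_n -> 'rV[int]_n -> T -> R) : Prop :=
  [/\ forall i a, K i a -> measurable_fun setT (X i a),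
      forall i a, K i a -> forall B : set R, measurable B ->
        P (X i a @^-1` B) = normal_prob 0 1 B
    & mutually_independent P K X].

Definition in_supp n (R : realType) (F : 'I_n -> espace n R) :
  'I_n -> 'rV[int]_n -> bool := fun i a => a \in supp (F i).

Definition solutions n (R : realType) (F : 'I_n -> espace n R)
    (f : 'I_n -> 'rV[int]_n -> R) (D : set (n.-tuple R)) : set (n.-tuple R) :=
  [set x | D x /\ forall i : 'I_n,
     \sum_(a <- supp (F i)) f i a * coef (F i) a * expR (dotZ a x) = 0].

Definition nsolutions n (R : realType) (F : 'I_n -> espace n R)
    (f : 'I_n -> 'rV[int]_n -> R) (D : set (n.-tuple R)) : \bar R :=
  (\esum_(x in solutions F f D) 1)%E.

Definition expected_nsol (d : measure_display) (T : measurableType d)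
    (R : realType) (P : probability T R) n (F : 'I_n -> espace n R)
    (X : 'I_n -> 'rV[int]_n -> T -> R) (D : set (n.-tuple R)) : \bar R :=
  (\int[P]_w nsolutions F (fun i a => X i a w) D)%E.

(* Main.v *)
(** Dividing the [i]-th equation by the standard deviation of its left-hand side
at [x] gives a random system [f *m U x = 0], where [f] is a standard Gaussian row
vector and [U x] has orthonormal columns. The map
[(g, x) |-> (g - g *m U x *m (U x)^T, g *m U x)] preserves the Gaussian weight of
[g], its Jacobian is the determinant of the derivatives [g *m dU j x], and its
fibre over [(f, s)] is the zero set of [f *m U x]. The area formula thus yields
the Kac-Rice formula: the expected number of zeros in [D] is the integral over
[D] of a constant times the mean of the absolute value of this determinant. The
mean depends only on the Gram matrix of the derivatives, which in the [i]-th
block is the covariance matrix of the exponents under the weights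
[alpha_a^2 e^(2 a.x)] of [F_i]. Aronszajn multiplication convolves these
weights, so covariances add up and the covariance of [F_i^(d_i)] is [d_i] times
that of [F_i]; hence the mean is multiplied by the square root of the product
of the [d_i]. *)

Require Import Defs.
From HB Require Import structures.
From mathcomp Require Import all_boot all_order all_algebra.
From mathcomp Require Import all_classical all_reals all_analysis.
From mathcomp Require Import measurable_realfun normal_distribution.
From mathcomp Require Import perm ring lra.
Set Implicit Arguments.
Unset Strict Implicit.
Unset Printing Implicit Defensive.
Import Order.TTheory GRing.Theory Num.Theory.
Import numFieldNormedType.Exports.
Local Open Scope classical_set_scope.
Local Open Scope ring_scope.

(** * Measures on row vectors *)

(** The evident square map [(f, x) |-> (f, f *m U x)] has the zeros over [s = 0], a null slice that
    an area formula does not see. Subtracting [g *m U x *m (U x)^T] in the first component makes the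
    fibre count independent of [s], so that it can be averaged against the Gaussian density of [s],
    whose mass is 1. The area formula is proved for maps whose first-order Taylor error is
    quadratic, uniformly on balls: on dyadic cells of side [2 ^- m] all errors are then polynomials
    in [2 ^- m]. Distances use the maximum norm, for which an [L]-Lipschitz map expands volume by at
    most [L ^+ n] with no dimensional constant; this sharpness is what produces the exact Jacobian
    in the limit. The number of solutions is never shown to be measurable: it agrees off a null set
    with a measurable function, and the integral of a nonnegative function, being a lower integral,
    tolerates this. The two sides of the theorem involve different numbers of coefficients, so Gram
    matrices are compared after padding with idle Gaussian coordinates. *)

Definition rV_display : measure_display. Proof. exact. Qed.

Section measurable_rV.
Context (R : realType) (n : nat).

Let coors : 'I_n -> 'rV[R]_n -> R := fun i x => x 0 i.

Let rV_set0 : g_sigma_preimage coors set0.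
Proof. exact: sigma_algebra0. Qed.

Let rV_setC A : g_sigma_preimage coors A -> g_sigma_preimage coors (~` A).
Proof. by move=> mA; rewrite -setTD; exact: sigma_algebraCD. Qed.

Let rV_bigcup (F : _^nat) : (forall i, g_sigma_preimage coors (F i)) ->
  g_sigma_preimage coors (\bigcup_i (F i)).
Proof. exact: sigma_algebra_bigcup. Qed.

HB.instance Definition _ := @isMeasurable.Build rV_display
  'rV[R]_n (g_sigma_preimage coors) rV_set0 rV_setC rV_bigcup.

End measurable_rV.

Section measurable_rV_theory.
Context (R : realType).

Lemma measurable_coord n (i : 'I_n) :
  measurable_fun [set: 'rV[R]_n] (fun x : 'rV[R]_n => x 0 i).
Proof.
move=> _ Y mY; rewrite setTI; apply: sub_sigma_algebra => /=.
rewrite -bigcup_seq/=; exists i => /=; first by rewrite mem_index_enum.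
by exists Y => //; rewrite setTI.
Qed.

Lemma measurable_fun_rVP d (T : measurableType d) n (f : T -> 'rV[R]_n) :
  (forall i, measurable_fun [set: T] (fun x => f x 0 i)) ->
  measurable_fun [set: T] f.
Proof.
move=> mf _ A mA; rewrite setTI.
suff : @measurable _ 'rV[R]_n `<=` [set B | measurable (f @^-1` B)].
  exact.
apply: smallest_sub.
  split => /=.
  - by rewrite preimage_set0.
  - by move=> B mB; rewrite setTD preimage_setC; exact: measurableC.
  - by move=> B mB; rewrite preimage_bigcup; exact: bigcup_measurable.
rewrite -bigcup_seq/=; apply: bigcup_sub => i _ B [C mC <-] /=.
by rewrite -comp_preimage setTI -[X in measurable X]setTI; exact: mf.
Qed.

Definition rect n (B : 'I_n -> set R) := [set x : 'rV[R]_n | forall i, B i (x 0 i)].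

Definition rects n : set (set 'rV[R]_n) :=
  [set A | exists2 B, (forall i, measurable (B i)) & A = rect B].
Arguments rects : clear implicits.

Lemma rectE n (B : 'I_n -> set R) :
  rect B = \bigcap_(i in [set: 'I_n]) ((fun x : 'rV[R]_n => x 0 i) @^-1` B i).
Proof. by apply/seteqP; split => [x Bx i _|x Bx i]; [exact: Bx|exact: (Bx i)]. Qed.

Lemma measurable_rect n (B : 'I_n -> set R) : (forall i, measurable (B i)) ->
  measurable (rect B).
Proof.
move=> mB; rewrite rectE; apply: fin_bigcap_measurable => // i _.
by rewrite -[X in measurable X]setTI; exact: measurable_coord.
Qed.

Lemma rects_measurable n : rects n `<=` @measurable _ 'rV[R]_n.
Proof. by move=> A [B mB ->]; exact: measurable_rect. Qed.

Lemma rects_setI n : setI_closed (rects n).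
Proof.
move=> _ _ [B mB ->] [C mC ->]; exists (fun i => B i `&` C i).
  by move=> i; exact: measurableI.
by apply/seteqP; split => [x [xB xC] i|x BC]; split => // i; case: (BC i).
Qed.

Lemma rects_generate n : @measurable _ 'rV[R]_n = <<s rects n >>.
Proof.
apply/seteqP; split; last first.
  apply: smallest_sub; last exact: rects_measurable.
  exact: sigma_algebra_measurable.
apply: smallest_sub; first exact: smallest_sigma_algebra.
rewrite -bigcup_seq/=; apply: bigcup_sub => i _ B [C mC <-] /=.
apply: sub_sigma_algebra; exists (fun j => if j == i then C else setT).
  by move=> j; case: ifP.
apply/seteqP; split => [x [_ /= Cx] j|x /(_ i)]; last by rewrite eqxx.
by case: eqP => [->|].
Qed.

End measurable_rV_theory.
Arguments rects {R} n.

(** * Push-forwards and sigma-finiteness *)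

Section pushforward_sigma_finite.
Local Open Scope ereal_scope.
Context d1 d2 (T1 : measurableType d1) (T2 : measurableType d2) (R : realType).

Definition pushm (m : {measure set T1 -> \bar R}) (f : T1 -> T2)
    (mf : measurable_fun setT f) : {measure set T2 -> \bar R} :=
  measure_function_pushforward__canonical__measure_function_Measure m mf.

Lemma integral_pushm (m : {measure set T1 -> \bar R}) (f : T1 -> T2)
    (mf : measurable_fun setT f) (h : T2 -> \bar R) :
  measurable_fun setT h -> (forall x, 0 <= h x) ->
  \int[pushm m mf]_y h y = \int[m]_x h (f x).
Proof. by move=> mh h0; rewrite [LHS](ge0_integral_pushforward mf). Qed.

Lemma sigma_finite_prod (m1 : {sigma_finite_measure set T1 -> \bar R})
    (m2 : {sigma_finite_measure set T2 -> \bar R}) :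
  sigma_finite setT (m1 \x m2).
Proof.
have /sigma_finiteP[F [TF ndF Foo]] := sigma_finiteT m1.
have /sigma_finiteP[G [TG ndG Goo]] := sigma_finiteT m2.
exists (fun k => F k `*` G k).
  apply/seteqP; split => // -[x y] _; have : [set: T1] x by [].
  rewrite TF => -[i _ Fx]; have : [set: T2] y by [].
  rewrite TG => -[j _ Gy]; exists (maxn i j) => //; split => /=.
    by move: x Fx; exact/subsetPset/ndF/leq_maxl.
  by move: y Gy; exact/subsetPset/ndG/leq_maxr.
move=> k; have [mF Fk] := Foo k; have [mG Gk] := Goo k.
split; first exact: measurableX.
by rewrite product_measure1E// lte_mul_pinfty// ge0_fin_numE.
Qed.

(** A push-forward can lose sigma-finiteness. The left inverse [g] prevents this: if the sets [H k]
    exhaust the source, their preimages under [g] exhaust the target and have measure [m (H k)]. *)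
Lemma sigma_finite_pushforward (m : {measure set T1 -> \bar R})
    (f : T1 -> T2) (g : T2 -> T1) : sigma_finite setT m -> measurable_fun setT f ->
  measurable_fun setT g -> cancel f g ->
  exists p : {sigma_finite_measure set T2 -> \bar R},
    forall A, p A = m (f @^-1` A).
Proof.
move=> sm mf mg fg.
have sf : sigma_finite setT (pushforward m f).
  have [H TH Hoo] := sm.
  exists (fun k => g @^-1` (H k)).
    by rewrite -preimage_bigcup -TH preimage_setT.
  move=> k; have [mH Hk] := Hoo k; split.
    by rewrite -[X in measurable X]setTI; exact: mg.
  rewrite /pushforward/= -comp_preimage (_ : g \o f = id) //.
  by apply/funext => x /=; rewrite fg.
pose p : {sigma_finite_measure set T2 -> \bar R} :=
  HB.pack (pushforward m f) (Measure_isSigmaFinite.Build _ _ _ (pushforward m f) sf).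
by exists (p mf mf mf).
Qed.

End pushforward_sigma_finite.

(** * Finite powers of a measure on the line *)

Section product_measures.
Local Open Scope ereal_scope.
Context (R : realType).

Lemma row_cons0 n (t : R) (x : 'rV[R]_n) :
  (row_mx t%:M x : 'rV[R]_n.+1) ord0 ord0 = t.
Proof. by rewrite mxE; case: splitP => // j _; rewrite mxE !ord1 eqxx mulr1n. Qed.

Lemma row_consS n (t : R) (x : 'rV[R]_n) i :
  (row_mx t%:M x : 'rV[R]_n.+1) ord0 (lift ord0 i) = x ord0 i.
Proof.
rewrite mxE; case: splitP => [[[|//] ?]//|j]; rewrite lift0 add1n => -[ij].
by congr (x _ _); apply/val_inj.
Qed.

Lemma mem_rect_row n (B : 'I_n.+1 -> set R) (t : R) (x : 'rV[R]_n) :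
  rect B (row_mx t%:M x : 'rV_(1 + n)) <->
  B ord0 t /\ rect (fun i => B (lift ord0 i)) x.
Proof.
split=> [H|[H0 H1] i]; first split.
- by move: (H ord0); rewrite row_cons0.
- by move=> i; move: (H (lift ord0 i)); rewrite row_consS.
- by case: (unliftP ord0 i) => [j ->|->]; rewrite ?row_cons0 ?row_consS//; exact: H1.
Qed.

Lemma ex_prodm (mu : {sigma_finite_measure set R -> \bar R}) n :
  exists p : {sigma_finite_measure set 'rV[R]_n -> \bar R},
   forall B : 'I_n -> set R, (forall i, measurable (B i)) ->
     p (rect B) = \prod_(i < n) mu (B i).
Proof.
elim: n => [|n [p pE]].
  (* There is only the empty row, and every rectangle contains it, in accordance with the empty
     product 1. *)
  exists (@dirac _ 'rV[R]_0 0%R R) => B mB; rewrite big_ord0 /= /dirac indicE.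
  by rewrite mem_set// => -[].
pose f (z : R * 'rV[R]_n) : 'rV[R]_n.+1 := (row_mx z.1%:M z.2 : 'rV_(1 + n)).
pose g (x : 'rV[R]_n.+1) : R * 'rV[R]_n := (x ord0 ord0, rsubmx (x : 'rV_(1 + n))).
have mf : measurable_fun setT f.
  apply: measurable_fun_rVP => i; case: (unliftP ord0 i) => [j ->|->].
    rewrite (_ : (fun _ => _) = (fun x : 'rV[R]_n => x ord0 j) \o snd).
      by apply: measurableT_comp => //; exact: measurable_coord.
    by apply/funext => z; rewrite /f /= row_consS.
  by rewrite (_ : (fun _ => _) = fst)//; apply/funext => z; rewrite /f row_cons0.
have mg : measurable_fun setT g.
  apply/measurable_fun_pairP; split => /=; first exact: measurable_coord.
  apply: measurable_fun_rVP => i.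
  under eq_fun do rewrite /= mxE; exact: measurable_coord.
have fg : cancel f g.
  by case=> t x; rewrite /f /g /= row_mxKr row_cons0.
have [q qE] := sigma_finite_pushforward (sigma_finite_prod mu p) mf mg fg.
exists q => B mB; rewrite qE.
rewrite (_ : _ @^-1` _ = B ord0 `*` rect (fun i => B (lift ord0 i))).
  rewrite [LHS]product_measure1E//; last exact: measurable_rect.
  by rewrite pE// big_ord_recl.
by apply/seteqP; split => -[t x] /mem_rect_row.
Qed.

Definition prodm (mu : {sigma_finite_measure set R -> \bar R}) n :=
  sval (cid (ex_prodm mu n)).

Lemma prodmE (mu : {sigma_finite_measure set R -> \bar R}) n (B : 'I_n -> set R) :
  (forall i, measurable (B i)) -> prodm mu n (rect B) = \prod_(i < n) mu (B i).
Proof. by move=> mB; rewrite /prodm; case: cid => /= p ->. Qed.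

Lemma prode_fin_num n (f : 'I_n -> \bar R) : (forall i, f i \is a fin_num) ->
  \prod_(i < n) f i \is a fin_num.
Proof.
by move=> ff; apply: (big_ind (fun x => x \is a fin_num)) => // x y; exact: fin_numM.
Qed.

(** Rectangles generate the sigma-algebra and are stable under intersection, and the cubes with all
    sides [F k] have finite measure and exhaust the space because [F] increases. Translates,
    concatenated rows and the law of the coefficients are all identified through this criterion. *)
Lemma prodm_unique (mu : {sigma_finite_measure set R -> \bar R}) n
    (m : {measure set 'rV[R]_n -> \bar R}) :
  (forall B : 'I_n -> set R, (forall i, measurable (B i)) ->
     m (rect B) = \prod_(i < n) mu (B i)) ->
  forall A, measurable A -> m A = prodm mu n A.
Proof.
move=> mE A mA; have /sigma_finiteP[F [TF ndF Foo]] := sigma_finiteT mu.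
apply/esym; apply: (measure_unique (rects n) (fun k => rect (fun=> F k))) => //.
- exact: rects_generate.
- exact: rects_setI.
- by move=> k; exists (fun=> F k) => // i; case: (Foo k).
- apply/seteqP; split => // x _.
  have /choice[k kx] : forall i, exists k, F k (x ord0 i).
    move=> i; have : [set: R] (x ord0 i) by [].
    by rewrite TF => -[k _ Fk]; exists k.
  exists (\max_i k i)%N => // i; have := kx i; move: (x ord0 i).
  by apply/subsetPset/ndF; exact: leq_bigmax.
- by move=> _ [B mB ->]; rewrite mE// -prodmE.
- move=> k; rewrite [ltLHS]prodmE; last by move=> i; case: (Foo k).
  by rewrite ltey_eq prode_fin_num// => i; case: (Foo k) => ? ?; rewrite ge0_fin_numE.
Qed.

Lemma mem_rect_row_mx m n (B : 'I_(m + n) -> set R) (x : 'rV[R]_m) (y : 'rV[R]_n) :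
  rect B (row_mx x y) <->
  rect (fun i => B (lshift n i)) x /\ rect (fun i => B (rshift m i)) y.
Proof.
split=> [H|[H0 H1] i]; first split.
- by move=> i; move: (H (lshift n i)); rewrite row_mxEl.
- by move=> i; move: (H (rshift m i)); rewrite row_mxEr.
- rewrite -(fintype.splitK i); case: (fintype.split i) => j /=; rewrite ?row_mxEl ?row_mxEr.
    exact: H0.
  exact: H1.
Qed.

Lemma measurable_row_mx m n :
  measurable_fun setT (fun z : 'rV[R]_m * 'rV[R]_n => row_mx z.1 z.2).
Proof.
apply: measurable_fun_rVP => i; rewrite -(fintype.splitK i); case: (fintype.split i) => j /=.
  under eq_fun do rewrite row_mxEl.
  exact: (measurableT_comp (measurable_coord _)).
under eq_fun do rewrite row_mxEr.
exact: (measurableT_comp (measurable_coord _)).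
Qed.

Lemma prodm_row_mx (mu : {sigma_finite_measure set R -> \bar R}) m n A :
  measurable A ->
  prodm mu (m + n) A =
  (prodm mu m \x prodm mu n) ((fun z => row_mx z.1 z.2) @^-1` A).
Proof.
move=> mA; pose f (z : 'rV[R]_m * 'rV[R]_n) := row_mx z.1 z.2.
have mf : measurable_fun setT f := @measurable_row_mx m n.
apply/esym; apply: (@prodm_unique mu _ (pushm (prodm mu m \x prodm mu n) mf)) => //.
move=> B mB; rewrite /= /pushforward.
rewrite (_ : _ @^-1` _ = rect (fun i => B (lshift n i)) `*`
  rect (fun i => B (rshift m i))).
  rewrite [LHS]product_measure1E; [|exact: measurable_rect..].
  by rewrite [X in X * _]prodmE// [X in _ * X]prodmE// [RHS]big_split_ord.
by apply/seteqP; split => -[x y] /mem_rect_row_mx.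
Qed.

Lemma integral_prodm_row_mx (mu : {sigma_finite_measure set R -> \bar R}) m n
    (h : 'rV[R]_(m + n) -> \bar R) :
  measurable_fun setT h -> (forall x, 0 <= h x) ->
  \int[prodm mu (m + n)]_x h x =
  \int[prodm mu m \x prodm mu n]_z h (row_mx z.1 z.2).
Proof.
move=> mh h0; pose f (z : 'rV[R]_m * 'rV[R]_n) := row_mx z.1 z.2.
have mf : measurable_fun setT f := @measurable_row_mx m n.
rewrite -[RHS](integral_pushm _ mf mh h0).
apply: eq_measure_integral => A mA _; exact: prodm_row_mx.
Qed.

End product_measures.

(** * Lebesgue measure on row vectors and its translation invariance *)

Section lebesgue_rV.
Context (R : realType).

(* [R] and [measurableTypeR R] carry the same Borel sets through distinct
   structures; [leb1] is Lebesgue measure for the canonical structure of [R]. *)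
Lemma measurable_fun_idTR :
  measurable_fun [set: measurableTypeR R] (fun x : measurableTypeR R => x : R).
Proof. by move=> _ B mB; rewrite setTI. Qed.

Lemma ex_leb1 : exists p : {sigma_finite_measure set R -> \bar R},
  forall A, p A = lebesgue_measure A.
Proof.
have mg : measurable_fun [set: R] (fun x : R => x : measurableTypeR R).
  by move=> _ B mB; rewrite setTI.
exact: (sigma_finite_pushforward (sigma_finiteT (@lebesgue_measure R))
  measurable_fun_idTR mg (fun=> erefl)).
Qed.

Definition leb1 := sval (cid ex_leb1).

Lemma leb1E A : leb1 A = lebesgue_measure A.
Proof. by rewrite /leb1; case: cid. Qed.

Lemma integral_leb1 (h : R -> \bar R) : measurable_fun setT h ->
  (forall x, 0 <= h x)%E -> (\int[leb1]_x h x = \int[lebesgue_measure]_x h x)%E.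
Proof.
move=> mh h0; rewrite -[RHS](integral_pushm (@lebesgue_measure R) measurable_fun_idTR mh h0).
by apply: eq_measure_integral => A mA _; rewrite [LHS]leb1E.
Qed.

Lemma integralT_indic d (T : measurableType d) (m : {measure set T -> \bar R}) A :
  measurable A -> (\int[m]_x (\1_A x)%:E = m A)%E.
Proof. by move=> mA; rewrite integral_indic// setIT. Qed.

Definition leb n : {sigma_finite_measure set 'rV[R]_n -> \bar R} := prodm leb1 n.
Arguments leb : clear implicits.

Lemma leb1_shift (v : R) (A : set R) : measurable A ->
  leb1 ((fun x => x + v) @^-1` A) = leb1 A.
Proof.
move=> mA.
have mf : measurable_fun [set: R] (fun x => x + v) by exact: measurable_funD.
have mf' : measurable_fun [set: measurableTypeR R]
  (fun x => x + v : measurableTypeR R) by exact: mf.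
rewrite !leb1E; apply/esym.
apply: (@lebesgue_measure_unique R (pushm (@lebesgue_measure R) mf')) => //.
move=> _ [[a b] _ <-] /=; rewrite /pushforward.
rewrite (_ : _ @^-1` _ = `]a - v, b - v]%classic).
  rewrite !lebesgue_measure_itv/= !lte_fin ltrD2r.
  by case: ifP => // _; rewrite -!EFinB; congr EFin; ring.
by apply/seteqP; split => x /=; rewrite !in_itv/= ltrBlDr lerBrDr.
Qed.

Lemma measurable_rV_add n (v : 'rV[R]_n) : measurable_fun setT (fun x : 'rV[R]_n => x + v).
Proof.
apply: measurable_fun_rVP => i; under eq_fun do rewrite mxE.
by apply: measurable_funD => //; exact: measurable_coord.
Qed.

Lemma leb_shift n (v : 'rV[R]_n) A : measurable A ->
  leb n ((fun x => x + v) @^-1` A) = leb n A.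
Proof.
move=> mA; apply: (@prodm_unique _ leb1 n (pushm (leb n) (measurable_rV_add v))) => //.
move=> B mB /=; rewrite /pushforward.
rewrite (_ : _ @^-1` _ = rect (fun i => (fun x => x + v 0 i) @^-1` B i)); last first.
  by apply/seteqP; split => x /= + i => /(_ i); rewrite mxE.
rewrite [LHS]prodmE; last first.
  move=> i; rewrite -[X in measurable X]setTI; exact: measurable_funD.
by apply: eq_bigr => i _; rewrite leb1_shift.
Qed.

Definition ucube n : set 'rV[R]_n := rect (fun=> `[0, 1[%classic).
Arguments ucube : clear implicits.

Lemma measurable_ucube n : measurable (ucube n).
Proof. by apply: measurable_rect => i; exact: measurable_itv. Qed.

Lemma leb_ucube n : leb n (ucube n) = 1%E.
Proof.
rewrite [LHS]prodmE; last by move=> i; exact: measurable_itv.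
by rewrite big1// => i _; rewrite leb1E lebesgue_measure_itv/= lte_fin ltr01 sube0.
Qed.

(* Tonelli applied to [1_E x * 1_Q (y - x)]. *)
Lemma translation_invariant_leb n (m : {sigma_finite_measure set 'rV[R]_n -> \bar R}) :
  (forall (v : 'rV[R]_n) (A : set 'rV[R]_n), measurable A -> m ((fun x => x + v) @^-1` A) = m A) ->
  forall A, measurable A -> m A = (m (-%R @^-1` ucube n) * leb n A)%E.
Proof.
move=> mshift A mA.
have mQ : measurable (ucube n) by exact: measurable_ucube.
have mN : measurable_fun setT (-%R : 'rV[R]_n -> 'rV[R]_n).
  apply: measurable_fun_rVP => i; under eq_fun do rewrite mxE.
  by apply: measurableT_comp => //; exact: measurable_coord.
have mB : measurable_fun setT (fun z : 'rV[R]_n * 'rV[R]_n => z.2 - z.1).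
  apply: measurable_fun_rVP => i; under eq_fun do rewrite !mxE.
  by apply: measurable_funB; apply: (measurableT_comp (measurable_coord _)).
have mD : measurable_fun setT (fun z : 'rV[R]_n * 'rV[R]_n => z.1 + z.2).
  apply: measurable_fun_rVP => i; under eq_fun do rewrite !mxE.
  by apply: measurable_funD; apply: (measurableT_comp (measurable_coord _)).
have i0 (B C : set 'rV[R]_n) x y : (0 <= (\1_B x * \1_C y : R)%:E)%E.
  by rewrite lee_fin mulr_ge0.
pose h (z : 'rV[R]_n * 'rV[R]_n) : \bar R := (\1_A z.1 * \1_(ucube n) (z.2 - z.1))%:E.
have mh : measurable_fun setT h.
  apply/measurable_EFinP; apply: measurable_funM.
    exact: (measurableT_comp (measurable_indic mA)).
  exact: (measurableT_comp (measurable_indic mQ)).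
have := @fubini_tonelli _ _ _ _ _ m (leb n) h mh (fun z => i0 _ _ _ _).
rewrite (_ : (\int[m]_x _)%E = m A); last first.
  rewrite -[RHS]integralT_indic//; apply: eq_integral => x _.
  rewrite /h /=; under eq_integral do rewrite EFinM.
  rewrite ge0_integralZl_EFin//; last first.
    apply/measurable_EFinP; apply: (measurableT_comp (measurable_indic mQ)).
    exact: measurable_rV_add.
  rewrite (_ : (\int[_]_y _)%E = leb n ((fun y => y - x) @^-1` ucube n)).
    by rewrite [X in (_ * X)%E]leb_shift// leb_ucube mule1.
  rewrite -[RHS]integralT_indic//.
  by rewrite -[X in measurable X]setTI; exact: measurable_rV_add.
move=> ->.
pose k (z : 'rV[R]_n * 'rV[R]_n) : \bar R := (\1_A (z.1 + z.2) * \1_(-%R @^-1` ucube n) z.1)%:E.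
have mNQ : measurable (-%R @^-1` ucube n).
  by rewrite -[X in measurable X]setTI; exact: mN.
have mk : measurable_fun setT k.
  apply/measurable_EFinP; apply: measurable_funM.
    exact: (measurableT_comp (measurable_indic mA)).
  exact: (measurableT_comp (measurable_indic mNQ)).
transitivity (\int[leb n]_y \int[m]_z k (z, y))%E.
  apply: eq_integral => y _.
  (* Invariance of [m] allows the substitution of [x + y] for [x]. The integrand becomes the
     indicator of [A] at [x + y] times that of the cube at [- x]; integrating in [y] first leaves
     [leb n A] and the constant. *)
  have -> : (\int[m]_x h (x, y) = \int[pushm m (measurable_rV_add y)]_x h (x, y))%E.
    apply: eq_measure_integral => B mB' _; exact/esym/mshift.
  rewrite integral_pushm; [|exact: (measurable_fun_pair1 _ mh)|by move=> x; exact: i0].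
  apply: eq_integral => x _; rewrite /h /k /=; congr (_ * _)%:E.
  by rewrite !indicE /= opprD addrCA subrr addr0.
rewrite -fubini_tonelli//; last by move=> z; exact: i0.
transitivity (\int[m]_x ((\1_(-%R @^-1` ucube n) x)%:E * leb n A))%E.
  apply: eq_integral => x _; rewrite /k /=; under eq_integral do rewrite EFinM muleC.
  rewrite ge0_integralZl_EFin//; last first.
    apply/measurable_EFinP; apply: (measurableT_comp (measurable_indic mA)).
    rewrite (_ : +%R x = fun y => y + x); first exact: measurable_rV_add.
    by apply/funext => y; rewrite addrC.
  congr (_ * _)%E; rewrite -[RHS](leb_shift x)// -[RHS]integralT_indic.
    by apply: eq_integral => y _; rewrite !indicE /= addrC.
  by rewrite -[X in measurable X]setTI; exact: measurable_rV_add.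
rewrite ge0_integralZr//; first by rewrite integralT_indic.
exact/measurable_EFinP/measurable_indic.
Qed.

End lebesgue_rV.
Arguments leb {R} n.
Arguments ucube {R} n.

(** * Lebesgue measure and linear maps *)

Section lebesgue_linear.
Context (R : realType) (n : nat).
Implicit Types (T S : 'M[R]_n) (A : set 'rV[R]_n).

Lemma measurable_mulmx m (T : 'M[R]_(m, n)) :
  measurable_fun setT (fun x : 'rV[R]_m => x *m T).
Proof.
apply: measurable_fun_rVP => i; under eq_fun do rewrite mxE.
apply: measurable_sum => j; apply: measurable_funM => //; exact: measurable_coord.
Qed.

Lemma measurable_preimage_mulmx T A : measurable A ->
  measurable ((fun x : 'rV[R]_n => x *m T) @^-1` A).
Proof. by move=> mA; rewrite -[X in measurable X]setTI; exact: measurable_mulmx. Qed.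

(** The push-forward by an invertible [T] is again translation invariant, so it is a multiple of
    [leb n]. At this point the constant may still be infinite. *)
Lemma leb_mulmx_ex T : T \in unitmx -> exists2 c : \bar R, (0 <= c)%E &
  forall A, measurable A ->
  leb n ((fun x : 'rV[R]_n => x *m T) @^-1` A) = (c * leb n A)%E.
Proof.
move=> uT; have [p pE] := sigma_finite_pushforward (sigma_finiteT (leb n))
  (measurable_mulmx T) (measurable_mulmx (invmx T)) (mulmxK uT).
exists (p (-%R @^-1` ucube n)); first exact: measure_ge0.
move=> A mA; rewrite -pE; apply: translation_invariant_leb => // v B mB.
have mTB := measurable_preimage_mulmx T mB.
rewrite [LHS]pE [RHS]pE -[RHS](leb_shift (v *m invmx T) mTB).
congr (leb n _); apply/seteqP; split => x /=; rewrite mulmxDl mulmxKV//.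
Qed.

(** The factor by which taking preimages under [T] scales volume. By [lcP], [fine] truncates nothing
    when [T] is invertible. *)
Definition lc T := fine (leb n ((fun x : 'rV[R]_n => x *m T) @^-1` ucube n)).

Lemma mule_eq1 (a b : \bar R) : (0 <= a)%E -> (0 <= b)%E -> (a * b = 1)%E ->
  exists2 r : R, 0 < r & a = r%:E.
Proof.
case: a b => [a| |] [b| |]//; rewrite ?lee_fin => a0 b0.
- rewrite -EFinM => -[ab]; exists a => //; rewrite lt_neqAle a0 andbT eq_sym.
  by apply/eqP => a00; move: ab; rewrite a00 mul0r => /esym/eqP; rewrite oner_eq0.
- have [->|a1] := eqVneq a 0; first by rewrite mul0e => -[/esym/eqP]; rewrite oner_eq0.
  by rewrite gt0_muley// lte_fin lt_neqAle eq_sym a1.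
- have [->|b1] := eqVneq b 0; first by rewrite mule0 => -[/esym/eqP]; rewrite oner_eq0.
  by rewrite gt0_mulye// lte_fin lt_neqAle eq_sym b1.
Qed.

(** The constants of [T] and of its inverse multiply to 1, which excludes 0 and infinity for
    both. *)
Lemma lcP T : T \in unitmx -> 0 < lc T /\
  forall A, measurable A ->
  leb n ((fun x : 'rV[R]_n => x *m T) @^-1` A) = ((lc T)%:E * leb n A)%E.
Proof.
move=> uT; have [c c0 cE] := leb_mulmx_ex uT.
have uT' : invmx T \in unitmx by rewrite unitmx_inv.
have [c' c'0 c'E] := leb_mulmx_ex uT'.
have mQ : measurable (@ucube R n) by exact: measurable_ucube.
have cc' : (c * c' = 1)%E.
  have := c'E _ mQ; rewrite leb_ucube mule1 => <-.
  rewrite -cE; last exact: measurable_preimage_mulmx.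
  rewrite -[RHS](leb_ucube R n); congr (leb n _).
  by apply/seteqP; split => x /=; rewrite mulmxK.
have [r r0 cr] := mule_eq1 c0 c'0 cc'.
have -> : lc T = r by rewrite /lc cE// leb_ucube mule1 cr.
by split=> // A mA; rewrite cE// cr.
Qed.

Lemma lc1 : lc 1%:M = 1.
Proof.
rewrite /lc (_ : _ @^-1` _ = ucube n) ?leb_ucube//.
by apply/seteqP; split => x /=; rewrite mulmx1.
Qed.

Lemma lcM T S : T \in unitmx -> S \in unitmx -> lc (T *m S) = lc T * lc S.
Proof.
move=> uT uS; have [_ TE] := lcP uT; have [_ SE] := lcP uS.
have mQ : measurable (@ucube R n) by exact: measurable_ucube.
rewrite {1}/lc (_ : _ @^-1` _ = (fun x => x *m T) @^-1` ((fun x => x *m S) @^-1` ucube n)).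
  rewrite TE; last exact: measurable_preimage_mulmx.
  by rewrite SE// leb_ucube mule1.
by apply/seteqP; split => x /=; rewrite mulmxA.
Qed.

Lemma lc_perm (s : 'S_n) : lc (perm_mx s) = 1.
Proof.
rewrite /lc (_ : _ @^-1` _ = ucube n) ?leb_ucube//.
have E (x : 'rV[R]_n) i : (x *m perm_mx s) 0 i = x 0 ((s^-1)%g i).
  by rewrite -{1}[s]invgK -col_permE mxE.
apply/seteqP; split => x /= Qx i; last by rewrite E; exact: Qx.
by have := Qx (s i); rewrite E permK.
Qed.

(* Conjugation by [diag (e ^ w i)] makes the off-diagonal entries small without
   changing [lc]. *)
Lemma lc_triangular_eps T (w : 'I_n -> nat) (e : R) : T \in unitmx ->
  (forall i j, i != j -> (w i <= w j)%N -> T i j = 0) -> 0 < e -> e <= 1 ->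
  1 <= lc T * \prod_j (`|T j j| + 2 * (n%:R * (e * \sum_i \sum_j `|T i j|))).
Proof.
move=> uT hT e0 e1; set M := \sum_i _.
have TM i j : `|T i j| <= M.
  rewrite /M (bigD1 i)//= (bigD1 j)//= -addrA lerDl addr_ge0 ?sumr_ge0// => k _.
  by rewrite sumr_ge0.
have M0 : 0 <= M by rewrite sumr_ge0// => i _; rewrite sumr_ge0.
set d := n%:R * _.
have d0 : 0 <= d by rewrite !mulr_ge0// ltW.
pose D := diag_mx (\row_i (e ^+ w i)); pose D' := diag_mx (\row_i (e ^- w i)).
have DD' : D *m D' = 1%:M.
  rewrite /D /D' mulmx_diag; apply/matrixP => i j; rewrite !mxE.
  by rewrite divff// expf_neq0// gt_eqF.
have uD : D \in unitmx by case: (mulmx1_unit DD').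
have uD' : D' \in unitmx by case: (mulmx1_unit DD').
pose T' := D *m T *m D'.
have T'E i j : T' i j = e ^+ w i * T i j / e ^+ w j.
  by rewrite /T' mul_mx_diag mxE mul_diag_mx !mxE.
have T'd i : T' i i = T i i by rewrite T'E mulrAC divff ?mul1r// expf_neq0// gt_eqF.
have T'o i j : i != j -> `|T' i j| <= e * M.
  move=> ij; rewrite T'E; have [ww|ww] := leqP (w i) (w j).
    by rewrite hT// mulr0 mul0r normr0 mulr_ge0// ltW.
  rewrite -(subnK ww) addnS exprS exprD !normrM normfV.
  rewrite (ger0_norm (ltW e0)) !(ger0_norm (exprn_ge0 _ (ltW e0))).
  rewrite (_ : _ / _ = e * (e ^+ (w i - (w j).+1) * `|T i j|)); last first.
    by field; rewrite expf_neq0// gt_eqF.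
  rewrite ler_pM2l// -[leRHS]mul1r ler_pM// ?exprn_ge0 ?exprn_ile1// ltW//.
have lcT' : lc T' = lc T.
  rewrite /T' !lcM ?unitmx_mul ?uD// mulrAC -lcM// DD' lc1 mul1r//.
have uT' : T' \in unitmx by rewrite !unitmx_mul uD uT uD'.
(* This box contains the image of the unit cube under [T']: coordinate [j] of [x *m T'] is [T j j]
   times a number between 0 and 1, plus an off-diagonal sum of size at most [d]. *)
pose B (j : 'I_n) := `[Num.min 0 (T j j) - d, Num.max 0 (T j j) + d]%classic.
have mB : measurable (rect B) by apply: measurable_rect => j; exact: measurable_itv.
have [c0 cE] := lcP uT'.
have lebB : leb n (rect B) = (\prod_j (`|T j j| + 2 * d))%:E.
  rewrite [LHS]prodmE; last by move=> j; exact: measurable_itv.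
  rewrite -prodEFin; apply: eq_bigr => j _.
  rewrite leb1E lebesgue_measure_itv/= lte_fin.
  have [t0|t0] := leP 0 (T j j).
    rewrite ger0_norm// -EFinB; case: ltP => h; congr EFin; first by ring.
    by move: h; lra.
  rewrite ltr0_norm// -EFinB; case: ltP => h; congr EFin; first by ring.
  by move: h; lra.
rewrite -lee_fin EFinM -lebB -lcT' -cE// -(leb_ucube R n).
apply: le_measure; rewrite ?inE; [exact: measurable_ucube|exact: measurable_preimage_mulmx|].
move=> x Qx j; rewrite /B /= in_itv /= mxE (bigD1 j)//= T'd.
have xj i : 0 <= x 0 i <= 1.
  by have := Qx i; rewrite /= in_itv/= => /andP[-> /ltW ->].
set s := \sum_(i | _) _.
have sd : `|s| <= d.
  apply: le_trans (ler_norm_sum _ _ _) _; rewrite /d.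
  apply: (@le_trans _ _ (\sum_(i < n | i != j) e * M)).
    apply: ler_sum => i ij; rewrite normrM -[leRHS]mul1r; apply: ler_pM => //.
      by case/andP: (xj i) => ? ?; rewrite ger0_norm.
    exact: T'o.
  rewrite sumr_const -[leLHS]mulr_natl; apply: ler_wpM2r.
    by rewrite mulr_ge0// ltW.
  rewrite ler_nat.
  by rewrite -[X in (_ <= X)%N]card_ord max_card.
have := xj j; move: sd; rewrite ler_norml => /andP[s1 s2] /andP[x1 x2].
have [t0|t0] := leP 0 (T j j); apply/andP; split; nra.
Qed.

(** Letting [e] tend to 0 in [lc_triangular_eps] removes the off-diagonal error, the bound being a
    polynomial in it. The weight [w] treats lower and upper triangular matrices at once. *)
Lemma lc_triangular T (w : 'I_n -> nat) : T \in unitmx ->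
  (forall i j, i != j -> (w i <= w j)%N -> T i j = 0) ->
  1 <= lc T * \prod_j `|T j j|.
Proof.
move=> uT hT; have [c0 _] := lcP uT; rewrite leNgt; apply/negP => lt1.
pose p : {poly R} := \prod_j ('X + `|T j j|%:P).
have pE x : p.[x] = \prod_j (`|T j j| + x).
  by rewrite horner_prod; apply: eq_bigr => j _; rewrite !hornerE addrC.
have : p.[x] @[x --> (0:R)] --> p.[0] by exact: continuous_horner.
rewrite pE; under eq_bigr do rewrite addr0.
move=> /cvgr_lt /(_ (lc T)^-1).
rewrite -ltr_pdivlMl ?mulr1 in lt1 => // /(_ lt1) /nbhs_ballP[r /= r0 rP].
pose M := \sum_i \sum_j `|T i j|.
have M0 : 0 <= M by rewrite sumr_ge0// => i _; rewrite sumr_ge0.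
pose k := 2 * (n%:R * M) + 1.
have k0 : 0 < k by rewrite ltr_wpDl// !mulr_ge0.
pose e := Num.min 1 (r / (2 * k)).
have e0 : 0 < e by rewrite lt_min ltr01 divr_gt0// mulr_gt0.
have e1 : e <= 1 by rewrite ge_min lexx.
have er : e <= r / (2 * k) by rewrite ge_min lexx orbT.
have := lc_triangular_eps uT hT e0 e1; rewrite -/M leNgt => /negP; apply.
rewrite -ltr_pdivlMl// mulr1 -pE; apply: rP => /=.
rewrite /ball /= sub0r normrN ger0_norm; last by rewrite !mulr_ge0// ltW.
apply: (@le_lt_trans _ _ (k * e)).
  by rewrite (_ : k * e = 2 * (n%:R * (e * M)) + e) ?lerDl 1?ltW//; rewrite /k; ring.
apply: (@le_lt_trans _ _ (k * (r / (2 * k)))); first by rewrite ler_pM2l.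
rewrite (_ : k * _ = r / 2) ?ltr_pdivrMr ?ltr_pMr ?ltr1n//.
by field; rewrite gt_eqF.
Qed.

End lebesgue_linear.

(** * The scaling factor is the inverse of the absolute determinant *)

Section lebesgue_det.
Context (R : realType).

(** An LUP factorisation reduces this to triangular factors, since a permutation preserves the unit
    cube. One inequality is enough, because it will be applied to the inverse matrix as well. *)
Lemma lc_det_ge1 n (T : 'M[R]_n) : T \in unitmx -> 1 <= lc T * `|\det T|.
Proof.
case: n T => [|n] T uT.
  by rewrite det_mx00 normr1 mulr1 (_ : T = 1%:M) ?lc1//; apply/matrixP => -[].
have := cormen_lup_correct T; have := cormen_lup_perm T.
have := @cormen_lup_lower _ _ T; have := @cormen_lup_upper _ _ T.
have := cormen_lup_detL T.
case: cormen_lup => -[P L] U /= dL Uup Llow /existsP[s /eqP ->] PT.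
have uL : L \in unitmx by rewrite unitmxE dL unitr1.
have uP : perm_mx s \in @unitmx R n.+1 by exact: unitmx_perm.
have uU : U \in unitmx.
  have : L *m U \in unitmx by rewrite -[L *m U]PT [_ * T]/(_ *m T) unitmx_mul uP.
  by rewrite unitmx_mul uL.
have lcT : lc T = lc L * lc U.
  by rewrite -lcM// -[L *m U]PT [_ * T]/(_ *m T) lcM// lc_perm mul1r.
have dT : `|\det T| = `|\det L| * `|\det U|.
  rewrite -normrM -det_mulmx -[L *m U]PT [_ * T]/(_ *m T) det_mulmx det_perm.
  by rewrite normrM normrX normrN1 expr1n mul1r.
have dU : `|\det U| = \prod_j `|U j j|.
  rewrite -det_tr det_trig; last first.
    by apply/is_trig_mxP => i j ij; rewrite mxE Uup.
  by rewrite normr_prod; apply: eq_bigr => j _; rewrite mxE.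
have dL' : `|\det L| = \prod_j `|L j j|.
  by rewrite dL normr1 big1// => j _; rewrite Llow// eqxx normr1.
have L1 : 1 <= lc L * \prod_j `|L j j|.
  apply: (@lc_triangular _ _ _ (fun i => i)) => // i j ij wij.
  by rewrite Llow// (negbTE ij).
have U1 : 1 <= lc U * \prod_j `|U j j|.
  (* The weight [n - i] reverses the order of the indices, as an upper triangular matrix
     requires. *)
  apply: (@lc_triangular _ _ _ (fun i => n - i)%N) => // i j ij wij.
  rewrite Uup// ltn_neqAle eq_sym ij /=.
  by move: wij; rewrite leq_sub2lE// -ltnS.
by rewrite lcT dT mulrACA dU dL'; have := ler_pM ler01 ler01 L1 U1; rewrite mulr1.
Qed.

(** Both [lc] and the determinant turn into their reciprocals when [T] is inverted, so [lc_det_ge1]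
    for [invmx T] is the opposite inequality for [T]. *)
Lemma lcE n (T : 'M[R]_n) : T \in unitmx -> lc T = `|\det T|^-1.
Proof.
move=> uT; have uT' : invmx T \in unitmx by rewrite unitmx_inv.
have := lc_det_ge1 uT; have := lc_det_ge1 uT'; rewrite det_inv normfV.
have [c0 _] := lcP uT; have [c'0 _] := lcP uT'.
have cc : lc T * lc (invmx T) = 1 by rewrite -lcM// mulmxV// lc1.
have d0 : 0 < `|\det T| by rewrite normr_gt0 -unitfE -unitmxE.
move=> h1 h2; have cV : lc (invmx T) = (lc T)^-1.
  by apply: (mulfI (lt0r_neq0 c0)); rewrite cc divff// gt_eqF.
apply/eqP; rewrite eq_le; apply/andP; split.
  rewrite cV -invfM in h1; rewrite -(@ler_pM2r _ `|\det T|)// mulVf ?gt_eqF//.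
  by rewrite -invf_ge1 ?mulr_gt0// mulrC.
by rewrite -(@ler_pM2r _ `|\det T|)// mulVf ?gt_eqF.
Qed.

Lemma leb_mulmx n (T : 'M[R]_n) A : T \in unitmx -> measurable A ->
  leb n ((fun x : 'rV[R]_n => x *m T) @^-1` A) = (`|\det T|^-1%:E * leb n A)%E.
Proof. by move=> uT mA; rewrite -lcE//; case: (lcP uT) => _ ->. Qed.

Lemma integral_leb_mulmx n (T : 'M[R]_n) (h : 'rV[R]_n -> \bar R) :
  T \in unitmx -> measurable_fun setT h -> (forall x, 0 <= h x)%E ->
  (\int[leb n]_x h (x *m T) = `|\det T|^-1%:E * \int[leb n]_x h x)%E.
Proof.
move=> uT mh h0; rewrite -(integral_pushm (leb n) (measurable_mulmx T) mh h0).
have d0 : 0 <= `|\det T|^-1 by rewrite invr_ge0.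
rewrite -(ge0_integral_mscale (leb n) measurableT (NngNum d0))//.
by apply: eq_measure_integral => A mA _; rewrite [LHS]leb_mulmx.
Qed.

End lebesgue_det.

(** * Locally Lipschitz maps and dyadic cells *)

Section matrix_norm.
Context (R : realType).

Lemma coord_le_norm m n (x : 'M[R]_(m, n)) i j : `|x i j| <= `|x|.
Proof.
rewrite [leRHS]mx_normrE.
exact: (le_bigmax 0 (fun ij : 'I_m * 'I_n => `|x ij.1 ij.2|) (i, j)).
Qed.

Lemma norm_le_coord m n (x : 'M[R]_(m, n)) e : 0 <= e ->
  (forall i j, `|x i j| <= e) -> `|x| <= e.
Proof.
by move=> e0 xe; rewrite [leLHS]mx_normrE; apply/bigmax_leP; split => // -[i j] _.
Qed.

(** The norm is the largest absolute value of an entry; it is not submultiplicative, and the sum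
    over the inner index costs the factor [n]. *)
Lemma norm_mulmx m n p (v : 'M[R]_(m, n)) (A : 'M[R]_(n, p)) :
  `|v *m A| <= n%:R * (`|v| * `|A|).
Proof.
apply: norm_le_coord => [|i j]; first by rewrite !mulr_ge0.
rewrite mxE; apply: le_trans (ler_norm_sum _ _ _) _.
apply: (@le_trans _ _ (\sum_(k < n) (`|v| * `|A|))); last first.
  by rewrite sumr_const card_ord -[leLHS]mulr_natl.
by apply: ler_sum => k _; rewrite normrM ler_pM// coord_le_norm.
Qed.

End matrix_norm.

Section local_lipschitz.
Context (R : realType) (n : nat).
Implicit Types (f g : 'rV[R]_n -> R) (x y : 'rV[R]_n).

(** Lipschitz on every ball about 0, which in finite dimension is local Lipschitz continuity in a
    form that gives one constant on each compact set. *)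
Definition loclip f := forall r : R, exists2 C, 0 <= C &
  forall x y, `|x| <= r -> `|y| <= r -> `|f x - f y| <= C * `|x - y|.

Lemma loclip_cst c : loclip (fun=> c).
Proof. by move=> r; exists 0 => // x y _ _; rewrite subrr normr0 mul0r. Qed.

Lemma loclipD f g : loclip f -> loclip g -> loclip (fun x => f x + g x).
Proof.
move=> lf lg r; have [C C0 fC] := lf r; have [D D0 gD] := lg r.
exists (C + D) => [|x y xr yr]; first exact: addr_ge0.
rewrite (_ : _ - _ = (f x - f y) + (g x - g y)); last by ring.
by rewrite mulrDl; apply: le_trans (ler_normD _ _) _; rewrite lerD ?fC ?gD.
Qed.

Lemma loclip_bounded f : loclip f -> forall r, exists2 B, 0 <= B &
  forall x, `|x| <= r -> `|f x| <= B.
Proof.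
move=> lf r; have [r0|r0] := leP 0 r; last first.
  by exists 0 => // x xr; have := le_trans (normr_ge0 x) xr; rewrite leNgt r0.
have [C C0 fC] := lf r; exists (`|f 0| + C * r) => [|x xr].
  by rewrite addr_ge0// mulr_ge0.
rewrite -[f x](subrK (f 0)) addrC; apply: le_trans (ler_normD _ _) _.
rewrite lerD2l; apply: le_trans (fC x 0 _ _) _ => //; first by rewrite normr0.
by rewrite subr0 ler_wpM2l.
Qed.

Lemma loclipM f g : loclip f -> loclip g -> loclip (fun x => f x * g x).
Proof.
move=> lf lg r; have [C C0 fC] := lf r; have [D D0 gD] := lg r.
have [A A0 fA] := loclip_bounded lf r; have [B B0 gB] := loclip_bounded lg r.
exists (A * D + B * C) => [|x y xr yr]; first by rewrite addr_ge0// mulr_ge0.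
rewrite (_ : _ - _ = f x * (g x - g y) + g y * (f x - f y)); last by ring.
apply: le_trans (ler_normD _ _) _; rewrite mulrDl !normrM -!mulrA lerD//.
  by rewrite ler_pM ?fA ?gD.
by rewrite ler_pM ?gB ?fC.
Qed.

Lemma loclip_sum (I : Type) (s : seq I) (P : pred I) (F : I -> 'rV[R]_n -> R) :
  (forall i, loclip (F i)) -> loclip (fun x => \sum_(i <- s | P i) F i x).
Proof.
move=> lF; elim: s => [|i s IH].
  by under [X in loclip X]eq_fun do rewrite big_nil; exact: loclip_cst.
under [X in loclip X]eq_fun do rewrite big_cons.
by case: (P i) => //; exact: loclipD.
Qed.

Lemma loclip_prod (I : Type) (s : seq I) (P : pred I) (F : I -> 'rV[R]_n -> R) :
  (forall i, loclip (F i)) -> loclip (fun x => \prod_(i <- s | P i) F i x).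
Proof.
move=> lF; elim: s => [|i s IH].
  by under [X in loclip X]eq_fun do rewrite big_nil; exact: loclip_cst.
under [X in loclip X]eq_fun do rewrite big_cons.
by case: (P i) => //; exact: loclipM.
Qed.

Lemma loclip_det p (M : 'rV[R]_n -> 'M[R]_p) :
  (forall i j, loclip (fun x => M x i j)) -> loclip (fun x => \det (M x)).
Proof.
move=> lM; apply: loclip_sum => s; apply: loclipM; first exact: loclip_cst.
by apply: loclip_prod => i; exact: lM.
Qed.

Lemma loclip_continuous f : loclip f -> continuous f.
Proof.
move=> lf x; have [C C0 fC] := lf (`|x| + 1); apply/(@cvgrPdist_lt _ _ _ (nbhs x) (nbhs_filter x)) => e e0.
apply/nbhs_ballP; exists (Num.min 1 (e / (C + 1))) => /=.
  by rewrite lt_min ltr01 divr_gt0// ltr_wpDl.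
move=> y; rewrite -ball_normE /= lt_min => /andP[xy1 xye].
apply: le_lt_trans (fC x y _ _) _; first by rewrite lerDl.
  rewrite -[y](subrK x) addrC; apply: le_trans (ler_normD _ _) _.
  by rewrite lerD2l distrC ltW.
apply: (@le_lt_trans _ _ ((C + 1) * `|x - y|)).
  by rewrite ler_wpM2r// lerDl.
by rewrite mulrC -ltr_pdivlMr// ltr_wpDl.
Qed.

End local_lipschitz.

(** * Dyadic cells and Borel sets *)

Section dyadic_grid.
Context (R : realType) (n : nat).
Implicit Types (x y : 'rV[R]_n) (m j : nat).

Definition gidx m x : {ffun 'I_n -> int} := [ffun i => Num.floor (2 ^+ m * x 0 i)].

(** Numbering the cells through [pickle] makes series over cells available. Numbers that code no
    index vector give the empty cell, whence the case distinction in [gcell_empty_or]. *)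
Definition gcell m j : set 'rV[R]_n := [set x | pickle (gidx m x) = j].

Definition gitv m (k : int) : set R := `[k%:~R / 2 ^+ m, (k + 1)%:~R / 2 ^+ m[%classic.

Lemma gidxP m x i : gitv m (gidx m x i) (x 0 i).
Proof.
rewrite /gitv /= in_itv /= ffunE ler_pdivrMr ?exprn_gt0// ltr_pdivlMr ?exprn_gt0//.
by rewrite [x 0 i * _]mulrC floor_itv.
Qed.

Lemma gcellE m x : gcell m (pickle (gidx m x)) = rect (fun i => gitv m (gidx m x i)).
Proof.
apply/seteqP; split => y.
  by move=> /(pcan_inj (@pickleK _)) <- i; exact: gidxP.
move=> yx; congr pickle; apply/ffunP => i; rewrite [LHS]ffunE; apply: floor_def.
have := yx i; rewrite /gitv /= in_itv /= ler_pdivrMr ?exprn_gt0//.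
by rewrite ltr_pdivlMr ?exprn_gt0// [y 0 i * _]mulrC.
Qed.

Lemma gcell_trivIset m : trivIset setT (gcell m).
Proof. by move=> i j _ _ [x [<- <-]]. Qed.

Lemma gcell_bigcup m : \bigcup_j gcell m j = setT.
Proof. by apply/seteqP; split => // x _; exists (pickle (gidx m x)). Qed.

Lemma gcell_empty_or m j : gcell m j = set0 \/
  exists x, gcell m j = rect (fun i => gitv m (gidx m x i)).
Proof.
have [[x xj]|ne] := pselect (gcell m j !=set0).
  by right; exists x; rewrite -xj gcellE.
by left; apply/seteqP; split => // x xj; apply: ne; exists x.
Qed.

Lemma measurable_gcell m j : measurable (gcell m j).
Proof.
have [->|[x ->]] := gcell_empty_or m j; first exact: measurable0.
by apply: measurable_rect => i; exact: measurable_itv.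
Qed.

Lemma leb1_gitv m k : leb1 R (gitv m k) = (2 ^- m)%:E.
Proof.
rewrite leb1E lebesgue_measure_itv /= lte_fin ltr_pM2r ?invr_gt0 ?exprn_gt0//.
rewrite ltr_int ltrDl -EFinB; congr EFin.
by rewrite -mulrBl intrD addrC addKr mul1r.
Qed.

Lemma leb_gcell m j : gcell m j !=set0 -> leb n (gcell m j) = ((2 ^- m) ^+ n)%:E.
Proof.
case=> x <-; rewrite gcellE [LHS]prodmE; last by move=> i; exact: measurable_itv.
under eq_bigr do rewrite leb1_gitv.
by rewrite prodEFin big_const_ord iter_mulr_1.
Qed.

Lemma gcell_dist m j x y : gcell m j x -> gcell m j y -> `|x - y| <= 2 ^- m.
Proof.
move=> xj yj; apply: norm_le_coord => [|i k]; first by rewrite invr_ge0 exprn_ge0.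
rewrite !mxE ord1; have := gidxP m x k; have := gidxP m y k.
have -> : gidx m y = gidx m x by apply: (pcan_inj (@pickleK _)); rewrite xj yj.
rewrite /gitv /= !in_itv /= intrD mulrDl mul1r ler_norml.
move=> /andP[? ?] /andP[? ?]; apply/andP; split; lra.
Qed.

(** This gives the nesting of dyadic cells. With [k] the floor of [t], the numbers [2 * k] and
    [2 * k + 2] are integers, so the unit interval with integer endpoints that contains [2 * s] and
    [2 * t] cannot cross them. *)
Lemma floor_half (s t : R) : Num.floor (2 * t) = Num.floor (2 * s) ->
  Num.floor t = Num.floor s.
Proof.
move=> ts; apply/esym/floor_def; have := floor_itv t; set k := Num.floor t.
rewrite intrD => /andP[k1 k2].
have /andP[t1 t2] := floor_itv (2 * t); have /andP[s1 s2] := floor_itv (2 * s).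
rewrite ts in t1 t2; set a := Num.floor (2 * s) in t1 t2 s1 s2.
have a1 : 2 * k <= a.
  rewrite -ltzD1 -(ltr_int R) intrM; apply: le_lt_trans t2.
  by rewrite ler_pM2l.
have a2 : a < 2 * k + 2.
  rewrite -(ltr_int R) intrD intrM; apply: le_lt_trans t1 _.
  have -> : (2%:~R : R) = 2 by []; lra.
have a3 : a + 1 <= 2 * k + 2 by rewrite -ltzD1 ltrD2r.
rewrite -(ler_int R) intrM in a1; rewrite -(ler_int R) !intrD intrM in a3.
move: a1 a3; have -> : (2%:~R : R) = 2 by []; rewrite intrD in s2.
by move=> a1 a3; apply/andP; split; rewrite ?intrD; lra.
Qed.

Lemma gidxS m x y : gidx m.+1 x = gidx m.+1 y -> gidx m x = gidx m y.
Proof.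
move=> /ffunP xy; apply/ffunP => i; have := xy i; rewrite !ffunE !exprS -!mulrA.
exact: floor_half.
Qed.

Lemma gidx_le m m' x y : (m <= m')%N -> gidx m' x = gidx m' y -> gidx m x = gidx m y.
Proof.
elim: m' => [|m' IH]; first by rewrite leqn0 => /eqP ->.
by rewrite leq_eqVlt => /predU1P[->//|]; rewrite ltnS => /IH mm /gidxS.
Qed.

Lemma closed_rect (B : 'I_n -> set R) : (forall i, closed (B i)) -> closed (rect B).
Proof.
move=> cB; rewrite rectE; apply: closed_bigI => i _.
by apply: preimage_closed => // x _; exact: coord_continuous.
Qed.

(** Shrinking the open sides of a half-open cell by [2 ^- p] gives closed boxes that increase to it.
    Continuity from below then carries estimates on closed sets over to cells. *)
Lemma gcell_exhaust m j : exists S : nat -> set 'rV[R]_n,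
  [/\ forall p, closed (S p), {homo S : p q / (p <= q)%N >-> (p <= q)%O} &
      \bigcup_p S p = gcell m j].
Proof.
have [->|[x ->]] := gcell_empty_or m j.
  by exists (fun=> set0); split => //; [move=> p; exact: closed0|exact: bigcup0].
pose a i : R := (gidx m x i)%:~R / 2 ^+ m.
pose b i : R := (gidx m x i + 1)%:~R / 2 ^+ m.
exists (fun p => rect (fun i => `[a i, b i - 2 ^- p]%classic)); split.
- by move=> p; apply: closed_rect => i; exact: itv_closed.
- move=> p q pq; apply/subsetPset => y yp i; have := yp i; rewrite /= !in_itv /=.
  move=> /andP[-> /le_trans ->]//; rewrite lerD2l lerN2 lef_pV2 ?posrE ?exprn_gt0//.
  by rewrite ler_eXn2l ?ltr1n.
- apply/seteqP; split => y.
    move=> [p _ yp] i; have := yp i; rewrite /gitv /= !in_itv /= => /andP[-> yb].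
    by rewrite (le_lt_trans yb)// ltrBlDr ltrDl invr_gt0 exprn_gt0.
  move=> yx.
  have /choice[k yk] : forall i, exists p, y 0 i <= b i - 2 ^- p.
    move=> i; have := yx i; rewrite /gitv /= in_itv /= -/(a i) -/(b i) => /andP[_ yb].
    have d0 : 0 < b i - y 0 i by rewrite subr_gt0.
    have [p _ pd] := near_infty_natSinv_expn_lt (PosNum d0).
    by exists p; have := pd p (leqnn _); rewrite /= div1r; lra.
  exists (\max_i k i)%N => // i; have := yx i.
  rewrite /gitv /= !in_itv /= => /andP[-> _] /=.
  apply: le_trans (yk i) _; rewrite lerD2l lerN2 lef_pV2 ?posrE ?exprn_gt0//.
  by rewrite ler_eXn2l ?ltr1n// leq_bigmax.
Qed.

Lemma exp2N_lt (e : R) : 0 < e -> exists m, 2 ^- m < e.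
Proof.
move=> e0; have [p _ pd] := near_infty_natSinv_expn_lt (PosNum e0).
by exists p; have := pd p (leqnn _); rewrite /= div1r.
Qed.

(** The sigma-algebra is generated by the coordinates. It contains the open sets because an open set
    is the countable union of the dyadic cells inside it. *)
Lemma open_measurable_rV (U : set 'rV[R]_n) : open U -> measurable U.
Proof.
move=> oU; pose V m j := if `[< gcell m j `<=` U >] then gcell m j else set0.
have -> : U = \bigcup_m \bigcup_j V m j.
  apply/seteqP; split => [x Ux|x [m _ [j _]]]; last first.
    by rewrite /V; case: asboolP => // VU /VU.
  move: oU; rewrite openE => /(_ _ Ux) /nbhs_ballP[e /= e0 eU].
  have [m me] := exp2N_lt e0.
  exists m => //; exists (pickle (gidx m x)) => //; rewrite /V.
  case: asboolP => // -[] y xy; apply: eU; rewrite -ball_normE /=.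
  by apply: le_lt_trans me; exact: gcell_dist xy.
apply: bigcup_measurable => m _; apply: bigcup_measurable => j _.
by rewrite /V; case: ifP => _; [exact: measurable_gcell|exact: measurable0].
Qed.

Lemma closed_measurable_rV (U : set 'rV[R]_n) : closed U -> measurable U.
Proof.
move=> cU; rewrite -[U]setCK; apply: measurableC; apply: open_measurable_rV.
exact: closed_openC.
Qed.

Lemma continuous_measurable_rV (f : 'rV[R]_n -> R) : continuous f ->
  measurable_fun setT f.
Proof.
move=> cf; apply: (measurability _ (RGenOInfty.measurableE R)) => // _ [_ [a ->] <-].
rewrite setTI; apply: open_measurable_rV; apply: open_comp => [x _|]; first exact: cf.
exact: interval_open.
Qed.

(** Closed generators are chosen with images in mind: the continuous image of a compact set is
    compact, hence measurable. *)
Lemma measurable_closed : @measurable _ 'rV[R]_n = <<s [set K | closed K] >>.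
Proof.
apply/seteqP; split; last first.
  apply: smallest_sub; first exact: sigma_algebra_measurable.
  by move=> K; exact: closed_measurable_rV.
apply: smallest_sub; first exact: smallest_sigma_algebra.
rewrite -bigcup_seq/=; apply: bigcup_sub => i _ _ [B mB <-] /=; rewrite setTI.
pose G := g_sigma_algebraType [set K : set 'rV[R]_n | closed K].
have : measurable_fun [set: G] (fun x : G => (x : 'rV[R]_n) 0 i).
  apply: (measurability _ (RGenCInfty.measurableE R)) => // _ [_ [a ->] <-].
  rewrite setTI; apply: sub_sigma_algebra => /=; apply: preimage_closed.
    by move=> x _; exact: coord_continuous.
  by rewrite set_itvE; exact: closed_ge.
by move=> /(_ measurableT B mB); rewrite setTI.
Qed.

End dyadic_grid.

(** * Measures given by a density *)

Section density.
Local Open Scope ereal_scope.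
Context d (T : measurableType d) (R : realType) (mu : {measure set T -> \bar R}).
Variables (g : T -> \bar R) (mg : measurable_fun setT g) (g0 : forall x, 0 <= g x).

Let dens_fun (A : set T) := \int[mu]_(x in A) g x.

Let dens0 : dens_fun set0 = 0. Proof. exact: integral_set0. Qed.

Let dens_ge0 A : 0 <= dens_fun A. Proof. exact: integral_ge0. Qed.

Let dens_sigma_additive : semi_sigma_additive dens_fun.
Proof.
move=> F mF tF mUF; rewrite /dens_fun ge0_integral_bigcup//; last first.
  exact: measurable_funTS.
by apply: is_cvg_ereal_nneg_natsum_cond => k _ _; exact: integral_ge0.
Qed.

Definition dens : {measure set T -> \bar R} :=
  HB.pack dens_fun (isMeasure.Build _ _ _ dens_fun dens0 dens_ge0 dens_sigma_additive).

Lemma densE A : dens A = \int[mu]_(x in A) g x. Proof. by []. Qed.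

Lemma integral_dens_indic A : measurable A ->
  \int[dens]_x (\1_A x)%:E = \int[mu]_x ((\1_A x)%:E * g x).
Proof.
move=> mA; rewrite integral_indic// setIT densE integral_mkcond.
apply: eq_integral => x _; rewrite patchE indicE; case: ifP => _.
  by rewrite mul1e.
by rewrite mul0e.
Qed.

Import HBNNSimple.

Lemma integral_dens_nnsfun (f : {nnsfun T >-> R}) :
  \int[dens]_x (f x)%:E = \int[mu]_x ((f x)%:E * g x).
Proof.
have fE x : (f x)%:E = \sum_(k \in range f) k%:E * (\1_(f @^-1` [set k]) x)%:E.
  by rewrite fsumEFin //= fimfunE.
have mi k : measurable_fun setT (fun x => (\1_(f @^-1` [set k]) x)%:E : \bar R).
  exact/measurable_EFinP/measurable_indic.
under eq_integral do rewrite fE.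
rewrite ge0_integral_fsum//; last 2 first.
  - by move=> k; exact: measurable_funeM.
  - by move=> k x _; exact: nnfun_muleindic_ge0.
transitivity (\int[mu]_x (\sum_(k \in range f) (k%:E * (\1_(f @^-1` [set k]) x)%:E * g x))).
  rewrite ge0_integral_fsum//; last 2 first.
    - by move=> k; apply: emeasurable_funM => //; exact: measurable_funeM.
    - by move=> k x _; apply: mule_ge0 => //; exact: nnfun_muleindic_ge0.
  apply: eq_fsbigr => k; rewrite inE => -[x _ <-].
  under [RHS]eq_integral do rewrite -muleA.
  rewrite !ge0_integralZl//.
  - by rewrite integral_dens_indic.
  - exact: emeasurable_funM.
  - by move=> y _; apply: mule_ge0 => //; rewrite lee_fin.
  - by rewrite lee_fin.
  - by rewrite lee_fin.
apply: eq_integral => x _; rewrite fE ge0_mule_fsuml// => k.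
exact: nnfun_muleindic_ge0.
Qed.

Lemma integral_dens (h : T -> \bar R) : measurable_fun setT h -> (forall x, 0 <= h x) ->
  \int[dens]_x h x = \int[mu]_x (h x * g x).
Proof.
move=> mh h0; pose f_ := nnsfun_approx measurableT mh.
have cvgf x : EFin \o f_^~ x @ \oo --> h x by exact: cvg_nnsfun_approx.
have ndf x : {homo (fun k => (f_ k x)%:E) : a b / (a <= b)%N >-> a <= b}.
  by move=> a b ab; rewrite lee_fin; exact/lefP/nd_nnsfun_approx.
transitivity (limn (fun k => \int[dens]_x (f_ k x)%:E)).
  rewrite -monotone_convergence//.
  - by apply: eq_integral => x _; apply/esym/cvg_lim => //; exact: cvgf.
  - by move=> k; exact/measurable_EFinP.
  - by move=> k x _; rewrite lee_fin.
under eq_fun do rewrite integral_dens_nnsfun.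
rewrite -monotone_convergence//.
- apply: eq_integral => x _; apply/cvg_lim => //.
  (* Multiplication by an infinite density is not continuous at 0. If [h x = 0], all approximations
     vanish at [x]; otherwise they are eventually positive and the products are eventually [+oo]. *)
  have [gx|gx] := eqVneq (g x) +oo; last first.
    by apply: cvgeZr; [rewrite ge0_fin_numE// ltey|exact: cvgf].
  have [hx|hx] := eqVneq (h x) 0.
    rewrite hx mul0e (_ : (fun _ => _) = cst 0); first exact: cvg_cst.
    apply/funext => k; have : (f_ k x)%:E <= h x.
      rewrite -(cvg_lim _ (cvgf x))//; apply: lime_ge.
        by apply/cvg_ex; eexists; exact: cvgf.
      by exists k => // l; exact: ndf.
    rewrite hx lee_fin => fk; have -> : f_ k x = 0%R.
      by apply/eqP; rewrite eq_le fk /=.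
    by rewrite mul0e.
  have hx0 : 0 < h x by rewrite lt0e hx h0.
  rewrite gx gt0_muley//.
  have [N HN] : exists N, 0 < (f_ N x)%:E.
    apply: contrapT => nN; move/eqP: hx; apply; rewrite -(cvg_lim _ (cvgf x))//.
    rewrite (_ : _ \o _ = cst 0); first exact: lim_cst.
    apply/funext => k /=; apply/eqP; rewrite eq_le !lee_fin fun_ge0 andbT leNgt.
    by apply/negP => fk; apply: nN; exists k.
  apply: cvg_near_cst; exists N => // k /= Nk; rewrite gt0_muley//.
  by apply: lt_le_trans HN _; exact: ndf.
- move=> k; apply: emeasurable_funM => //; exact/measurable_EFinP.
- by move=> k x _; rewrite mule_ge0// lee_fin.
- by move=> x _ a b ab; rewrite lee_wpmul2r//; exact: ndf.
Qed.

End density.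

(** * Volume of Lipschitz images *)

Section lipschitz_image.
Context (R : realType) (n : nat).
Implicit Types (K S : set 'rV[R]_n).

Lemma measure_bigcupT d (T : measurableType d) (mu : {measure set T -> \bar R})
    (F : nat -> set T) : (forall k, measurable (F k)) -> trivIset setT F ->
  mu (\bigcup_k F k) = (\sum_(0 <= k <oo) mu (F k))%E.
Proof.
move=> mF tF; rewrite measure_bigcup//; apply: eq_eseriesl => i.
by rewrite in_setT.
Qed.

Lemma measure_split_cells (mu : {measure set 'rV[R]_n -> \bar R}) m S : measurable S ->
  mu S = (\sum_(0 <= j <oo) mu (S `&` gcell m j))%E.
Proof.
move=> mS; rewrite -measure_bigcupT//.
- by rewrite -setI_bigcupr gcell_bigcup setIT.
- by move=> j; apply: measurableI => //; exact: measurable_gcell.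
- by apply: trivIset_setIl; exact: gcell_trivIset.
Qed.

Lemma compact_closed_rV K : compact K -> closed K.
Proof. by apply: compact_closed; exact: norm_hausdorff. Qed.

Lemma compact_measurable_rV K : compact K -> measurable K.
Proof. by move=> /compact_closed_rV; exact: closed_measurable_rV. Qed.

Lemma compact_setI K S : compact K -> closed S -> compact (K `&` S).
Proof. exact: compact_closedI. Qed.

Lemma compact_norm_le K : compact K -> exists2 r : R, 0 < r & forall x, K x -> `|x| <= r.
Proof.
by move=> /compact_bounded /pinfty_ex_gt0[r r0 Kr]; exists r.
Qed.

Lemma leb_box (a : 'I_n -> R) (d : R) : 0 <= d ->
  leb n (rect (fun i => `[a i, a i + d]%classic)) = (d ^+ n)%:E.
Proof.
move=> d0; rewrite [LHS]prodmE; last by move=> i; exact: measurable_itv.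
rewrite (eq_bigr (fun=> d%:E)).
  by rewrite prodEFin big_const_ord iter_mulr_1.
move=> i _; rewrite leb1E lebesgue_measure_itv /= lte_fin ltrDl.
case: ltP => d1; first by rewrite -EFinB addrAC subrr add0r.
by congr EFin; apply/eqP; rewrite eq_le d0.
Qed.

Lemma measurable_box (a : 'I_n -> R) (d : R) :
  measurable (rect (fun i => `[a i, a i + d]%classic)).
Proof. by apply: measurable_rect => i; exact: measurable_itv. Qed.

Lemma compact_leb_fin K : compact K -> (leb n K < +oo)%E.
Proof.
move=> cK; have [r r0 Kr] := compact_norm_le cK.
apply: (@le_lt_trans _ _ (leb n (rect (fun i => `[- r, - r + 2 * r]%classic)))).
  apply: le_measure; rewrite ?inE; [exact: compact_measurable_rV|exact: measurable_box|].
  move=> x /Kr xr i; have := le_trans (coord_le_norm x 0 i) xr.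
  by rewrite /= in_itv /= ler_norml => /andP[? ?]; apply/andP; split; lra.
by rewrite leb_box ?ltry// mulr_ge0// ltW.
Qed.

(** In the maximum norm a diameter of at most [d] bounds the spread of each coordinate by [d], so
    the coordinatewise infima form a corner of the box. *)
Lemma box_cover S (d : R) : S !=set0 -> (forall x y, S x -> S y -> `|x - y| <= d) ->
  exists a : 'I_n -> R, S `<=` rect (fun i => `[a i, a i + d]%classic).
Proof.
move=> [x0 Sx0] Sd; pose E i := [set x 0 i | x in S].
have lbE x i : S x -> lbound (E i) (x 0 i - d).
  move=> Sx _ [y Sy <-]; have := le_trans (coord_le_norm (x - y) 0 i) (Sd _ _ Sx Sy).
  by rewrite !mxE ler_norml => /andP[? ?]; lra.
exists (fun i => inf (E i)) => x Sx i; rewrite /= in_itv /=; apply/andP; split.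
  by apply: ge_inf; [exists (x0 0 i - d); exact: lbE|exists x].
rewrite -lerBlDr; apply: lb_le_inf; last exact: lbE.
by exists (x0 0 i), x0.
Qed.

Definition lip_on K (L : R) (H : 'rV[R]_n -> 'rV[R]_n) :=
  forall x y, K x -> K y -> `|H x - H y| <= L * `|x - y|.

Lemma lip_on_compact K L H : 0 <= L -> compact K -> lip_on K L H -> compact (H @` K).
Proof.
move=> L0 cK lH; apply: continuous_compact => //; apply/subspace_continuousP => x Kx.
apply/cvgrPdist_lt => e e0; rewrite near_withinE.
apply/nbhs_ballP; exists (e / (L + 1)) => /=; first by rewrite divr_gt0// ltr_wpDl.
move=> y; rewrite -ball_normE /= => xy Ky; apply: le_lt_trans (lH _ _ Kx Ky) _.
apply: (@le_lt_trans _ _ ((L + 1) * `|x - y|)).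
  by rewrite ler_wpM2r// lerDl.
by rewrite mulrC -ltr_pdivlMr// ltr_wpDl.
Qed.

Definition cellhull m K : set 'rV[R]_n := [set x | exists2 y, K y & gidx m x = gidx m y].

Lemma cellhullE m K : cellhull m K =
  \bigcup_j (if `[< gcell m j `&` K !=set0 >] then gcell m j else set0).
Proof.
apply/seteqP; split => [x [y Ky xy]|x [j _]].
  exists (pickle (gidx m x)) => //; rewrite asboolT//.
  by exists y; split => //; rewrite /gcell /= xy.
by case: asboolP => // -[y [yj Ky]] xj; exists y => //; apply: (pcan_inj (@pickleK _)); rewrite xj yj.
Qed.

Lemma measurable_cellhull m K : measurable (cellhull m K).
Proof.
rewrite cellhullE; apply: bigcup_measurable => j _.
by case: ifP => _; [exact: measurable_gcell|exact: measurable0].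
Qed.

Lemma cellhull_fin K : compact K -> (leb n (cellhull 0 K) < +oo)%E.
Proof.
move=> cK; have [r r0 Kr] := compact_norm_le cK.
apply: (@le_lt_trans _ _ (leb n (rect (fun i => `[- (r + 1), - (r + 1) + 2 * (r + 1)]%classic)))).
  apply: le_measure; rewrite ?inE; [exact: measurable_cellhull|exact: measurable_box|].
  move=> x [y Ky xy] i.
  have := le_trans (coord_le_norm y 0 i) (Kr _ Ky).
  have /(le_trans (coord_le_norm (x - y) 0 i)) : `|x - y| <= 2 ^- 0.
    by apply: (@gcell_dist _ _ 0 (pickle (gidx 0 x))) => //; rewrite /gcell /= xy.
  rewrite !mxE expr0 invr1 /= in_itv /= !ler_norml.
  by move=> /andP[? ?] /andP[? ?]; apply/andP; split; lra.
by rewrite leb_box ?ltry// mulr_ge0// ltW// ltr_wpDl// ltW.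
Qed.

(** The hulls decrease to [K]: a point of all of them is within [2 ^- m] of [K] for every [m], and
    [K] is closed. Since the hull at level 0 has finite measure, continuity from above applies. *)
Lemma leb_cellhull K : compact K -> leb n (cellhull m K) @[m --> \oo] --> leb n K.
Proof.
move=> cK; have [r r0 Kr] := compact_norm_le cK.
have cap : \bigcap_m cellhull m K = K.
  apply/seteqP; split => [x xK|x Kx m _]; last by exists x.
  rewrite (closure_id K).1; last exact: compact_closed_rV.
  move=> B /nbhs_ballP[e /= e0 eB]; have [m me] := exp2N_lt e0.
  have [y Ky xy] := xK m I; exists y; split => //; apply: eB; rewrite -ball_normE /=.
  apply: le_lt_trans me; apply: (@gcell_dist _ _ m (pickle (gidx m x))) => //.
  by rewrite /gcell /= xy.
rewrite -[X in _ --> leb n X]cap; apply: nonincreasing_cvg_mu.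
- exact: cellhull_fin.
- by move=> m; exact: measurable_cellhull.
- by rewrite cap; exact: compact_measurable_rV.
- move=> m m' mm; apply/subsetPset => x [y Ky xy]; exists y => //.
  exact: gidx_le xy.
Qed.

(** The covering argument shared by the Lipschitz bound, where [c] is [L ^+ n], and by the bound on
    critical values, where [c] tends to 0 with the mesh. *)
Lemma leb_image_cells K m (H : 'rV[R]_n -> 'rV[R]_n) (c : R) : 0 <= c -> measurable (H @` K) ->
  (forall j, gcell m j `&` K !=set0 -> exists C : set 'rV[R]_n, [/\ measurable C,
      H @` (gcell m j `&` K) `<=` C & (leb n C <= c%:E * leb n (gcell m j))%E]) ->
  (leb n (H @` K) <= c%:E * leb n (cellhull m K))%E.
Proof.
move=> c0 mHK HC; pose D j := `[< gcell m j `&` K !=set0 >].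
have /choice[C CP] : forall j, exists C : set 'rV[R]_n, [/\ measurable C,
    H @` (gcell m j `&` K) `<=` C &
    (leb n C <= c%:E * leb n (if D j then gcell m j else set0))%E].
  move=> j; rewrite /D; case: asboolP => [/HC//|ne].
  exists set0; split; first exact: measurable0.
    by move=> y [x xK _]; case: ne; exists x.
  by rewrite !measure0 mule0.
apply: (@le_trans _ _ (\sum_(0 <= j <oo) leb n (C j))%E).
  apply: measure_sigma_subadditive => //; first by move=> j; have [] := CP j.
  move=> _ [x Kx <-]; exists (pickle (gidx m x)) => //.
  by have [_ + _] := CP (pickle (gidx m x)); apply; exists x.
rewrite cellhullE measure_bigcupT.
- rewrite -nneseriesZl//; apply: lee_nneseries => // j _; by have [] := CP j.
- by move=> j; case: ifP => _; [exact: measurable_gcell|exact: measurable0].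
- move=> i j _ _ [x []]; case: ifP => // _; case: ifP => // _ xi xj.
  by apply: (@gcell_trivIset R n m) => //; exists x.
Qed.

(** The image of a cell has diameter at most [L * 2 ^- m], hence lies in a box whose volume is
    exactly [L ^+ n] times that of the cell. No further constant may be lost here, since
    [piece_bounds] uses factors close to 1. *)
Lemma leb_lipschitz K L H : 0 <= L -> compact K -> lip_on K L H ->
  (leb n (H @` K) <= (L ^+ n)%:E * leb n K)%E.
Proof.
move=> L0 cK lH.
have mHK : measurable (H @` K) by apply: compact_measurable_rV; exact: lip_on_compact lH.
have step m : (leb n (H @` K) <= (L ^+ n)%:E * leb n (cellhull m K))%E.
  apply: leb_image_cells => //; first exact: exprn_ge0.
  move=> j [x0 [x0j Kx0]].
  have [a aP] : exists a : 'I_n -> R,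
      H @` (gcell m j `&` K) `<=` rect (fun i => `[a i, a i + L * 2 ^- m]%classic).
    apply: box_cover; first by exists (H x0), x0.
    move=> _ _ [x [xj Kx] <-] [y [yj Ky] <-]; apply: le_trans (lH _ _ Kx Ky) _.
    by rewrite ler_wpM2l// (gcell_dist xj yj).
  exists (rect (fun i => `[a i, a i + L * 2 ^- m]%classic)); split => //.
    exact: measurable_box.
  rewrite leb_box ?mulr_ge0 ?invr_ge0 ?exprn_ge0// leb_gcell; last by exists x0.
  by rewrite -EFinM exprMn.
have cv : ((L ^+ n)%:E * leb n (cellhull m K))%E @[m --> \oo] --> ((L ^+ n)%:E * leb n K)%E.
  by apply: cvgeZl => //; exact: leb_cellhull.
rewrite -(cvg_lim _ cv)//; apply: lime_ge; first by apply/cvg_ex; eexists; exact: cv.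
exact: nearW.
Qed.

(* Comparison on small compact sets suffices. *)
Lemma le_measure_cells (mu nu : {measure set 'rV[R]_n -> \bar R}) m K : closed K ->
  (forall K', K' `<=` K -> closed K' -> (forall x y, K' x -> K' y -> `|x - y| <= 2 ^- m) ->
    (mu K' <= nu K')%E) ->
  (mu K <= nu K)%E.
Proof.
move=> cK H; have mK := closed_measurable_rV cK.
rewrite (measure_split_cells _ m mK) (measure_split_cells nu m mK).
apply: lee_nneseries => // j _.
have [S [cS ndS SE]] := gcell_exhaust R n m j.
have mS p : measurable (K `&` S p).
  by apply: measurableI => //; apply: closed_measurable_rV; exact: cS.
have mSj : measurable (\bigcup_p (K `&` S p)) by exact: bigcup_measurable.
have ndKS : {homo (fun p => K `&` S p) : p q / (p <= q)%N >-> (p <= q)%O}.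
  by move=> p q pq; apply/subsetPset; apply: setIS; exact/subsetPset/ndS.
rewrite -SE setI_bigcupr.
have /cvg_lim <- // := nondecreasing_cvg_mu mS mSj ndKS (mu := mu).
apply: lime_le.
  by apply/cvg_ex; eexists; exact: (nondecreasing_cvg_mu mS mSj ndKS (mu := mu)).
apply: nearW => p /=; apply: (@le_trans _ _ (nu (K `&` S p))).
  apply: (H (K `&` S p)); first by move=> x [].
    by apply: closedI => //; exact: cS.
  move=> x y [_ Sx] [_ Sy]; apply: (@gcell_dist _ _ m j); rewrite -SE; by exists p.
apply: le_measure; rewrite ?inE//; exact: (bigcup_sup (i := p)).
Qed.

End lipschitz_image.

(** * The area formula *)

Section area_formula.
Context (R : realType) (n : nat).
Implicit Types (K Q E D : set 'rV[R]_n) (x y z : 'rV[R]_n).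

(* [M x] is the transposed Jacobian of [Phi] at [x], since vectors are rows. *)
Definition c11 (Phi : 'rV[R]_n -> 'rV[R]_n) (M : 'rV[R]_n -> 'M[R]_n) :=
  forall r : R, exists2 C, 0 <= C & forall x y, `|x| <= r -> `|y| <= r ->
    `|Phi y - Phi x - (y - x) *m M x| <= C * `|y - x| ^+ 2 /\ `|M y - M x| <= C * `|y - x|.

(** The errors in [area_compact] and [sard_compact] are polynomials in the mesh [2 ^- m]; passing to
    the limit is evaluation at 0. *)
Lemma poly_le_limit (p : {poly R}) (a : R) m0 :
  (forall m, (m0 <= m)%N -> a <= p.[2 ^- m]) -> a <= p.[0].
Proof.
move=> ap; rewrite leNgt; apply/negP => pa.
have /cvgr_lt /(_ _ pa) : p.[x] @[x --> (0:R)] --> p.[0] by exact: continuous_horner.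
move=> /nbhs_ballP[e /= e0 ep]; have [m me] := exp2N_lt e0.
pose k := maxn m m0; have := ap k (leq_maxr _ _); rewrite leNgt => /negP; apply.
apply: ep; rewrite /ball /= sub0r normrN ger0_norm ?invr_ge0 ?exprn_ge0//.
apply: le_lt_trans me; rewrite lef_pV2 ?posrE ?exprn_gt0//.
by rewrite ler_eXn2l ?ltr1n// leq_maxl.
Qed.

Variables (Phi : 'rV[R]_n -> 'rV[R]_n) (M : 'rV[R]_n -> 'M[R]_n).
Hypothesis PhiM : c11 Phi M.

Lemma c11_loclip i j : loclip (fun x => M x i j).
Proof.
move=> r; have [C C0 PC] := PhiM r; exists C => // x y xr yr.
have [_] := PC y x yr xr; apply: le_trans.
by apply: le_trans (coord_le_norm (M x - M y) i j); rewrite !mxE.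
Qed.

Lemma c11_bounded r : exists2 B, 0 <= B & forall x, `|x| <= r -> `|M x| <= B.
Proof.
have /choice[B BP] : forall ij : 'I_n * 'I_n, exists B, 0 <= B /\
    forall x, `|x| <= r -> `|M x ij.1 ij.2| <= B.
  by move=> ij; have [B B0 PB] := loclip_bounded (c11_loclip ij.1 ij.2) r; exists B.
exists (\sum_ij B ij) => [|x xr]; first by apply: sumr_ge0 => ij _; case: (BP ij).
apply: norm_le_coord => [|i j]; first by apply: sumr_ge0 => ij _; case: (BP ij).
rewrite (bigD1 (i, j))//=; have [B0 /(_ x xr) PB] := BP (i, j).
apply: le_trans PB _; rewrite lerDl; by apply: sumr_ge0 => ij _; case: (BP ij).
Qed.

Lemma c11_lip r : exists2 L, 0 <= L & lip_on [set x | `|x| <= r] L Phi.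
Proof.
have [C C0 PC] := PhiM r; have [B B0 MB] := c11_bounded r.
exists (C * (2 * `|r|) + n%:R * B) => [|x y /= xr yr].
  by rewrite addr_ge0 ?mulr_ge0.
have [H _] := PC y x yr xr.
rewrite -[Phi x - Phi y](subrK ((x - y) *m M y)); apply: le_trans (ler_normD _ _) _.
rewrite mulrDl lerD//.
  apply: le_trans H _; rewrite expr2 -!mulrA ler_wpM2l// mulrA ler_wpM2r//.
  apply: le_trans (ler_normB _ _) _; rewrite mulr_natl mulr2n.
  by rewrite lerD// (le_trans _ (ler_norm r)).
apply: le_trans (norm_mulmx _ _) _; rewrite -!mulrA ler_wpM2l// mulrC ler_wpM2r//.
exact: MB.
Qed.

Lemma c11_image_compact K : compact K -> compact (Phi @` K).
Proof.
move=> cK; have [r _ Kr] := compact_norm_le cK; have [L L0 lP] := c11_lip r.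
by apply: lip_on_compact L0 cK _ => x y /Kr ? /Kr ?; exact: lP.
Qed.

Lemma c11_coord_loclip i : loclip (fun x => Phi x 0 i).
Proof.
move=> r; have [L L0 lP] := c11_lip r; exists L => // x y xr yr.
apply: le_trans (lP x y xr yr); apply: le_trans (coord_le_norm (Phi x - Phi y) 0 i).
by rewrite !mxE.
Qed.

Lemma c11_measurable : measurable_fun setT Phi.
Proof.
apply: measurable_fun_rVP => i; apply: continuous_measurable_rV.
by apply: loclip_continuous; exact: c11_coord_loclip.
Qed.

Lemma loclip_detM : loclip (fun x => \det (M x)).
Proof. by apply: loclip_det => i j; exact: c11_loclip. Qed.

Let J x : R := `|\det (M x)|.

Lemma continuous_absdet : continuous J.
Proof.
apply: loclip_continuous => r; have [C C0 PC] := loclip_detM r; exists C => // x y xr yr.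
by apply: le_trans (ler_dist_dist _ _) _; exact: PC.
Qed.

Lemma measurable_absdet : measurable_fun setT (fun x => (J x)%:E).
Proof.
apply/measurable_EFinP; apply: continuous_measurable_rV => x.
exact: continuous_absdet.
Qed.

(** The inverse is the adjugate over the determinant: on a compact set the adjugate is bounded and
    the absolute determinant has a positive minimum. *)
Lemma invM_bounded Q : compact Q -> (forall x, Q x -> \det (M x) != 0) ->
  exists2 B, 0 <= B & forall x, Q x -> `|invmx (M x)| <= B.
Proof.
move=> cQ dQ; have [->|/set0P[x0 Qx0]] := eqVneq Q set0; first by exists 0.
have [r _ Qr] := compact_norm_le cQ.
have cJ : {within Q, continuous J}.
  by apply: continuous_subspaceT; exact: continuous_absdet.
have [c /set_mem Qc cmin] := EVT_min_rV (ex_intro _ x0 Qx0) cQ cJ.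
have c0 : 0 < J c by rewrite normr_gt0 dQ.
have /choice[B BP] : forall ij : 'I_n * 'I_n, exists B, 0 <= B /\
    forall x, `|x| <= r -> `|\adj (M x) ij.1 ij.2| <= B.
  move=> ij; have [|B B0 PB] := @loclip_bounded _ _ (fun x => \adj (M x) ij.1 ij.2) _ r.
    under [X in loclip X]eq_fun do rewrite mxE.
    apply: loclipM; first exact: loclip_cst.
    apply: loclip_det => i j; under [X in loclip X]eq_fun do rewrite !mxE.
    exact: c11_loclip.
  by exists B.
have S0 : 0 <= \sum_ij B ij by apply: sumr_ge0 => ij _; case: (BP ij).
exists ((J c)^-1 * \sum_ij B ij) => [|x Qx].
  by rewrite mulr_ge0// invr_ge0 ltW.
have uM : M x \in unitmx by rewrite unitmxE unitfE dQ.
apply: norm_le_coord => [|i j]; first by rewrite mulr_ge0// invr_ge0 ltW.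
rewrite /invmx uM mxE normrM normfV ler_pM ?invr_ge0//.
  by rewrite lef_pV2 ?posrE ?normr_gt0 ?dQ// cmin ?mem_set.
have [_ /(_ x (Qr _ Qx)) PB] := BP (i, j); apply: le_trans PB _.
rewrite (bigD1 (i, j))//= lerDl; by apply: sumr_ge0 => ij _; case: (BP ij).
Qed.

(** Seen through [invmx (M x0)], the map [Phi] differs from the identity at scale [e] by a map of
    Lipschitz constant [B * e]. That [B] does not depend on [x0] lets one estimate serve all
    cells. *)
Lemma local_estimate Q : compact Q -> (forall x, Q x -> \det (M x) != 0) ->
  exists2 B, 0 <= B & forall e x0 x y, Q x0 -> Q x -> Q y ->
    `|x - x0| <= e -> `|y - x0| <= e -> `|x - y| <= e ->
    `|(Phi x - Phi y) *m invmx (M x0) - (x - y)| <= B * e * `|x - y| /\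
    `|J x - J x0| <= B * e.
Proof.
move=> cQ dQ; have [B B0 PB] := invM_bounded cQ dQ.
have [r _ Qr] := compact_norm_le cQ; have [C C0 PC] := PhiM r.
have [D D0 PD] := loclip_detM r.
exists (n%:R * ((C + n%:R * C) * B) + D) => [|e x0 x y Qx0 Qx Qy xe ye xye].
  by rewrite addr_ge0// ?mulr_ge0// addr_ge0// mulr_ge0.
have e0 : 0 <= e by apply: le_trans xe.
split; last first.
  apply: le_trans (ler_dist_dist _ _) _; apply: le_trans (PD _ _ (Qr _ Qx) (Qr _ Qx0)) _.
  apply: (@le_trans _ _ (D * e)); first by rewrite ler_wpM2l.
  by rewrite ler_wpM2r// lerDr !mulr_ge0// addr_ge0// mulr_ge0.
have uM : M x0 \in unitmx by rewrite unitmxE unitfE dQ.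
have -> : (Phi x - Phi y) *m invmx (M x0) - (x - y) =
    ((Phi x - Phi y - (x - y) *m M y) + (x - y) *m (M y - M x0)) *m invmx (M x0).
  by rewrite -{1}[x - y](mulmxK uM) -mulmxBl mulmxBr addrA subrK.
apply: (@le_trans _ _ (n%:R * ((C + n%:R * C) * B) * e * `|x - y|)); last first.
  by rewrite ler_wpM2r// ler_wpM2r// lerDl.
apply: le_trans (norm_mulmx _ _) _; rewrite -!mulrA ler_wpM2l//.
have -> : (C + n%:R * C) * (B * (e * `|x - y|)) =
  (C * (e * `|x - y|) + n%:R * (`|x - y| * (C * e))) * B by ring.
rewrite ler_pM//; last exact: PB.
apply: le_trans (ler_normD _ _) _; rewrite lerD//.
  have [H _] := PC y x (Qr _ Qy) (Qr _ Qx); apply: le_trans H _.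
  by rewrite expr2 ler_wpM2l// ler_wpM2r.
apply: le_trans (norm_mulmx _ _) _; rewrite ler_wpM2l// ler_wpM2l//.
have [_ H] := PC x0 y (Qr _ Qx0) (Qr _ Qy); apply: le_trans H _.
by rewrite ler_wpM2l.
Qed.

Lemma leb_image_mulmx K T : T \in unitmx -> compact K ->
  leb n (Phi @` K) = (`|\det T|%:E * leb n ((fun x => Phi x *m invmx T) @` K))%E.
Proof.
move=> uT cK; have mP : measurable (Phi @` K).
  by apply: compact_measurable_rV; exact: c11_image_compact.
have -> : (fun x => Phi x *m invmx T) @` K = (fun x : 'rV[R]_n => x *m T) @^-1` (Phi @` K).
  apply/seteqP; split => [_ [x Kx <-]|y [x Kx xy]] /=.
    by exists x => //; rewrite mulmxKV.
  by exists x => //; rewrite xy mulmxK.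
rewrite leb_mulmx// muleA -EFinM divff ?mul1e//.
by rewrite normr_eq0 -unitfE -unitmxE.
Qed.

(** After composition with [invmx (M x0)] the map is [(1 + e)]-Lipschitz, and its inverse on the
    image is [(1 - e)^-1]-Lipschitz. Each bound is [leb_lipschitz] for one of these two maps, and
    the linear factor contributes [J x0]. *)
Lemma piece_bounds K x0 (e : R) : compact K -> \det (M x0) != 0 -> 0 <= e -> e < 1 ->
  (forall x y, K x -> K y ->
    `|(Phi x - Phi y) *m invmx (M x0) - (x - y)| <= e * `|x - y|) ->
  (leb n (Phi @` K) <= ((1 + e) ^+ n * J x0)%:E * leb n K)%E /\
  (((1 - e) ^+ n * J x0)%:E * leb n K <= leb n (Phi @` K))%E.
Proof.
move=> cK d0 e0 e1 eP; have uM : M x0 \in unitmx by rewrite unitmxE unitfE.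
pose H x := Phi x *m invmx (M x0).
have J0 : 0 <= J x0 by rewrite normr_ge0.
have HE x y : H x - H y = (Phi x - Phi y) *m invmx (M x0) by rewrite mulmxBl.
have lipH : lip_on K (1 + e) H.
  move=> x y Kx Ky; rewrite HE -[_ *m _](subrK (x - y)).
  apply: le_trans (ler_normD _ _) _; rewrite mulrDl mul1r addrC lerD2l; exact: eP.
have lowH x y : K x -> K y -> (1 - e) * `|x - y| <= `|H x - H y|.
  move=> Kx Ky; have := eP _ _ Kx Ky; rewrite -HE => eH.
  have := ler_normB (H x - H y) (H x - H y - (x - y)).
  by rewrite opprB addrC subrK mulrBl mul1r; lra.
have e10 : 0 < 1 - e by rewrite subr_gt0.
have cHK : compact (H @` K).
  by apply: (lip_on_compact _ cK lipH); rewrite addr_ge0.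
rewrite (leb_image_mulmx uM cK) -/H -/(J x0); split.
  rewrite mulrC EFinM -muleA lee_wpmul2l//.
  by apply: leb_lipschitz => //; rewrite addr_ge0.
(* The inverse of [H] on the image of [K]; the lower bound [lowH] makes the chosen preimage
   unique. *)
pose G y := xget 0 [set x | K x /\ H x = y].
have GH x : K x -> G (H x) = x.
  move=> Kx; rewrite /G; case: xgetP => [z _ [Kz Hz]|/(_ x)]; last by case.
  have := lowH _ _ Kz Kx; rewrite Hz subrr normr0 => h.
  have : `|z - x| <= 0 by rewrite -(@ler_pM2l _ (1 - e))// mulr0.
  by rewrite normr_le0 subr_eq0 => /eqP.
have KE : G @` (H @` K) = K.
  apply/seteqP; split => [_ [_ [x Kx <-] <-]|x Kx]; first by rewrite GH.
  by exists (H x); [exists x|exact: GH].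
have lipG : lip_on (H @` K) (1 - e)^-1 G.
  move=> _ _ [x Kx <-] [y Ky <-]; rewrite !GH// -(ler_pM2l e10) mulrA divff ?gt_eqF//.
  by rewrite mul1r; exact: lowH.
have := leb_lipschitz _ cHK lipG; rewrite KE => /(_ _)/wrap[].
  by rewrite invr_ge0 ltW.
move=> h; rewrite mulrC EFinM -muleA lee_wpmul2l ?lee_fin//.
apply: (@le_trans _ _ (((1 - e) ^+ n)%:E * (((1 - e)^-1 ^+ n)%:E * leb n (H @` K)))%E).
  by rewrite lee_wpmul2l// lee_fin exprn_ge0// ltW.
by rewrite muleA -EFinM -exprMn divff ?gt_eqF// expr1n mul1e.
Qed.

End area_formula.

(** * The area formula on a compact set of injectivity *)

Section area_pieces.
Context (R : realType) (n : nat).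
Implicit Types (K Q E D A : set 'rV[R]_n) (x y z : 'rV[R]_n).
Variables (Phi : 'rV[R]_n -> 'rV[R]_n) (M : 'rV[R]_n -> 'M[R]_n).
Hypothesis PhiM : c11 Phi M.

Let J x : R := `|\det (M x)|.

Let Jge0 x : 0 <= J x. Proof. exact: normr_ge0. Qed.
Let J0 x : (0 <= (J x)%:E)%E. Proof. by rewrite lee_fin. Qed.
#[local] Hint Resolve Jge0 J0 : core.

Let mJ : measurable_fun setT (fun x => (J x)%:E). Proof. exact: measurable_absdet. Qed.

Definition inj_on Q := forall x y, Q x -> Q y -> Phi x = Phi y -> x = y.

(** Injectivity on [Q] lets images commute with complements relative to [Q], so the sets with
    measurable image form a sigma-algebra. It contains the closed sets, whose traces on [Q] are
    compact. *)
Lemma measurable_image Q A : compact Q -> inj_on Q -> measurable A ->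
  measurable (Phi @` (A `&` Q)).
Proof.
move=> cQ iQ; suff : @measurable _ 'rV[R]_n `<=` [set A | measurable (Phi @` (A `&` Q))].
  exact.
have mQ : measurable (Phi @` Q).
  by apply: compact_measurable_rV; exact: c11_image_compact.
rewrite {1}measurable_closed; apply: smallest_sub.
  split => /=.
  - by rewrite set0I image_set0.
  - move=> B mB; rewrite (_ : _ @` _ = Phi @` Q `\` Phi @` (B `&` Q)).
      exact: measurableD.
    apply/seteqP; split => [_ [x [[_ nB] Qx] <-]|_ [[x Qx <-] nB]].
      by split; [exists x|move=> [y [By Qy] /(iQ _ _ Qy Qx) yx]; rewrite -yx in nB].
    by exists x => //; split => //; split => // Bx; apply: nB; exists x.
  - move=> F mF; rewrite setI_bigcupl image_bigcup; exact: bigcup_measurable.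
move=> K cK /=; apply: compact_measurable_rV; apply: (c11_image_compact PhiM).
by rewrite setIC; exact: compact_setI.
Qed.

Lemma image_measure Q : compact Q -> inj_on Q ->
  exists nu : {measure set 'rV[R]_n -> \bar R},
    forall A, nu A = leb n (Phi @` (A `&` Q)).
Proof.
move=> cQ iQ; pose nu A := leb n (Phi @` (A `&` Q)).
have nu0 : nu set0 = 0%E by rewrite /nu set0I image_set0 measure0.
have nu_ge0 A : (0 <= nu A)%E by exact: measure_ge0.
have nuD : semi_sigma_additive nu.
  move=> F mF tF mUF; rewrite /nu setI_bigcupl image_bigcup.
  apply: measure_semi_sigma_additive.
  - by move=> k; exact: measurable_image.
  - move=> i j _ _ [_ [[x [Fx Qx] <-] [y [Fy Qy] yx]]].
    by apply: tF => //; exists x; split => //; rewrite -(iQ _ _ Qy Qx yx).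
  - by apply: bigcup_measurable => k _; exact: measurable_image.
pose nm : {measure set 'rV[R]_n -> \bar R} :=
  HB.pack nu (isMeasure.Build _ _ _ nu nu0 nu_ge0 nuD).
by exists nm.
Qed.

Lemma integral_cst_leb K (c : R) : measurable K ->
  (\int[leb n]_(x in K) c%:E = c%:E * leb n K)%E.
Proof. by move=> mK; rewrite integral_cst. Qed.

Lemma J_bounded K : compact K -> exists2 B, 0 <= B & forall x, K x -> J x <= B.
Proof.
move=> cK; have [r _ Kr] := compact_norm_le cK.
by have [B B0 BP] := loclip_bounded (loclip_detM PhiM) r; exists B => // x /Kr/BP.
Qed.

(** On closed subsets of diameter at most [2 ^- m], [piece_bounds] compares the image volume with a
    nearly constant Jacobian. By [le_measure_cells] the comparison holds on all of [K], and the two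
    bounds meet as the mesh tends to 0. *)
Lemma area_compact Q K : compact Q -> inj_on Q -> (forall x, Q x -> \det (M x) != 0) ->
  closed K -> K `<=` Q -> leb n (Phi @` K) = (\int[leb n]_(x in K) (J x)%:E)%E.
Proof.
move=> cQ iQ dQ clK KQ.
have cK : compact K by exact: subclosed_compact cQ KQ.
have mK := compact_measurable_rV cK.
have [nu nuE] := image_measure cQ iQ.
have nuS K' : K' `<=` Q -> nu K' = leb n (Phi @` K').
  by move=> K'Q; rewrite nuE setIidl.
have [B B0 est] := local_estimate PhiM cQ dQ.
have [m0 m0P] : exists m0, B * 2 ^- m0 < 1.
  have B10 : 0 < (B + 1)^-1 by rewrite invr_gt0 ltr_wpDl.
  have [m0 lt0] := exp2N_lt B10; exists m0.
  apply: (@le_lt_trans _ _ ((B + 1) * 2 ^- m0)).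
    by rewrite ler_wpM2r ?invr_ge0 ?exprn_ge0// lerDl.
  by rewrite mulrC -ltr_pdivlMr ?ltr_wpDl// mul1r.
have mP m : (m0 <= m)%N -> B * 2 ^- m < 1.
  move=> mm; apply: le_lt_trans m0P; rewrite ler_wpM2l// lef_pV2 ?posrE ?exprn_gt0//.
  by rewrite ler_eXn2l ?ltr1n.
have t0 m : 0 <= 2 ^- m :> R by rewrite invr_ge0 exprn_ge0.
have [BJ BJ0 JB] := J_bounded cK.
have lfin : leb n K \is a fin_num by rewrite ge0_fin_numE//; exact: compact_leb_fin.
pose l := fine (leb n K); have lE : leb n K = l%:E by rewrite fineK.
have l0 : 0 <= l by rewrite fine_ge0.
have kfin : (\int[leb n]_(x in K) (J x)%:E)%E \is a fin_num.
  rewrite ge0_fin_numE ?integral_ge0//.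
  apply: (@le_lt_trans _ _ (\int[leb n]_(x in K) BJ%:E)%E); last first.
    by rewrite integral_cst_leb// lE ltry.
  by apply: ge0_le_integral => //; try exact: measurable_funTS; move=> x /JB; rewrite lee_fin.
pose k := fine (\int[leb n]_(x in K) (J x)%:E)%E.
have kE : (\int[leb n]_(x in K) (J x)%:E)%E = k%:E by rewrite fineK.
have nfin : nu K \is a fin_num.
  rewrite ge0_fin_numE// nuS//; apply: compact_leb_fin; exact: (c11_image_compact PhiM).
pose a := fine (nu K); have aE : nu K = a%:E by rewrite fineK.
have mJc c : measurable_fun setT (fun x => (J x + c)%:E).
  apply/measurable_EFinP; apply: measurable_funD => //; exact/measurable_EFinP.
suff : a = k by move=> ak; rewrite -nuS// aE ak -kE.
have bounds m K' : (m0 <= m)%N -> K' `<=` K -> closed K' ->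
    (forall x y, K' x -> K' y -> `|x - y| <= 2 ^- m) -> K' !=set0 ->
    exists x0, [/\ K' x0, (nu K' <= ((1 + B * 2 ^- m) ^+ n * J x0)%:E * leb n K')%E &
      (((1 - B * 2 ^- m) ^+ n * J x0)%:E * leb n K' <= nu K')%E].
  move=> mm K'K clK' K'd [x0 K'x0]; exists x0; rewrite nuS; last first.
    exact: subset_trans KQ.
  have cK' : compact K' by exact: subclosed_compact cK K'K.
  have [] := @piece_bounds R n _ _ PhiM K' x0 (B * 2 ^- m) cK'.
  - by apply/dQ/KQ/K'K.
  - by rewrite mulr_ge0.
  - exact: mP.
  - move=> x y K'x K'y.
    by have [] := est (2 ^- m) x0 x y (KQ _ (K'K _ K'x0)) (KQ _ (K'K _ K'x))
      (KQ _ (K'K _ K'y)) (K'd _ _ K'x K'x0) (K'd _ _ K'y K'x0) (K'd _ _ K'x K'y).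
  - by [].
have Jest m K' x0 x : K' `<=` K ->
    (forall x y, K' x -> K' y -> `|x - y| <= 2 ^- m) -> K' x0 -> K' x ->
    `|J x - J x0| <= B * 2 ^- m.
  move=> K'K K'd K'x0 K'x.
  by have [] := est (2 ^- m) x0 x x (KQ _ (K'K _ K'x0)) (KQ _ (K'K _ K'x))
    (KQ _ (K'K _ K'x)) (K'd _ _ K'x K'x0) (K'd _ _ K'x K'x0) (K'd _ _ K'x K'x).
apply/eqP; rewrite eq_le; apply/andP; split.
  (* On such a subset [J] varies by at most [B * 2 ^- m], whence the density [J + B * 2 ^- m], whose
     integral over [K] is [k + B * l * 2 ^- m]. *)
  pose p : {poly R} := (1 + B *: 'X) ^+ n * (k%:P + (B * l) *: 'X).
  have pE (x : R) : p.[x] = (1 + B * x) ^+ n * (k + B * l * x) by rewrite /p !hornerE.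
  have -> : k = p.[0] by rewrite pE !mulr0 !addr0 expr1n mul1r.
  apply: (@poly_le_limit _ p _ m0) => m mm.
  have c0 : 0 <= (1 + B * 2 ^- m) ^+ n by rewrite exprn_ge0// addr_ge0// mulr_ge0.
  pose g x := (((1 + B * 2 ^- m) ^+ n)%:E * (J x + B * 2 ^- m)%:E)%E.
  have mg : measurable_fun setT g by apply: measurable_funeM; exact: mJc.
  have g0 x : (0 <= g x)%E.
    by rewrite mule_ge0 ?lee_fin// addr_ge0// mulr_ge0.
  have : (nu K <= dens (leb n) mg g0 K)%E.
    apply: (@le_measure_cells _ _ _ _ m) => // K' K'K clK' K'd.
    have [->|/set0P ne] := eqVneq K' set0; first by rewrite !measure0.
    have [x0 [K'x0 up _]] := bounds m K' mm K'K clK' K'd ne.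
    apply: le_trans up _; rewrite densE.
    have mK' : measurable K' by exact: closed_measurable_rV.
    rewrite -integral_cst_leb//; apply: ge0_le_integral => //.
    - by move=> x _; rewrite lee_fin mulr_ge0.
    - exact: measurable_funTS.
    - move=> x K'x; rewrite /g -EFinM lee_fin ler_wpM2l//.
      have := Jest m K' x0 x K'K K'd K'x0 K'x.
      by rewrite ler_norml => /andP[? ?]; lra.
  rewrite densE /g ge0_integralZl//; last 2 first.
  - by apply: measurable_funTS; exact: mJc.
  - by move=> x _; rewrite lee_fin addr_ge0// mulr_ge0.
  under eq_integral do rewrite EFinD.
  rewrite ge0_integralD//; last 2 first.
  - exact: measurable_funTS.
  - by move=> x _; rewrite lee_fin mulr_ge0.
  rewrite kE integral_cst_leb// lE aE => h.
  have {}h : a <= (1 + B * 2 ^- m) ^+ n * (k + B * 2 ^- m * l) by rewrite -lee_fin.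
  apply: le_trans h _; rewrite pE ler_wpM2l// lerD2l.
  by rewrite le_eqVlt; apply/orP; left; apply/eqP; ring.
(* With [u = (1 - B * t) ^+ n], the bound [u * k <= a + B * l * t] is rearranged as
   [k <= a + B * l * t + (1 - u) * k], so that the left side is constant. *)
pose p : {poly R} := a%:P + (B * l) *: 'X + (1 - (1 - B *: 'X) ^+ n) * k%:P.
have pE (x : R) : p.[x] = a + B * l * x + (1 - (1 - B * x) ^+ n) * k by rewrite /p !hornerE.
have -> : a = p.[0] by rewrite pE !mulr0 !addr0 subr0 expr1n subrr mul0r addr0.
apply: (@poly_le_limit _ p _ m0) => m mm.
have c0 : 0 <= (1 - B * 2 ^- m) by rewrite subr_ge0 ltW// mP.
have c1 : (1 - B * 2 ^- m) ^+ n <= 1.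
  by rewrite exprn_ile1// gerBl mulr_ge0.
pose g x := (((1 - B * 2 ^- m) ^+ n)%:E * (J x)%:E)%E.
have mg : measurable_fun setT g by exact: measurable_funeM.
have g0 x : (0 <= g x)%E by rewrite mule_ge0 ?lee_fin// exprn_ge0.
(* The oscillation of [J] is added to [nu] as a constant density instead of being subtracted from
   the density [J], so that both sides remain measures. *)
pose t (x : 'rV[R]_n) : \bar R := (B * 2 ^- m)%:E.
have mt : measurable_fun setT t by exact: measurable_cst.
have tt0 x : (0 <= t x)%E by rewrite lee_fin mulr_ge0.
have : (dens (leb n) mg g0 K <= measure_add nu (dens (leb n) mt tt0) K)%E.
  apply: (@le_measure_cells _ _ _ _ m) => // K' K'K clK' K'd.
  have [->|/set0P ne] := eqVneq K' set0; first by rewrite !measure0.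
  have [x0 [K'x0 _ low]] := bounds m K' mm K'K clK' K'd ne.
  have mK' : measurable K' by exact: closed_measurable_rV.
  rewrite [leRHS]measure_addE !densE.
  apply: (@le_trans _ _ (((1 - B * 2 ^- m) ^+ n * J x0)%:E * leb n K'
     + \int[leb n]_(x in K') t x)%E); last by rewrite leeD2r.
  rewrite -integral_cst_leb// -ge0_integralD//.
  all: try exact: measurable_funTS.
  all: try by move=> x _; rewrite lee_fin mulr_ge0// exprn_ge0.
  apply: ge0_le_integral => //.
  - exact: measurable_funTS.
  - move=> x K'x; rewrite /g /t -EFinM -EFinD lee_fin.
    have := Jest m K' x0 x K'K K'd K'x0 K'x; rewrite ler_norml => /andP[_ h].
    rewrite -lerBlDl -mulrBr.
    apply: (@le_trans _ _ ((1 - B * 2 ^- m) ^+ n * (B * 2 ^- m))).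
      by rewrite ler_wpM2l// exprn_ge0.
    by rewrite ler_piMl// mulr_ge0.
rewrite [X in (_ <= X)%E -> _]measure_addE !densE /g ge0_integralZl//; last 2 first.
- exact: measurable_funTS.
- by rewrite lee_fin exprn_ge0.
rewrite kE /t integral_cst_leb// lE aE => h.
have {}h : (1 - B * 2 ^- m) ^+ n * k <= a + B * 2 ^- m * l by rewrite -lee_fin.
by move: h; rewrite pE mulrBl mul1r; set u := (_ ^+ n * k); lra.
Qed.

(** Both sides are measures in [A]; they agree on the closed sets by [area_compact], and the total
    mass is finite because [Q] is compact. *)
Lemma area_measure Q A : compact Q -> inj_on Q -> (forall x, Q x -> \det (M x) != 0) ->
  measurable A -> leb n (Phi @` (A `&` Q)) = (\int[leb n]_(x in A `&` Q) (J x)%:E)%E.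
Proof.
move=> cQ iQ dQ mA; have [nu nuE] := image_measure cQ iQ.
have mQ := compact_measurable_rV cQ.
pose g x := ((J x)%:E * (\1_Q x)%:E)%E.
have mg : measurable_fun setT g.
  by apply: emeasurable_funM => //; apply/measurable_EFinP; exact: measurable_indic.
have g0 x : (0 <= g x)%E by rewrite mule_ge0// lee_fin.
have dE B : dens (leb n) mg g0 B = (\int[leb n]_(x in B `&` Q) (J x)%:E)%E.
  rewrite densE [RHS]integral_mkcondr; apply: eq_integral => x _.
  by rewrite patchE /g indicE; case: (x \in Q); rewrite ?mule1 ?mule0.
rewrite -nuE -dE.
apply: (measure_unique [set K : set 'rV[R]_n | closed K] (fun=> setT)) => //.
- exact: measurable_closed.
- by move=> B C; exact: closedI.
- by apply/seteqP; split => // x _; exists 0%N.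
- move=> K cK; rewrite nuE dE; apply: (area_compact cQ iQ dQ); last by move=> x [].
  by apply: closedI => //; exact: compact_closed_rV.
- move=> _; rewrite nuE setTI; apply: compact_leb_fin; exact: (c11_image_compact PhiM).
Qed.

(** Both sides integrate [h] over the target: against Lebesgue measure restricted to the image of
    [E], and against the push-forward of the measure with density [J] on [E]. By [area_measure]
    these measures coincide. *)
Lemma area_piece Q E (h : 'rV[R]_n -> \bar R) : compact Q -> inj_on Q ->
  (forall x, Q x -> \det (M x) != 0) -> measurable E -> E `<=` Q ->
  measurable_fun setT h -> (forall x, 0 <= h x)%E ->
  measurable (Phi @` E) /\
  (\int[leb n]_(y in Phi @` E) h y = \int[leb n]_(x in E) (h (Phi x) * (J x)%:E))%E.
Proof.
move=> cQ iQ dQ mE EQ mh h0.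
have mPE : measurable (Phi @` E) by rewrite -(setIidl EQ); exact: measurable_image.
have mPhi := c11_measurable PhiM.
split => //.
pose g x := ((J x)%:E * (\1_E x)%:E)%E.
have mg : measurable_fun setT g.
  by apply: emeasurable_funM => //; apply/measurable_EFinP; exact: measurable_indic.
have g0 x : (0 <= g x)%E by rewrite mule_ge0// lee_fin.
pose f y : \bar R := (\1_(Phi @` E) y)%:E.
have mf : measurable_fun setT f by apply/measurable_EFinP; exact: measurable_indic.
have f0 x : (0 <= f x)%E by rewrite lee_fin.
have -> : (\int[leb n]_(y in Phi @` E) h y = \int[dens (leb n) mf f0]_y h y)%E.
  rewrite integral_dens// [LHS]integral_mkcond; apply: eq_integral => y _.
  by rewrite patchE /f indicE; case: (_ \in _); rewrite ?mule1 ?mule0.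
have -> : (\int[leb n]_(x in E) (h (Phi x) * (J x)%:E) =
    \int[pushm (dens (leb n) mg g0) mPhi]_y h y)%E.
  rewrite integral_pushm// integral_dens//; last exact: measurableT_comp.
  rewrite [LHS]integral_mkcond; apply: eq_integral => y _.
  by rewrite patchE /g indicE; case: (_ \in _); rewrite ?mule1 ?mule0.
apply: eq_measure_integral => B mB _.
have mPB : measurable (Phi @^-1` B) by rewrite -[X in measurable X]setTI; exact: mPhi.
rewrite [LHS]densE /f integral_indic//.
transitivity (\int[leb n]_(x in (E `&` Phi @^-1` B) `&` Q) (J x)%:E)%E.
  rewrite -area_measure//; last exact: measurableI.
  congr (leb n _); apply/seteqP; split => [_ [[x Ex <-] Bx]|_ [x [[Ex Bx] Qx] <-]].
    by exists x => //; split => //; exact: EQ.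
  by split => //; exists x.
rewrite (setIidl (_ : E `&` Phi @^-1` B `<=` Q)); last by move=> x [/EQ].
rewrite [RHS]/(pushforward _ _ _) densE setIC integral_mkcondr; apply: eq_integral => x _.
by rewrite patchE /g indicE; case: (x \in E); rewrite ?mule1 ?mule0.
Qed.

End area_pieces.

(** * Critical values and the global area formula *)

Section area_theorem.
Context (R : realType) (n : nat).
Implicit Types (K Q E D A : set 'rV[R]_n) (x y z : 'rV[R]_n).
Variables (Phi : 'rV[R]_n -> 'rV[R]_n) (M : 'rV[R]_n -> 'M[R]_n).
Hypothesis PhiM : c11 Phi M.

Let J x : R := `|\det (M x)|.

Lemma closed_norm_le z (d : R) : closed [set y | `|y - z| <= d].
Proof.
have cf : continuous (fun y => `|y - z|).
  apply: loclip_continuous => r; exists 1 => // x y _ _; rewrite mul1r.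
  apply: le_trans (ler_dist_dist _ _) _.
  by rewrite opprB addrA subrK.
rewrite (_ : [set y | _] = (fun y => `|y - z|) @^-1` [set t | t <= d])//.
by apply: preimage_closed => [x _|]; [exact: cf|exact: closed_le].
Qed.

(** A kernel vector divided by its entry of largest absolute value. Vectors being rows, [w]
    annihilates the image of the linear map [T]. *)
Lemma singular_col (T : 'M[R]_n) : \det T = 0 -> exists j (w : 'cV[R]_n),
  [/\ T *m w = 0, w j 0 = 1 & forall i, `|w i 0| <= 1].
Proof.
move=> dT.
have [v v0 vT] : exists2 v : 'rV[R]_n, v != 0 & v *m T^T = 0.
  by apply/det0P; rewrite det_tr dT.
have [j jP] : exists j : 'I_n, forall i, `|v 0 i| <= `|v 0 j|.
  case: n T v v0 vT {dT} => [|p] T v v0 vT.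
    by move: v0; rewrite (_ : v = 0) ?eqxx//; apply/rowP => -[].
  have [j _ jP] := Order.TotalTheory.arg_maxP (fun i : 'I_p.+1 => `|v 0 i|) (erefl : predT ord0).
  by exists j => i; exact: jP.
have vj : v 0 j != 0.
  apply: contra v0 => /eqP vj0; apply/eqP/rowP => i; rewrite mxE.
  by apply/eqP; rewrite -normr_le0; have := jP i; rewrite vj0 normr0.
exists j, ((v 0 j)^-1 *: v^T); split.
- by rewrite -scalemxAr -[T *m _]trmxK trmx_mul trmxK vT trmx0 scaler0.
- by rewrite !mxE mulVf.
- move=> i; rewrite !mxE normrM normfV mulrC ler_pdivrMr ?normr_gt0// mul1r.
  exact: jP.
Qed.

(** A change of coordinates that replaces coordinate [j] by the pairing with [w] and keeps the
    others; it has determinant [w j 0]. *)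
Definition shear (j : 'I_n) (w : 'cV[R]_n) : 'M[R]_n :=
  \matrix_(i, k) if k == j then w i 0 else (i == k)%:R.

Lemma det_shear j (w : 'cV[R]_n) : w j 0 = 1 -> \det (shear j w) = 1.
Proof.
move=> wj; rewrite (expand_det_row _ j) (bigD1 j)//= big1 ?addr0 => [|k kj]; last first.
  by rewrite !mxE (negbTE kj) eq_sym (negbTE kj) mul0r.
rewrite !mxE eqxx wj mul1r /cofactor addnn -signr_odd odd_double expr0 mul1r.
rewrite (_ : row' j _ = 1%:M) ?det1//; apply/matrixP => i k; rewrite !mxE.
by rewrite eq_sym (negbTE (neq_lift _ _)) (inj_eq lift_inj).
Qed.

Lemma mulmx_shear j (w : 'cV[R]_n) (v : 'rV[R]_n) k :
  (v *m shear j w) 0 k = if k == j then (v *m w) 0 0 else v 0 k.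
Proof.
rewrite mxE; case: eqP => kj.
  by rewrite mxE; apply: eq_bigr => i _; rewrite mxE kj eqxx.
rewrite (bigD1 k)//= big1 ?addr0 => [|i ik]; rewrite !mxE (introF eqP kj).
  by rewrite eqxx mulr1.
by rewrite (negbTE ik) mulr0.
Qed.

(** Near a critical point [z] the image is flat in the direction [w] that annihilates the image of
    [M z]: over a cell it has extent of order [4 ^- m] along [w] and [2 ^- m] in the other
    coordinates. The image of a cell thus has volume at most [2 ^- m] times a multiple of the cell
    volume, and the sum tends to 0. *)
Lemma sard_compact (r : R) :
  leb n (Phi @` [set x | `|x| <= r /\ \det (M x) = 0]) = 0%E.
Proof.
set Z := [set x | _].
have cZ : compact Z.
  apply: bounded_closed_compact.
    exists r; split; first exact: num_real.
    by move=> s rs x [xr _] /=; apply: le_trans xr _; exact: ltW.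
  rewrite (_ : Z = [set x | `|x - 0| <= r] `&` (fun x => \det (M x)) @^-1` [set 0]).
    apply: closedI; first exact: closed_norm_le.
    apply: preimage_closed => [x _|]; last exact: closed_eq.
    exact: (loclip_continuous (loclip_detM PhiM)).
  by apply/seteqP; split => x [] /=; rewrite subr0.
have mPZ : measurable (Phi @` Z).
  by apply: compact_measurable_rV; exact: (c11_image_compact PhiM).
have [C C0 PC] := PhiM r; have [L L0 lP] := c11_lip PhiM r.
(* Half of [a] dominates both [L], for the ordinary coordinates, and [n%:R * C], for the Taylor
   remainder along [w]. *)
pose a := 2 * (L + n%:R * C).
have a0 : 0 <= a by rewrite mulr_ge0// addr_ge0// mulr_ge0.
have step m : (leb n (Phi @` Z) <= (a ^+ n * 2 ^- m)%:E * leb n (cellhull m Z))%E.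
  have t0 : 0 <= 2 ^- m :> R by rewrite invr_ge0 exprn_ge0.
  apply: leb_image_cells => //; first by rewrite mulr_ge0 ?exprn_ge0.
  move=> c [z [zc [zr dz]]]; have [j [w [Tw wj w1]]] := singular_col dz.
  have dS := det_shear wj; have uS : shear j w \in unitmx by rewrite unitmxE dS unitr1.
  pose b k : R := (a * 2 ^- m) * (if k == j then 2 ^- m else 1).
  have b0 k : 0 <= b k by rewrite /b mulr_ge0 ?(mulr_ge0 a0 t0)//; case: ifP.
  pose B := rect (fun k => `[- (b k / 2), b k / 2]%classic) : set 'rV[R]_n.
  have mB : measurable B by apply: measurable_rect => k; exact: measurable_itv.
  pose C' := (fun v => v - Phi z) @^-1` ((fun v : 'rV[R]_n => v *m shear j w) @^-1` B).
  have mSB : measurable ((fun v : 'rV[R]_n => v *m shear j w) @^-1` B).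
    exact: measurable_preimage_mulmx.
  exists C'; split.
  - by rewrite -[X in measurable X]setTI; exact: measurable_rV_add.
  - move=> _ [y [yc [yr dy]] <-] k; rewrite /= mulmx_shear.
    have yz : `|y - z| <= 2 ^- m by exact: gcell_dist yc zc.
    rewrite in_itv /= -ler_norml /b; case: eqP => [_|_]; last first.
      apply: le_trans (coord_le_norm (Phi y - Phi z) 0 k) _.
      apply: le_trans (lP _ _ yr zr) _; rewrite mulr1.
      apply: (@le_trans _ _ (L * 2 ^- m)); first by rewrite ler_wpM2l.
      rewrite (_ : a * 2 ^- m / 2 = (L + n%:R * C) * 2 ^- m); last by rewrite /a; field.
      by rewrite ler_wpM2r// lerDl mulr_ge0.
    (* As [M z *m w = 0], the linear part can be subtracted at no cost, which leaves the quadratic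
       remainder. *)
    have -> : (Phi y - Phi z) *m w = (Phi y - Phi z - (y - z) *m M z) *m w.
      by rewrite [RHS]mulmxBl -mulmxA Tw mulmx0 subr0.
    apply: le_trans (coord_le_norm _ 0 0) _; apply: le_trans (norm_mulmx _ _) _.
    have [H _] := PC z y zr yr.
    apply: (@le_trans _ _ (n%:R * ((C * (2 ^- m) ^+ 2) * 1))).
      rewrite ler_wpM2l// ler_pM//.
        apply: le_trans H _; rewrite ler_wpM2l// ler_sqr ?nnegrE//.
      by apply: norm_le_coord => // i l; rewrite ord1; exact: w1.
    rewrite mulr1 (_ : a * 2 ^- m * 2 ^- m / 2 = (L + n%:R * C) * (2 ^- m) ^+ 2); last first.
      by rewrite /a; field.
    by rewrite mulrA ler_wpM2r ?exprn_ge0// lerDr.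
  - rewrite /C' leb_shift// leb_mulmx// dS normr1 invr1 mul1e.
    rewrite leb_gcell; last by exists z.
    rewrite [leLHS]prodmE; last by move=> k; exact: measurable_itv.
    rewrite (eq_bigr (fun k => (b k)%:E)); last first.
      move=> k _; rewrite leb1E lebesgue_measure_itv /= lte_fin.
      case: ltP => bk; first by rewrite -EFinB; congr EFin; field.
      by congr EFin; have := b0 k; lra.
    rewrite prodEFin -EFinM lee_fin /b big_split /= prodr_const card_ord.
    rewrite [X in _ * X](bigD1 j)//= eqxx big1 ?mulr1; last by move=> k /negbTE ->.
    rewrite exprMn le_eqVlt; apply/orP; left; apply/eqP; ring.
pose l := leb n (cellhull 0 Z).
have lfin : l \is a fin_num.
  by rewrite /l ge0_fin_numE//; exact: cellhull_fin.
have hl m : (leb n (cellhull m Z) <= l)%E.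
  apply: le_measure; rewrite ?inE; [exact: measurable_cellhull..|].
  by move=> x [y Zy xy]; exists y => //; exact: gidx_le xy.
have pfin : leb n (Phi @` Z) \is a fin_num.
  by rewrite ge0_fin_numE//; apply: compact_leb_fin; exact: (c11_image_compact PhiM).
apply/eqP; rewrite eq_le measure_ge0 andbT -(fineK pfin) lee_fin.
pose p : {poly R} := (a ^+ n * fine l) *: 'X.
have <- : p.[0] = 0 by rewrite !hornerE.
apply: (@poly_le_limit _ p _ 0) => m _.
rewrite -lee_fin fineK//; apply: le_trans (step m) _.
have t0 : 0 <= 2 ^- m :> R by rewrite invr_ge0 exprn_ge0.
apply: (@le_trans _ _ ((a ^+ n * 2 ^- m)%:E * l)%E).
  by rewrite lee_wpmul2l// lee_fin mulr_ge0// exprn_ge0.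
by rewrite -(fineK lfin) -EFinM lee_fin !hornerE /= mulrAC.
Qed.

Lemma sard : exists Z : set 'rV[R]_n, [/\ measurable Z, leb n Z = 0%E &
  forall x, \det (M x) = 0 -> Z (Phi x)].
Proof.
pose S (k : nat) : set 'rV[R]_n := [set x | `|x| <= k%:R /\ \det (M x) = 0].
have mS k : measurable (Phi @` S k).
  apply: compact_measurable_rV; apply: (c11_image_compact PhiM).
  apply: bounded_closed_compact.
    exists k%:R; split; first exact: num_real.
    by move=> s rs x [xr _] /=; apply: le_trans xr _; exact: ltW.
  rewrite (_ : S k = [set x | `|x - 0| <= k%:R] `&` (fun x => \det (M x)) @^-1` [set 0]).
    apply: closedI; first exact: closed_norm_le.
    apply: preimage_closed => [x _|]; last exact: closed_eq.
    exact: (loclip_continuous (loclip_detM PhiM)).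
  by apply/seteqP; split => x [] /=; rewrite subr0.
exists (\bigcup_k Phi @` S k); split.
- exact: bigcup_measurable.
- apply/eqP; rewrite eq_le measure_ge0 andbT.
  apply: (@le_trans _ _ (\sum_(0 <= k <oo) leb n (Phi @` S k))%E).
    by apply: measure_sigma_subadditive => //; exact: bigcup_measurable.
  rewrite eseries0// => k _ _; exact: sard_compact.
- move=> x dx; exists (Num.bound `|x|) => //; exists x => //; split => //.
  by apply: ltW; rewrite archi_boundP.
Qed.

(** Closures are used because [area_piece] asks for a compact set on which the map is injective and
    regular. *)
Definition good_cell m j := inj_on Phi (closure (gcell m j)) /\
  forall x, closure (gcell m j) x -> \det (M x) != 0.

Lemma closure_gcell_dist m j x y : closure (gcell m j) x -> closure (gcell m j) y ->
  `|x - y| <= 2 ^- m.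
Proof.
move=> cx cy.
have h z : gcell m j z -> `|x - z| <= 2 ^- m.
  move=> zj; have : closure [set x | `|x - z| <= 2 ^- m] x.
    by apply: closureS cx => t tj; exact: gcell_dist tj zj.
  by rewrite -(closure_id _).1//; exact: closed_norm_le.
have : closure [set y | `|y - x| <= 2 ^- m] y.
  by apply: closureS cy => t tj /=; rewrite distrC; exact: h.
move=> cy'; rewrite distrC; move: cy'.
by rewrite -(closure_id _).1//; exact: closed_norm_le.
Qed.

Lemma compact_closure_gcell m j : compact (closure (gcell m j) : set 'rV[R]_n).
Proof.
have [->|/set0P[z zj]] := eqVneq (gcell m j : set 'rV[R]_n) set0.
  by rewrite closure0; exact: compact0.
apply: bounded_closed_compact; last exact: closed_closure.
exists (`|z| + 2 ^- m); split; first exact: num_real.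
move=> s rs x xj /=; apply: ltW; apply: le_lt_trans rs.
rewrite -[x](subrK z) addrC; apply: le_trans (ler_normD _ _) _; rewrite lerD2l.
by apply: (@closure_gcell_dist m j) => //; exact: subset_closure.
Qed.

(** Local injectivity from [local_estimate]: two points of a small cell with equal images satisfy
    [|y - z| <= B * 2 ^- m * |y - z|] with a factor below 1. *)
Lemma regular_good x : \det (M x) != 0 -> exists m, good_cell m (pickle (gidx m x)).
Proof.
move=> dx.
have cd := loclip_continuous (loclip_detM PhiM) (x := x).
have nb : nbhs x [set y | \det (M y) != 0] by exact: (cvgr_neq0 _ cd dx).
move/nbhs_ballP : nb => [e /= e0 eP].
pose Q := [set y | `|y - x| <= e / 2].
have cQ : compact Q.
  apply: bounded_closed_compact; last exact: closed_norm_le.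
  exists (`|x| + e / 2); split; first exact: num_real.
  move=> s rs y yx /=; apply: ltW; apply: le_lt_trans rs.
  by rewrite -[y](subrK x) addrC; apply: le_trans (ler_normD _ _) _; rewrite lerD2l.
have dQ y : Q y -> \det (M y) != 0.
  move=> yx; apply: eP; rewrite -ball_normE /= distrC; apply: le_lt_trans yx _.
  by rewrite ltr_pdivrMr// ltr_pMr// ltr1n.
have [B B0 est] := local_estimate PhiM cQ dQ.
have me0 : 0 < Num.min (e / 2) (B + 1)^-1.
  by rewrite lt_min divr_gt0//= invr_gt0 ltr_wpDl.
have [m] := exp2N_lt me0; rewrite lt_min => /andP[m1 m2]; exists m.
set j := pickle _; have xj : closure (gcell m j) x by exact: subset_closure.
have cQ' y : closure (gcell m j) y -> Q y.
  by move=> yj; rewrite /Q /=; apply: ltW; apply: le_lt_trans m1; exact: (closure_gcell_dist yj xj).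
split; last by move=> y /cQ'/dQ.
move=> y z yj zj yz.
have [+ _] := est (2 ^- m) x y z (cQ' _ xj) (cQ' _ yj) (cQ' _ zj)
  (closure_gcell_dist yj xj) (closure_gcell_dist zj xj) (closure_gcell_dist yj zj).
rewrite yz subrr mul0mx sub0r normrN.
have Bm : B * 2 ^- m < 1.
  apply: (@le_lt_trans _ _ ((B + 1) * 2 ^- m)).
    by rewrite ler_wpM2r ?invr_ge0 ?exprn_ge0// lerDl.
  by rewrite mulrC -ltr_pdivlMr ?ltr_wpDl// mul1r.
move=> h; apply/eqP; rewrite -subr_eq0 -normr_le0.
rewrite -subr_ge0 -[X in _ - X]mul1r -mulrBl in h.
have c0 : B * 2 ^- m - 1 < 0 by rewrite subr_lt0.
by move: h; rewrite nmulr_rge0.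
Qed.

(** One sequence lists the good cells of all levels. They overlap, so [seqDU] makes them disjoint in
    [E] below. *)
Let C k : set 'rV[R]_n := if unpickle k is Some (m, j) then
  (if `[< good_cell m j >] then gcell m j else set0) else set0.

Let mC k : measurable (C k).
Proof.
rewrite /C; case: unpickle => [[m j]|]; last exact: measurable0.
by case: ifP => _; [exact: measurable_gcell|exact: measurable0].
Qed.

Let CU : \bigcup_k C k = [set x | \det (M x) != 0].
Proof.
apply/seteqP; split => [x [k _]|x /= /regular_good[m gm]].
  rewrite /C; case: unpickle => [[m j]|]//; case: asboolP => // -[_ dd] xj.
  by apply: dd; exact: subset_closure.
exists (pickle (m, pickle (gidx m x))) => //; rewrite /C pickleK.
by case: asboolP.
Qed.

Let E D k := D `&` seqDU C k.

Let mE D k : measurable D -> measurable (E D k).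
Proof.
move=> mD; apply: measurableI => //; apply: measurableD => //.
by apply: bigsetU_measurable => i _; exact: mC.
Qed.

Let EQ D k : exists Q, [/\ compact Q, inj_on Phi Q, forall x, Q x -> \det (M x) != 0 &
  E D k `<=` Q].
Proof.
have EC : E D k `<=` C k by move=> x [_ []].
have [C0|] := pselect (C k = set0).
  exists set0; split => //; first exact: compact0.
  by rewrite -C0.
move: EC; rewrite /C; case: unpickle => [[m j]|]//; case: asboolP => // -[gi gd] EC _.
exists (closure (gcell m j)); split => //; first exact: compact_closure_gcell.
by apply: subset_trans EC _; exact: subset_closure.
Qed.

Let trivE D : trivIset setT (E D).
Proof. by apply: trivIset_setIl; exact: trivIset_seqDU. Qed.

Let EU D : \bigcup_k E D k = D `&` [set x | \det (M x) != 0].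
Proof. by rewrite -setI_bigcupr -seqDU_bigcup_eq CU. Qed.

(** [N y] counts the disjoint pieces whose image contains [y]. Off the null set [Z] of critical
    values each preimage in [D] lies in exactly one piece and each piece contains at most one, so
    [N y] is the fibre count; as a series of indicators it is measurable. *)
Theorem area_formula D (f : 'rV[R]_n -> R) : measurable D ->
  measurable_fun setT f -> (forall x, 0 <= f x) ->
  exists (Z : set 'rV[R]_n) (N : 'rV[R]_n -> \bar R),
  [/\ measurable Z, leb n Z = 0%E, measurable_fun setT N, (forall y, 0 <= N y)%E &
    (forall y, ~ Z y -> \esum_(x in [set x | D x /\ Phi x = y]) 1 = N y)%E /\
    (\int[leb n]_y (N y * (f y)%:E) =
     \int[leb n]_(x in D) ((f (Phi x))%:E * `|\det (M x)|%:E))%E].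
Proof.
move=> mD mf f0; pose h y := (f y)%:E.
have mh : measurable_fun setT h by exact/measurable_EFinP.
have h0 y : (0 <= h y)%E by rewrite lee_fin.
have [Z [mZ Z0 ZP]] := sard.
have piece k : measurable (Phi @` E D k) /\ (\int[leb n]_(y in Phi @` E D k) h y =
    \int[leb n]_(x in E D k) (h (Phi x) * (J x)%:E))%E.
  have [Q [cQ iQ dQ EQk]] := EQ D k.
  by apply: (area_piece PhiM cQ iQ dQ _ EQk) => //; exact: mE.
pose N y := (\sum_(0 <= k <oo) (\1_(Phi @` E D k) y)%:E)%E : \bar R.
have i0 k y : (0 <= (\1_(Phi @` E D k) y)%:E :> \bar R)%E by rewrite lee_fin.
have mi k : measurable_fun setT (fun y => (\1_(Phi @` E D k) y)%:E : \bar R).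
  by apply/measurable_EFinP; apply: measurable_indic; case: (piece k).
have N0 y : (0 <= N y)%E by apply: nneseries_ge0.
have mN : measurable_fun setT N by apply: ge0_emeasurable_sum.
exists Z, N; split => //; split => [y Zy|].
  have -> : [set x | D x /\ Phi x = y] = \bigcup_k [set x | E D k x /\ Phi x = y].
    apply/seteqP; split => [x [Dx xy]|x [k _ [[Dx _] xy]]//].
    have : (\bigcup_k E D k) x.
      rewrite EU; split => //=; apply/eqP => /ZP; rewrite xy; exact: Zy.
    by case=> k _ Ek; exists k.
  rewrite esum_bigcupT//; last first.
    move=> i j _ _ [x [[Ei _] [Ej _]]]; apply: (trivE (D := D)) => //.
    by exists x.
  rewrite -nneseries_esumT; last by move=> k; exact: esum_ge0.
  apply: eq_eseriesr => k _; rewrite indicE.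
  case: (boolP (y \in _)) => [/set_mem[x Ex xy]|/negP yE].
    rewrite (_ : [set x | _] = [set x]) ?esum_set1//.
    apply/seteqP; split => [z [Ez zy]|z ->//].
    have [Q [cQ iQ dQ EQk]] := EQ D k.
    by apply: iQ; [exact: EQk|exact: EQk|rewrite zy xy].
  rewrite (_ : [set x | _] = set0) ?esum_set0//.
  apply/seteqP; split => // z [Ez zy]; apply: yE; apply/mem_set; by exists z.
transitivity (\sum_(0 <= k <oo) \int[leb n]_y ((\1_(Phi @` E D k) y)%:E * h y))%E.
  rewrite -integral_nneseries//.
  - apply: eq_integral => y _; rewrite muleC -nneseriesZl//.
    by apply: eq_eseriesr => k _; rewrite muleC.
  - by move=> k; exact: emeasurable_funM.
  - by move=> k y _; exact: mule_ge0.
transitivity (\sum_(0 <= k <oo) \int[leb n]_(x in E D k) (h (Phi x) * (J x)%:E))%E.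
  apply: eq_eseriesr => k _; have [_ <-] := piece k.
  rewrite [RHS]integral_mkcond; apply: eq_integral => y _.
  by rewrite patchE indicE; case: (_ \in _); rewrite ?mul1e ?mul0e.
have mhJ : measurable_fun setT (fun x => h (Phi x) * (J x)%:E)%E.
  apply: emeasurable_funM; last exact: measurable_absdet.
  by apply: measurableT_comp => //; exact: c11_measurable.
rewrite -ge0_integral_bigcup//.
(* The pieces cover only the regular points of [D]; at the critical ones the integrand vanishes with
   the determinant. *)
- rewrite EU [LHS]integral_mkcondr; apply: eq_integral => x _; rewrite patchE.
  case: ifP => // /negP/negP; rewrite notin_setE /= => /negP; rewrite negbK => /eqP dx.
  by rewrite /J dx normr0 mule0.
- by move=> k; exact: mE.
- exact: measurable_funTS.
- by move=> x _; rewrite mule_ge0// lee_fin /J normr_ge0.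
Qed.

End area_theorem.

(** * Functions with locally Lipschitz gradient *)

Section scalar_c11.
Context (R : realType) (p : nat).
Implicit Types (f g : 'rV[R]_p -> R) (df dg : 'I_p -> 'rV[R]_p -> R) (x y : 'rV[R]_p).

Definition lin df x y := \sum_j (y 0 j - x 0 j) * df j x.

(** [lin df x y] is the differential at [x] applied to [y - x]. Carrying the gradient [df] along
    with [f] lets the rules below compute Jacobians explicitly. *)
Definition sc11 f df := (forall j, loclip (df j)) /\
  forall r : R, exists2 C, 0 <= C & forall x y, `|x| <= r -> `|y| <= r ->
    `|f y - f x - lin df x y| <= C * `|y - x| ^+ 2.

Lemma loclip_lin_bound df : (forall j, loclip (df j)) ->
  forall r : R, exists2 B, 0 <= B & forall x y, `|x| <= r -> `|lin df x y| <= B * `|y - x|.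
Proof.
move=> ldf r.
have /choice[B BP] : forall j, exists B, 0 <= B /\ forall x, `|x| <= r -> `|df j x| <= B.
  by move=> j; have [B B0 PB] := loclip_bounded (ldf j) r; exists B.
exists (\sum_j B j) => [|x y xr]; first by apply: sumr_ge0 => j _; case: (BP j).
apply: le_trans (ler_norm_sum _ _ _) _; rewrite mulr_suml; apply: ler_sum => j _.
rewrite normrM mulrC ler_pM//; first by case: (BP j) => _; exact.
by apply: le_trans (coord_le_norm (y - x) 0 j); rewrite !mxE.
Qed.

Lemma sc11_loclip f df : sc11 f df -> loclip f.
Proof.
move=> [ldf fP] r; have [C C0 PC] := fP r; have [B B0 PB] := loclip_lin_bound ldf r.
exists (C * (2 * `|r|) + B) => [|x y xr yr]; first by rewrite addr_ge0// !mulr_ge0.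
rewrite -[f x - f y](subrK (lin df y x)); apply: le_trans (ler_normD _ _) _.
rewrite mulrDl lerD ?PB//; apply: le_trans (PC _ _ yr xr) _.
rewrite expr2 -!mulrA ler_wpM2l// mulrA ler_wpM2r//.
apply: le_trans (ler_normB _ _) _; rewrite mulr_natl mulr2n.
by rewrite lerD// (le_trans _ (ler_norm r)).
Qed.

Lemma eq_sc11 f g df dg : f =1 g -> (forall j x, df j x = dg j x) ->
  sc11 f df -> sc11 g dg.
Proof.
move=> /funext <- fg; have -> // : df = dg.
by apply/funext => j; apply/funext => x; exact: fg.
Qed.

Lemma sc11_cst c : sc11 (fun=> c) (fun _ _ => 0).
Proof.
split=> [j|r]; first exact: loclip_cst.
exists 0 => // x y _ _; rewrite /lin big1 => [|j _]; last by rewrite mulr0.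
by rewrite subrr subr0 normr0 mul0r.
Qed.

Lemma sc11_coord i : sc11 (fun x => x 0 i) (fun j _ => (j == i)%:R).
Proof.
split=> [j|r]; first exact: loclip_cst.
exists 0 => // x y _ _; rewrite /lin (bigD1 i)//= big1 => [|j /negbTE ->].
  by rewrite eqxx mulr1 addr0 subrr normr0 mul0r.
by rewrite mulr0.
Qed.

Lemma sc11D f g df dg : sc11 f df -> sc11 g dg ->
  sc11 (fun x => f x + g x) (fun j x => df j x + dg j x).
Proof.
move=> [lf fP] [lg gP]; split=> [j|r]; first exact: loclipD.
have [C C0 PC] := fP r; have [D D0 PD] := gP r.
exists (C + D) => [|x y xr yr]; first exact: addr_ge0.
have -> : lin (fun j x => df j x + dg j x) x y = lin df x y + lin dg x y.
  by rewrite /lin -big_split; apply: eq_bigr => j _; rewrite mulrDr.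
rewrite (_ : _ - _ = (f y - f x - lin df x y) + (g y - g x - lin dg x y)); last by ring.
by apply: le_trans (ler_normD _ _) _; rewrite mulrDl lerD ?PC ?PD.
Qed.

Lemma sc11M f g df dg : sc11 f df -> sc11 g dg ->
  sc11 (fun x => f x * g x) (fun j x => df j x * g x + f x * dg j x).
Proof.
move=> sf sg; have lf := sc11_loclip sf; have lg := sc11_loclip sg.
case: sf sg => [ldf fP] [ldg gP]; split=> [j|r].
  by apply: loclipD; apply: loclipM.
have [C C0 PC] := fP r; have [D D0 PD] := gP r.
have [Lf Lf0 PLf] := lf r; have [Lg Lg0 PLg] := lg r.
have [Bf Bf0 PBf] := loclip_bounded lf r; have [Bg Bg0 PBg] := loclip_bounded lg r.
exists (C * Bg + Bf * D + Lf * Lg) => [|x y xr yr].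
  by rewrite !addr_ge0// mulr_ge0.
have -> : lin (fun j x => df j x * g x + f x * dg j x) x y =
    lin df x y * g x + f x * lin dg x y.
  rewrite /lin mulr_suml mulr_sumr -big_split; apply: eq_bigr => j _ /=; ring.
rewrite (_ : _ - _ = (f y - f x - lin df x y) * g x + f x * (g y - g x - lin dg x y)
  + (f y - f x) * (g y - g x)); last by ring.
rewrite [leRHS]mulrDl; apply: le_trans (ler_normD _ _) _; apply: lerD.
  rewrite [leRHS]mulrDl; apply: le_trans (ler_normD _ _) _; rewrite !normrM; apply: lerD.
    by rewrite mulrAC ler_pM ?PC ?PBg.
  by rewrite -mulrA ler_pM ?PD ?PBf.
rewrite normrM expr2 (_ : _ * _ * (_ * _) = (Lf * `|y - x|) * (Lg * `|y - x|)); last by ring.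
by rewrite ler_pM ?PLf ?PLg.
Qed.

Lemma sc11_sum (I : Type) (s : seq I) (F : I -> 'rV[R]_p -> R) dF :
  (forall i, sc11 (F i) (dF i)) ->
  sc11 (fun x => \sum_(i <- s) F i x) (fun j x => \sum_(i <- s) dF i j x).
Proof.
move=> sF; elim: s => [|i s IH].
  by apply: eq_sc11 (sc11_cst 0) => [x|j x]; rewrite big_nil.
by apply: eq_sc11 (sc11D (sF i) IH) => [x|j x]; rewrite big_cons.
Qed.

(** The conditions on [phi] are imposed only at values of [f] over balls, so that the inverse and
    the square root are covered for positive [f]. *)
Lemma sc11_comp (phi phi' : R -> R) f df : sc11 f df -> loclip (fun x => phi' (f x)) ->
  (forall r : R, exists2 C, 0 <= C & forall x y, `|x| <= r -> `|y| <= r ->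
    `|phi (f y) - phi (f x) - phi' (f x) * (f y - f x)| <= C * (f y - f x) ^+ 2) ->
  sc11 (fun x => phi (f x)) (fun j x => phi' (f x) * df j x).
Proof.
move=> sf lphi phiP; have lf := sc11_loclip sf; case: sf => ldf fP.
split=> [j|r]; first exact: loclipM.
have [C C0 PC] := fP r; have [D D0 PD] := phiP r; have [L L0 PL] := lf r.
have [B B0 PB] := loclip_bounded lphi r.
exists (D * L ^+ 2 + B * C) => [|x y xr yr].
  by rewrite addr_ge0// mulr_ge0// exprn_ge0.
have -> : lin (fun j x => phi' (f x) * df j x) x y = phi' (f x) * lin df x y.
  by rewrite /lin mulr_sumr; apply: eq_bigr => j _; rewrite mulrCA.
rewrite (_ : _ - _ = (phi (f y) - phi (f x) - phi' (f x) * (f y - f x)) +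
  phi' (f x) * (f y - f x - lin df x y)); last by ring.
rewrite mulrDl; apply: le_trans (ler_normD _ _) _; apply: lerD.
  apply: le_trans (PD _ _ xr yr) _; rewrite -mulrA ler_wpM2l// -exprMn.
  rewrite -real_normK ?num_real// ler_sqr ?nnegrE ?mulr_ge0//; exact: PL.
by rewrite normrM -mulrA ler_pM ?PB ?PC.
Qed.

(** This bound and the next come from [1 + t <= expR t] at [t = h] and [t = - h], which give
    [h <= expR h - 1 <= h * expR h]. *)
Lemma expR_taylor1 (h : R) : `|expR h - 1| <= `|h| * expR `|h|.
Proof.
have e1 := expR_ge1Dx h; have := expR_ge1Dx (- h); rewrite expRN => e2.
have e0 := expR_gt0 h.
have e3 : expR h - 1 <= h * expR h.
  have : (1 - h) * expR h <= 1 by rewrite -ler_pdivlMr// div1r.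
  by rewrite mulrBl mul1r; lra.
have [h0|h0] := leP 0 h.
  rewrite (ger0_norm h0) ger0_norm//; lra.
have eh1 : expR h < 1 by rewrite expR_lt1.
rewrite ltr0_norm ?subr_lt0// (ltr0_norm h0).
have : 1 <= expR (- h) by rewrite -expR0 ler_expR; lra.
by nra.
Qed.

Lemma expR_taylor2 (h : R) : `|expR h - 1 - h| <= h ^+ 2 * expR `|h|.
Proof.
have e1 := expR_ge1Dx h; have := expR_ge1Dx (- h); rewrite expRN => e2.
have e0 := expR_gt0 h.
have e3 : expR h - 1 <= h * expR h.
  have : (1 - h) * expR h <= 1 by rewrite -ler_pdivlMr// div1r.
  by rewrite mulrBl mul1r; lra.
rewrite ger0_norm; last by lra.
have [h0|h0] := leP 0 h.
  by rewrite (ger0_norm h0); nra.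
have : 1 <= expR `|h| by rewrite -expR0 ler_expR.
by nra.
Qed.

Lemma loclip_expR f : loclip f -> loclip (fun x => expR (f x)).
Proof.
move=> lf r; have [B B0 PB] := loclip_bounded lf r; have [L L0 PL] := lf r.
exists (expR B * expR (2 * B) * L) => [|x y xr yr].
  by rewrite !mulr_ge0// expR_ge0.
have -> : expR (f x) - expR (f y) = expR (f y) * (expR (f x - f y) - 1).
  by rewrite mulrBr mulr1 -expRD; congr (expR _ - _); ring.
have fB : `|f x - f y| <= 2 * B.
  apply: le_trans (ler_normB _ _) _; have := PB _ xr; have := PB _ yr; lra.
rewrite normrM (ger0_norm (expR_ge0 _)) -!mulrA ler_pM ?expR_ge0//.
  by rewrite ler_expR; apply: le_trans (ler_norm _) (PB _ yr).
apply: le_trans (expR_taylor1 _) _; rewrite mulrC ler_pM ?expR_ge0//.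
  by rewrite ler_expR.
exact: PL.
Qed.

Lemma sc11_expR f df : sc11 f df ->
  sc11 (fun x => expR (f x)) (fun j x => expR (f x) * df j x).
Proof.
move=> sf; have lf := sc11_loclip sf.
apply: (sc11_comp sf (loclip_expR lf)) => r; have [B B0 PB] := loclip_bounded lf r.
exists (expR B * expR (2 * B)) => [|x y xr yr]; first by rewrite mulr_ge0// expR_ge0.
have -> : expR (f y) - expR (f x) - expR (f x) * (f y - f x) =
    expR (f x) * (expR (f y - f x) - 1 - (f y - f x)).
  have -> : expR (f y) = expR (f x) * expR (f y - f x) by rewrite -expRD; congr expR; ring.
  by ring.
have fB : `|f y - f x| <= 2 * B.
  apply: le_trans (ler_normB _ _) _; have := PB _ xr; have := PB _ yr; lra.
rewrite normrM (ger0_norm (expR_ge0 _)) -!mulrA ler_pM ?expR_ge0//.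
  by rewrite ler_expR; apply: le_trans (ler_norm _) (PB _ xr).
apply: le_trans (expR_taylor2 _) _; rewrite mulrC ler_wpM2r ?sqr_ge0//.
by rewrite ler_expR.
Qed.

Lemma loclip_pos_lb f : loclip f -> (forall x, 0 < f x) ->
  forall r : R, exists2 c, 0 < c & forall x, `|x| <= r -> c <= f x.
Proof.
move=> lf f0 r; have [r0|r0] := leP 0 r; last first.
  by exists 1 => // x xr; have := le_trans (normr_ge0 x) xr; rewrite leNgt r0.
pose Q := [set x : 'rV[R]_p | `|x - 0| <= r].
have cQ : compact Q.
  apply: bounded_closed_compact; last exact: closed_norm_le.
  exists r; split; first exact: num_real.
  by move=> s rs x /=; rewrite /Q /= subr0 => /le_trans; apply; exact: ltW.
have ne : Q !=set0 by exists 0; rewrite /Q /= subrr normr0.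
have cf : {within Q, continuous f}.
  by apply: continuous_subspaceT; exact: loclip_continuous.
have [c _ cmin] := EVT_min_rV ne cQ cf.
by exists (f c) => // x xr; apply: cmin; apply/mem_set; rewrite /Q /= subr0.
Qed.

Lemma loclip_inv f : loclip f -> (forall x, 0 < f x) -> loclip (fun x => (f x)^-1).
Proof.
move=> lf f0 r; have [c c0 Pc] := loclip_pos_lb lf f0 r; have [L L0 PL] := lf r.
exists (c^-1 * c^-1 * L) => [|x y xr yr]; first by rewrite !mulr_ge0// invr_ge0 ltW.
have fx0 := f0 x; have fy0 := f0 y.
have -> : (f x)^-1 - (f y)^-1 = (f x)^-1 * (f y)^-1 * (f y - f x).
  by field; rewrite !gt_eqF.
have inv0 z : 0 <= (f z)^-1 by rewrite invr_ge0 ltW.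
have invc z : `|z| <= r -> (f z)^-1 <= c^-1 by move=> zr; rewrite lef_pV2 ?posrE ?Pc.
rewrite !normrM !normfV (gtr0_norm fx0) (gtr0_norm fy0) distrC -[leRHS]mulrA.
apply: ler_pM; [exact: mulr_ge0|exact: normr_ge0| |exact: PL].
by apply: ler_pM => //; exact: invc.
Qed.

Lemma sc11_inv f df : sc11 f df -> (forall x, 0 < f x) ->
  sc11 (fun x => (f x)^-1) (fun j x => - (f x)^-1 ^+ 2 * df j x).
Proof.
move=> sf f0; have lf := sc11_loclip sf; have lV := loclip_inv lf f0.
apply: (@sc11_comp (fun t => t^-1) (fun t => - t^-1 ^+ 2)) => //.
  have := loclipM (@loclip_cst R p (- 1)) (loclipM lV lV).
  by under [X in loclip X]eq_fun do rewrite mulN1r -expr2.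
move=> r; have [c c0 Pc] := loclip_pos_lb lf f0 r.
exists (c^-1 ^+ 3) => [|x y xr yr]; first by rewrite exprn_ge0// invr_ge0 ltW.
have fx0 := f0 x; have fy0 := f0 y.
rewrite (_ : _ - _ = ((f y)^-1 * (f x)^-1 ^+ 2) * (f y - f x) ^+ 2); last first.
  by field; rewrite !gt_eqF.
have inv0 z : 0 <= (f z)^-1 by rewrite invr_ge0 ltW.
have invc z : `|z| <= r -> (f z)^-1 <= c^-1 by move=> zr; rewrite lef_pV2 ?posrE ?Pc.
have ic0 : 0 <= c^-1 by rewrite invr_ge0 ltW.
rewrite ger0_norm; last first.
  by apply: mulr_ge0; [apply: mulr_ge0 => //; exact: sqr_ge0|exact: sqr_ge0].
rewrite ler_wpM2r ?sqr_ge0// [leRHS]exprS.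
apply: ler_pM; [exact: inv0|exact: sqr_ge0|exact: invc|].
by rewrite ler_sqr ?nnegrE ?invc.
Qed.

Lemma loclip_sqrt f : loclip f -> (forall x, 0 < f x) -> loclip (fun x => Num.sqrt (f x)).
Proof.
move=> lf f0 r; have [c c0 Pc] := loclip_pos_lb lf f0 r; have [L L0 PL] := lf r.
have sc0 : 0 < Num.sqrt c by rewrite sqrtr_gt0.
exists ((Num.sqrt c)^-1 * L) => [|x y xr yr]; first by rewrite !mulr_ge0// invr_ge0 ltW.
have sx : Num.sqrt c <= Num.sqrt (f x) by apply: ler_wsqrtr; exact: Pc.
have sy : 0 <= Num.sqrt (f y) by exact: sqrtr_ge0.
have -> : Num.sqrt (f x) - Num.sqrt (f y) =
    (Num.sqrt (f x) + Num.sqrt (f y))^-1 * (f x - f y).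
  rewrite -{3}(sqr_sqrtr (ltW (f0 x))) -{3}(sqr_sqrtr (ltW (f0 y))).
  by field; rewrite gt_eqF// ltr_pwDl// (lt_le_trans sc0).
have s0 : 0 < Num.sqrt (f x) + Num.sqrt (f y) by rewrite ltr_pwDl// (lt_le_trans sc0).
rewrite normrM normfV (gtr0_norm s0) -[leRHS]mulrA.
apply: ler_pM; [by rewrite invr_ge0 ltW|exact: normr_ge0| |exact: PL].
by rewrite lef_pV2 ?posrE//; lra.
Qed.

Lemma sc11_sqrt f df : sc11 f df -> (forall x, 0 < f x) ->
  sc11 (fun x => Num.sqrt (f x)) (fun j x => (2 * Num.sqrt (f x))^-1 * df j x).
Proof.
move=> sf f0; have lf := sc11_loclip sf; have ls := loclip_sqrt lf f0.
have s0 x : 0 < Num.sqrt (f x) by rewrite sqrtr_gt0.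
apply: (@sc11_comp Num.sqrt (fun t => (2 * Num.sqrt t)^-1)) => //.
  by apply: loclip_inv => [|x]; [apply: loclipM => //; exact: loclip_cst|rewrite mulr_gt0].
move=> r; have [c c0 Pc] := loclip_pos_lb ls s0 r.
exists (c^-1 ^+ 3) => [|x y xr yr]; first by rewrite exprn_ge0// invr_ge0 ltW.
have := Pc _ xr; have := Pc _ yr.
have := s0 x; have := s0 y; set a := Num.sqrt (f x); set b := Num.sqrt (f y) => b0 a0 cb ca.
have -> : f x = a ^+ 2 by rewrite sqr_sqrtr// ltW.
have -> : f y = b ^+ 2 by rewrite sqr_sqrtr// ltW.
rewrite (_ : _ - _ = - ((2 * a)^-1 * (b + a)^-1 ^+ 2 * (b ^+ 2 - a ^+ 2) ^+ 2)); last first.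
  by field; rewrite !gt_eqF ?addr_gt0.
have i1 : 0 <= (2 * a)^-1 by rewrite invr_ge0 mulr_ge0// ltW.
have i2 : 0 <= (b + a)^-1 by rewrite invr_ge0 addr_ge0// ltW.
have i3 : 0 <= c^-1 by rewrite invr_ge0 ltW.
rewrite normrN ger0_norm; last first.
  by apply: mulr_ge0; [apply: mulr_ge0 => //; exact: sqr_ge0|exact: sqr_ge0].
rewrite ler_wpM2r ?sqr_ge0// [leRHS]exprS.
apply: ler_pM; [exact: i1|exact: sqr_ge0| |].
  by rewrite lef_pV2 ?posrE ?mulr_gt0//; lra.
by rewrite ler_sqr ?nnegrE// lef_pV2 ?posrE ?addr_gt0//; lra.
Qed.

End scalar_c11.

Section c11_assembly.
Context (R : realType).

Lemma c11_of_coords p (Phi : 'rV[R]_p -> 'rV[R]_p) (M : 'rV[R]_p -> 'M[R]_p) :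
  (forall i, sc11 (fun v => Phi v 0 i) (fun j v => M v j i)) -> c11 Phi M.
Proof.
move=> sP r.
have /choice[C CP] : forall i : 'I_p, exists C, 0 <= C /\ forall x y, `|x| <= r -> `|y| <= r ->
    `|Phi y 0 i - Phi x 0 i - lin (fun j v => M v j i) x y| <= C * `|y - x| ^+ 2.
  by move=> i; have [_ /(_ r)[C C0 PC]] := sP i; exists C.
have /choice[D DP] : forall ij : 'I_p * 'I_p, exists D, 0 <= D /\
    forall x y, `|x| <= r -> `|y| <= r -> `|M x ij.1 ij.2 - M y ij.1 ij.2| <= D * `|x - y|.
  by move=> ij; have [/(_ ij.1)/(_ r)[D D0 PD] _] := sP ij.2; exists D.
have sC : 0 <= \sum_i C i by apply: sumr_ge0 => i _; case: (CP i).
have sD : 0 <= \sum_i D i by apply: sumr_ge0 => i _; case: (DP i).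
exists (\sum_i C i + \sum_i D i) => [|x y xr yr]; first exact: addr_ge0.
split.
  apply: norm_le_coord => [|k i]; first by rewrite mulr_ge0 ?sqr_ge0 ?addr_ge0.
  rewrite !mxE ord1; have [C0 /(_ x y xr yr) PC] := CP i.
  rewrite (_ : \sum_j _ = lin (fun j v => M v j i) x y); last first.
    by apply: eq_bigr => j _; rewrite !mxE.
  apply: le_trans PC _; rewrite ler_wpM2r ?sqr_ge0// (bigD1 i)//= -addrA lerDl.
  by rewrite addr_ge0// sumr_ge0// => l _; case: (CP l).
apply: norm_le_coord => [|k i]; first by rewrite mulr_ge0 ?addr_ge0.
rewrite !mxE; have [D0 /(_ y x yr xr) PD] := DP (k, i).
apply: le_trans PD _; rewrite ler_wpM2r// [X in _ + X](bigD1 (k, i))//= addrCA lerDl.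
by rewrite addr_ge0// sumr_ge0// => l _; case: (DP l).
Qed.

Lemma norm_rsubmx m n (v : 'rV[R]_(m + n)) : `|rsubmx v| <= `|v|.
Proof. by apply: norm_le_coord => // i j; rewrite mxE coord_le_norm. Qed.

Lemma loclip_rsubmx m n (f : 'rV[R]_n -> R) : loclip f ->
  loclip (fun v : 'rV[R]_(m + n) => f (rsubmx v)).
Proof.
move=> lf r; have [C C0 PC] := lf r; exists C => // x y xr yr.
apply: le_trans (PC _ _ _ _) _; rewrite ?(le_trans (norm_rsubmx _))//.
by rewrite ler_wpM2l// -linearB norm_rsubmx.
Qed.

Definition rgrad m n (df : 'I_n -> 'rV[R]_n -> R) (j : 'I_(m + n)) (v : 'rV[R]_(m + n)) : R :=
  if fintype.split j is inr k then df k (rsubmx v) else 0.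

Lemma rgradl m n (df : 'I_n -> 'rV[R]_n -> R) (j : 'I_m) v : rgrad df (lshift n j) v = 0.
Proof. by rewrite /rgrad -[lshift n j]/(unsplit (inl j)) unsplitK. Qed.

Lemma rgradr m n (df : 'I_n -> 'rV[R]_n -> R) (j : 'I_n) v :
  rgrad df (rshift m j) v = df j (rsubmx v).
Proof. by rewrite /rgrad -[rshift m j]/(unsplit (inr j)) unsplitK. Qed.

Lemma sc11_rsubmx m n (f : 'rV[R]_n -> R) df : sc11 f df ->
  sc11 (fun v : 'rV[R]_(m + n) => f (rsubmx v)) (@rgrad m n df).
Proof.
move=> [ldf fP]; split=> [j|r].
  rewrite /rgrad; case: (fintype.split j) => k; first exact: loclip_cst.
  exact: loclip_rsubmx.
have [C C0 PC] := fP r; exists C => // x y xr yr.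
rewrite /lin big_split_ord /= big1 => [|j _]; last by rewrite rgradl mulr0.
rewrite add0r (_ : \sum_i _ = lin df (rsubmx x) (rsubmx y)); last first.
  by apply: eq_bigr => j _; rewrite rgradr !mxE.
apply: le_trans (PC _ _ _ _) _; rewrite ?(le_trans (norm_rsubmx _))//.
by rewrite ler_wpM2l// ler_sqr ?nnegrE// -linearB norm_rsubmx.
Qed.

End c11_assembly.

(** * The Kac-Rice formula *)

Section gaussian_density.
Context (R : realType).

Definition gd p (v : 'rV[R]_p) : R := \prod_i normal_pdf 0 1 (v 0 i).

Lemma gd_ge0 p (v : 'rV[R]_p) : 0 <= gd v.
Proof. by apply: prodr_ge0 => i _; exact: normal_pdf_ge0. Qed.

(** The density sees only the Euclidean norm; this is the source of its orthogonal invariance and of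
    [gd_kr]. *)
Lemma gdE p (v : 'rV[R]_p) : gd v = normal_peak 1 ^+ p * expR (- (v *m v^T) 0 0 / 2).
Proof.
rewrite /gd; under eq_bigr do rewrite normal_pdfE ?oner_neq0//.
rewrite big_split /= prodr_const card_ord; congr (_ * _).
rewrite /normal_fun -expR_sum; congr expR; rewrite mxE mulNr mulr_suml -sumrN.
by apply: eq_bigr => i _; rewrite mxE subr0 expr1n mulNr -expr2.
Qed.

Lemma gd_row_mx m n (x : 'rV[R]_m) (y : 'rV[R]_n) : gd (row_mx x y) = gd x * gd y.
Proof.
rewrite /gd big_split_ord /=; congr (_ * _); apply: eq_bigr => i _.
  by rewrite row_mxEl.
by rewrite row_mxEr.
Qed.

Lemma measurable_gd p : measurable_fun setT (@gd p).
Proof.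
apply: measurable_prod => i _; apply: (measurableT_comp (measurable_normal_pdf _ _)).
exact: measurable_coord.
Qed.

Lemma integral_leb_rV1 (h : R -> \bar R) : measurable_fun setT h -> (forall x, 0 <= h x)%E ->
  (\int[leb 1]_x h (x ord0 ord0) = \int[leb1 R]_t h t)%E.
Proof.
move=> mh h0; have mc : measurable_fun setT (fun t : R => (\row_(i < 1) t)).
  by apply: measurable_fun_rVP => i; under eq_fun do rewrite mxE; exact: measurable_id.
transitivity (\int[pushm (leb1 R) mc]_x h (x ord0 ord0))%E.
  apply: eq_measure_integral => A mA _; apply/esym.
  apply: (@prodm_unique _ (leb1 R) 1 (pushm (leb1 R) mc)) => // B mB.
  rewrite big_ord1 /= /pushforward; congr (leb1 R _).
  apply/seteqP; split => [t /(_ 0)|t Bt i]; first by rewrite mxE.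
  by rewrite mxE ord1.
rewrite (integral_pushm (leb1 R) mc (h := fun x => h (x ord0 ord0)))//.
  by apply: eq_integral => t _; rewrite mxE.
by apply: (measurableT_comp mh); exact: measurable_coord.
Qed.

Lemma integral_leb_prod p (f : 'I_p -> R -> R) : (forall i, measurable_fun setT (f i)) ->
  (forall i t, 0 <= f i t) ->
  (\int[leb p]_x (\prod_i f i (x ord0 i))%:E = \prod_i \int[leb1 R]_t (f i t)%:E)%E.
Proof.
elim: p f => [|p IH] f mf f0.
  rewrite big_ord0; under eq_integral do rewrite big_ord0.
  rewrite integral_cst// mul1e -[RHS](leb_ucube R 0); congr (leb 0 _).
  by apply/seteqP; split => // x _ [].
have mprod q (g : 'I_q -> R -> R) : (forall i, measurable_fun setT (g i)) ->
    measurable_fun setT (fun x : 'rV[R]_q => \prod_i g i (x 0 i)).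
  move=> mg; apply: measurable_prod => i _; apply: (measurableT_comp (mg i)).
  exact: measurable_coord.
rewrite (@integral_prodm_row_mx R (leb1 R) 1 p (fun x => (\prod_i f i (x ord0 i))%:E)); last 2 first.
- by apply/measurable_EFinP; exact: mprod.
- by move=> x; rewrite lee_fin prodr_ge0.
have mm : measurable_fun setT (fun z : 'rV[R]_1 * 'rV[R]_p =>
    (\prod_i f i ((row_mx z.1 z.2 : 'rV[R]_p.+1) 0 i))%:E).
  apply/measurable_EFinP; apply: (measurableT_comp (mprod _ _ mf)).
  exact: (@measurable_row_mx R 1 p).
rewrite fubini_tonelli1//; last by move=> z; rewrite lee_fin prodr_ge0.
rewrite big_ord_recl.
transitivity (\int[leb 1]_t ((f ord0 (t ord0 ord0))%:E *
    \prod_(i < p) \int[leb1 R]_s (f (lift ord0 i) s)%:E))%E.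
  apply: eq_integral => t _; rewrite /fubini_F -IH//.
  rewrite -ge0_integralZl_EFin//.
  - apply: eq_integral => y _; rewrite -EFinM big_ord_recl; congr EFin.
    congr (f _ _ * _).
      rewrite (_ : ord0 = lshift p (ord0 : 'I_1)) ?row_mxEl//; exact/val_inj.
    apply: eq_bigr => i _; congr (f _ _).
    by rewrite (_ : lift ord0 i = rshift 1 i) ?row_mxEr//; exact/val_inj.
  - by move=> y _; rewrite lee_fin prodr_ge0.
  - by apply/measurable_EFinP; exact: (mprod _ (fun i => f (lift ord0 i))).
rewrite ge0_integralZr//.
- congr (_ * _)%E; apply: (@integral_leb_rV1 (fun t => (f ord0 t)%:E)) => [|t].
    by apply/measurable_EFinP; exact: mf.
  by rewrite lee_fin.
- apply/measurable_EFinP; apply: (measurableT_comp (mf ord0)); exact: measurable_coord.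
- by move=> t _; rewrite lee_fin.
- apply: prode_ge0 => i _; apply: integral_ge0 => s _; by rewrite lee_fin.
Qed.

Lemma integral_gd_rect p (B : 'I_p -> set R) : (forall i, measurable (B i)) ->
  (\int[leb p]_(x in rect B) (gd x)%:E = \prod_i normal_prob 0 1 (B i))%E.
Proof.
move=> mB; pose f i t : R := normal_pdf 0 1 t * \1_(B i) t.
transitivity (\int[leb p]_x (\prod_i f i (x ord0 i))%:E)%E.
  rewrite [LHS]integral_mkcond; apply: eq_integral => x _; rewrite patchE.
  rewrite /f big_split /=; case: ifPn => [/set_mem xB|/negP xB].
    rewrite [X in _ * X]big1 ?mulr1// => i _.
    by rewrite indicE mem_set//; exact: xB.
  have [i /negP Bi] : exists i, ~~ (x ord0 i \in B i).
    apply/not_existsP => nB; apply: xB; apply/mem_set => i.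
    by have /negP := nB i; rewrite negbK => /set_mem.
  by rewrite [X in _ * X](bigD1 i)//= indicE (negbTE (introN idP Bi)) mul0r mulr0.
rewrite integral_leb_prod.
- apply: eq_bigr => i _; rewrite integral_leb1.
  + rewrite [RHS]integral_mkcond; apply: eq_integral => t _; rewrite patchE /f indicE.
    by case: (t \in B i); rewrite ?mulr1 ?mulr0.
  + apply/measurable_EFinP; apply: measurable_funM; first exact: measurable_normal_pdf.
    exact: measurable_indic.
  + by move=> t; rewrite lee_fin mulr_ge0 ?normal_pdf_ge0.
- move=> i; apply: measurable_funM; first exact: measurable_normal_pdf.
  exact: measurable_indic.
- by move=> i t; rewrite mulr_ge0 ?normal_pdf_ge0.
Qed.

Lemma integral_gd p : (\int[leb p]_x (gd x)%:E = 1)%E.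
Proof.
have := @integral_gd_rect p (fun=> setT) (fun=> measurableT).
rewrite (_ : rect _ = setT); last by apply/seteqP; split.
move=> ->; rewrite big1// => i _; exact: probability_setT.
Qed.

End gaussian_density.

Section kac_rice.
Context (R : realType) (N n : nat).
Variables (U : 'rV[R]_n -> 'M[R]_(N, n)) (dU : 'I_n -> 'rV[R]_n -> 'M[R]_(N, n)).
Hypothesis sU : forall k i, sc11 (fun x => U x k i) (fun j x => dU j x k i).
Hypothesis UU : forall x, (U x)^T *m U x = 1%:M.
Hypothesis dUU : forall j x, (dU j x)^T *m U x = 0.

Implicit Types (v : 'rV[R]_(N + n)) (f g : 'rV[R]_N) (x s : 'rV[R]_n).

Definition krY x g : 'M[R]_n := \matrix_(j, i) (g *m dU j x) 0 i.

Definition krS x g : 'M[R]_(n, N) := \matrix_(j, k) (g *m U x *m (dU j x)^T) 0 k.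

(* The fibre of [kr] over [(f, s)] is in bijection with the zeros of [f *m U x],
   through [g = f + s *m (U x)^T]; moreover [kr] preserves the Euclidean norm of [g]. *)
Definition kr v : 'rV[R]_(N + n) :=
  let g := lsubmx v in let x := rsubmx v in
  row_mx (g - g *m U x *m (U x)^T) (g *m U x).

(** The upper block row differentiates [kr] in [g], the lower one in [x]. The two lower left terms
    come from the product rule applied to [U x *m (U x)^T]. *)
Definition krM v : 'M[R]_(N + n) :=
  let g := lsubmx v in let x := rsubmx v in
  block_mx (1%:M - U x *m (U x)^T) (U x) (- (krY x g *m (U x)^T) - krS x g) (krY x g).

(** Adding the second block column times [(U x)^T] to the first turns the upper left block into the
    identity and the lower left one into [- krS]. Adding [krS] times the upper row to the lower one
    then clears that block, and it keeps [krY] because [dUU] gives [krS x g *m U x = 0]. *)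
Lemma det_krM v : \det (krM v) = \det (krY (rsubmx v) (lsubmx v)).
Proof.
rewrite /krM; set g := lsubmx v; set x := rsubmx v.
have SU : krS x g *m U x = 0.
  apply/row_matrixP => j; rewrite row_mul row0.
  rewrite (_ : row j _ = g *m U x *m (dU j x)^T); last by apply/rowP => k; rewrite !mxE.
  by rewrite -mulmxA dUU mulmx0.
pose C1 : 'M[R]_(N + n) := block_mx 1%:M 0 (U x)^T 1%:M.
pose C2 : 'M[R]_(N + n) := block_mx 1%:M 0 (krS x g) 1%:M.
have d1 : \det C1 = 1 by rewrite det_lblock !det1 mulr1.
have d2 : \det C2 = 1 by rewrite det_lblock !det1 mulr1.
set M := block_mx _ _ _ _.
have -> : \det M = \det (C2 *m (M *m C1)) by rewrite !det_mulmx d1 d2 mul1r mulr1.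
rewrite !mulmx_block !(mulmx1, mul1mx, mulmx0, mul0mx, add0r, addr0) subrK.
rewrite [- _ - _ + _]addrAC addNr sub0r mulmx1 SU add0r subrr det_ublock det1 mul1r//.
Qed.

(** The columns of [U x] being orthonormal, this is Pythagoras: [g *m U x] holds the coordinates of
    the projection of [g] to their span, and the first component of [kr] is the rest of [g]. *)
Lemma kr_norm v : kr v *m (kr v)^T = lsubmx v *m (lsubmx v)^T.
Proof.
rewrite /kr; set g := lsubmx v; set x := rsubmx v.
rewrite tr_row_mx mul_row_col.
have fU : (g - g *m U x *m (U x)^T) *m U x = 0.
  by rewrite mulmxBl -!mulmxA UU mulmx1 subrr.
rewrite linearB /= [(g *m U x *m (U x)^T)^T]trmx_mul trmxK mulmxBr mulmxA fU mul0mx subr0.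
by rewrite mulmxBl trmx_mul -addrA -[X in _ + (- X + _)]mulmxA addNr addr0.
Qed.

(** The norms agree, but [kr v] has [n] more coordinates than [g]. The extra peaks are the constant
    of the Kac-Rice formula. *)
Lemma gd_kr v : gd (kr v) = normal_peak 1 ^+ n * gd (lsubmx v).
Proof. by rewrite !gdE kr_norm exprD; ring. Qed.

Lemma sc11_krs i : sc11 (fun v => (lsubmx v *m U (rsubmx v)) 0 i) (fun p v => krM v p (rshift N i)).
Proof.
apply: (@eq_sc11 _ _ (fun v => \sum_(l < N) v 0 (lshift n l) * U (rsubmx v) l i) _
  (fun p v => \sum_(l < N) ((p == lshift n l)%:R * U (rsubmx v) l i +
     v 0 (lshift n l) * rgrad (fun j x => dU j x l i) p v))).
- by move=> v; rewrite mxE; apply: eq_bigr => l _; rewrite mxE.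
- move=> p v; rewrite -(fintype.splitK p); case: (fintype.split p) => q /=.
    rewrite block_mxEur (bigD1 q)//= big1 => [|l lq]; last first.
      rewrite rgradl mulr0 addr0 (inj_eq (@lshift_inj _ _)) eq_sym (negbTE lq) mul0r//.
    by rewrite rgradl eqxx mul1r mulr0 !addr0.
  rewrite block_mxEdr !mxE; apply: eq_bigr => l _.
  by rewrite rgradr eq_rlshift mul0r add0r mxE.
- apply: sc11_sum => l; apply: sc11M; first exact: sc11_coord.
  exact: (@sc11_rsubmx R N n (fun x => U x l i) _ (sU l i)).
Qed.

Lemma sc11_krf k : sc11 (fun v => (lsubmx v - lsubmx v *m U (rsubmx v) *m (U (rsubmx v))^T) 0 k)
  (fun p v => krM v p (lshift n k)).
Proof.
(* Function and gradient are spelled out in the shape that the sum and product rules return,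
   including the zero gradient of the constant [- 1]. *)
apply: (@eq_sc11 _ _ (fun v => v 0 (lshift n k) + - 1 *
    \sum_(i < n) (lsubmx v *m U (rsubmx v)) 0 i * U (rsubmx v) k i) _
  (fun p v => (p == lshift n k)%:R + (0 * (\sum_(i < n) (lsubmx v *m U (rsubmx v)) 0 i * U (rsubmx v) k i)
    + - 1 * \sum_(i < n) (krM v p (rshift N i) * U (rsubmx v) k i +
     (lsubmx v *m U (rsubmx v)) 0 i * rgrad (fun j x => dU j x k i) p v)))).
- move=> v; rewrite mulN1r 3!mxE; congr (_ - _); rewrite mxE; apply: eq_bigr => i _.
  by rewrite [(U _)^T _ _]mxE.
- move=> p v; rewrite mul0r add0r mulN1r.
  rewrite -(fintype.splitK p); case: (fintype.split p) => q /=.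
    rewrite block_mxEul (inj_eq (@lshift_inj _ _)) 3!mxE; congr (_ - _).
    rewrite mxE; apply: eq_bigr => i _.
    by rewrite block_mxEur rgradl mulr0 addr0 [(U _)^T _ _]mxE.
  rewrite block_mxEdl eq_rlshift add0r 4!mxE -opprD; congr (- _).
  rewrite big_split /=; congr (_ + _).
    by apply: eq_bigr => i _; rewrite block_mxEdr [(U _)^T _ _]mxE.
  rewrite /krS mxE mxE; apply: eq_bigr => i _.
  by rewrite rgradr [(dU _ _)^T _ _]mxE.
- apply: sc11D; first exact: sc11_coord.
  apply: sc11M; first exact: sc11_cst.
  apply: sc11_sum => i; apply: sc11M; first exact: sc11_krs.
  exact: (@sc11_rsubmx R N n (fun x => U x k i) _ (sU k i)).
Qed.

Lemma c11_kr : c11 kr krM.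
Proof.
apply: c11_of_coords => i; rewrite -(fintype.splitK i).
case: (fintype.split i) => j /=; rewrite /kr.
  by apply: eq_sc11 (sc11_krf j) => // v; rewrite row_mxEl.
by apply: eq_sc11 (sc11_krs j) => // v; rewrite row_mxEr.
Qed.

(** By [det_krM] the integrand is the Jacobian of [kr], which is continuous, hence jointly
    measurable in [g] and [x]; the partial integral is then measurable by Tonelli. *)
Lemma measurable_integral_krY : measurable_fun setT (fun x =>
  \int[leb N]_g (gd g * `|\det (krY x g)|)%:E)%E.
Proof.
pose H (z : 'rV[R]_N * 'rV[R]_n) : \bar R := (gd z.1 * `|\det (krM (row_mx z.1 z.2))|)%:E.
have mH : measurable_fun setT H.
  apply/measurable_EFinP; apply: measurable_funM.
    by apply: (measurableT_comp (@measurable_gd R N)); exact: measurable_fst.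
  have /measurable_EFinP ma := measurable_absdet c11_kr.
  exact: (measurableT_comp ma (@measurable_row_mx R N n)).
have H0 z : (0 <= H z)%E by rewrite lee_fin mulr_ge0 ?gd_ge0.
have := measurable_fun_fubini_tonelli_G (m1 := leb N) _ mH H0.
apply: eq_measurable_fun => x _; apply: eq_integral => g _.
by rewrite /H /= det_krM row_mxKl row_mxKr.
Qed.

Definition zeros (D : set 'rV[R]_n) f := [set x | D x /\ f *m U x = 0].

Lemma kr_fibre (D : set 'rV[R]_n) f s :
  (\esum_(v in [set v | D (rsubmx v) /\ kr v = row_mx f s]) 1 =
   \esum_(x in zeros D f) 1 :> \bar R)%E.
Proof.
pose e x : 'rV[R]_(N + n) := row_mx (f + s *m (U x)^T) x.
rewrite (reindex_esum (zeros D f) _ e)//; split.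
- move=> x [Dx fx] /=; rewrite /e row_mxKr; split => //.
  rewrite /kr row_mxKl row_mxKr mulmxDl fx add0r -[s *m _ *m _]mulmxA UU mulmx1.
  by rewrite addrK.
- by move=> x y _ _ /(congr1 rsubmx); rewrite !row_mxKr.
- move=> v [Dv /eq_row_mx[Ef Es]]; exists (rsubmx v).
    split => //; rewrite -Ef mulmxBl -!mulmxA UU mulmx1 subrr//.
  by rewrite /e -Es -Ef subrK hsubmxK.
Qed.

(** The area formula for [kr] with weight [gd] yields a measurable count [Nc], equal to the fibre
    count off a null set of pairs [(f, s)]. By [kr_fibre] that count depends on [f] alone, so for
    almost every [f] it is recovered as [C f], the mean of [Nc] over a Gaussian [s]. *)
Theorem kac_rice (D : set 'rV[R]_n) : measurable D ->
  exists (Z : set 'rV[R]_N) (C : 'rV[R]_N -> \bar R),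
  [/\ measurable Z, leb N Z = 0%E, measurable_fun setT C, (forall f, 0 <= C f)%E &
    (forall f, ~ Z f -> \esum_(x in zeros D f) 1 = C f)%E /\
    (\int[leb N]_f (C f * (gd f)%:E) =
     \int[leb n]_(x in D) ((normal_peak 1 ^+ n)%:E *
       \int[leb N]_g (gd g * `|\det (krY x g)|)%:E))%E].
Proof.
move=> mD; pose DD := [set v : 'rV[R]_(N + n) | D (rsubmx v)].
have mrs : measurable_fun setT (fun v : 'rV[R]_(N + n) => rsubmx v).
  by apply: measurable_fun_rVP => i; under eq_fun do rewrite mxE; exact: measurable_coord.
have mDD : measurable DD by rewrite -[X in measurable X]setTI; exact: mrs.
have [Z [Nc [mZ Z0 mNc Nc0 [NcE NcI]]]] :=
  area_formula c11_kr mDD (@measurable_gd R (N + n)) (@gd_ge0 R _).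
have mrow := @measurable_row_mx R N n.
have mrowf f : measurable_fun setT (fun s => row_mx f s : 'rV[R]_(N + n)).
  exact: (measurable_fun_pair2 f mrow).
have mgdE p : measurable_fun setT (fun v : 'rV[R]_p => (gd v)%:E).
  by apply/measurable_EFinP; exact: measurable_gd.
have gd0 p (v : 'rV[R]_p) : (0 <= (gd v)%:E)%E by rewrite lee_fin gd_ge0.
pose F f := (\int[leb n]_s (\1_Z (row_mx f s))%:E)%E : \bar R.
have mFz : measurable_fun setT (fun z : 'rV[R]_N * 'rV[R]_n => (\1_Z (row_mx z.1 z.2))%:E : \bar R).
  by apply/measurable_EFinP; exact: (measurableT_comp (measurable_indic mZ)).
have mF : measurable_fun setT F.
  by apply: (measurable_fun_fubini_tonelli_F _ mFz) => z; rewrite lee_fin.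
have F0 f : (0 <= F f)%E by apply: integral_ge0 => s _; rewrite lee_fin.
have IF : (\int[leb N]_f `|F f| = 0)%E.
  under eq_integral do rewrite gee0_abs//.
  have z0 (z : 'rV[R]_N * 'rV[R]_n) : (0 <= (\1_Z (row_mx z.1 z.2))%:E :> \bar R)%E.
    by rewrite lee_fin.
  have <- := fubini_tonelli1 (m1 := leb N) (m2 := leb n) _ mFz z0.
  rewrite -(@integral_prodm_row_mx R (leb1 R) N n (fun v => (\1_Z v)%:E))//.
    by rewrite integralT_indic.
  exact/measurable_EFinP/measurable_indic.
(* By Tonelli almost every section of the null set [Z] is null; [Z1] contains the [f] whose section
   is not. *)
have [Z1 [mZ1 Z10 Z1P]] : (leb N).-negligible [set f | F f != 0%E].
  have [+ _] := ae_eq_integral_abs (leb N) measurableT mF.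
  move=> /(_ IF)[A [mA A0 AP]]; exists A; split => //.
  by apply: subset_trans AP => f /eqP Ff /= /(_ I).
pose C f := (\int[leb n]_s (Nc (row_mx f s) * (gd s)%:E))%E.
have mCz : measurable_fun setT (fun z : 'rV[R]_N * 'rV[R]_n => Nc (row_mx z.1 z.2) * (gd z.2)%:E)%E.
  apply: emeasurable_funM; first exact: (measurableT_comp mNc).
  exact: (measurableT_comp (mgdE n)).
have C0z (z : 'rV[R]_N * 'rV[R]_n) : (0 <= Nc (row_mx z.1 z.2) * (gd z.2)%:E)%E.
  by rewrite mule_ge0.
have mC : measurable_fun setT C by exact: (measurable_fun_fubini_tonelli_F _ mCz).
have C0 f : (0 <= C f)%E by apply: integral_ge0 => s _; exact: (C0z (f, s)).
exists Z1, C; split => //; split => [f Zf|].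
  have c0 : (0 <= \esum_(x in zeros D f) (1 : \bar R))%E by apply: esum_ge0.
  have mZf : measurable [set s | Z (row_mx f s)].
    by rewrite -[X in measurable X]setTI; exact: mrowf.
  have Zf0 : leb n [set s | Z (row_mx f s)] = 0%E.
    rewrite -[LHS]integralT_indic//; apply/eqP; apply/negPn/negP => Ff.
    by apply: Zf; apply: Z1P.
  transitivity (\int[leb n]_s ((\esum_(x in zeros D f) (1 : \bar R)) * (gd s)%:E))%E.
    rewrite [RHS](ge0_integralZl (leb n) measurableT (mgdE n) (fun s _ => gd0 n s) c0).
    by rewrite integral_gd mule1.
  apply: ge0_ae_eq_integral => //.
  - by apply: measurable_funeM; exact: mgdE.
  - exact: (measurable_fun_pair2 f mCz).
  - by move=> s _; rewrite mule_ge0.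
  - by move=> s _; exact: (C0z (f, s)).
  - exists [set s | Z (row_mx f s)]; split => // s /= /not_implyP[_ h].
    apply: contrapT => Zs; apply: h; rewrite -NcE//; congr (_ * _)%E.
    by rewrite -(kr_fibre D f s).
transitivity (\int[leb (N + n)]_v (Nc v * (gd v)%:E))%E.
  have mNg : measurable_fun setT (fun v : 'rV[R]_(N + n) => Nc v * (gd v)%:E)%E.
    by apply: emeasurable_funM => //; exact: mgdE.
  rewrite (@integral_prodm_row_mx R (leb1 R) N n (fun v => Nc v * (gd v)%:E)%E); last 2 first.
  - exact: mNg.
  - by move=> v; rewrite mule_ge0.
  rewrite fubini_tonelli1//; last 2 first.
  - exact: (measurableT_comp mNg mrow).
  - by move=> z; rewrite mule_ge0.
  apply: eq_integral => f _; rewrite /C -ge0_integralZr//.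
  - by apply: eq_integral => s _ /=; rewrite gd_row_mx -muleA -EFinM mulrC.
  - exact: (measurable_fun_pair2 f mCz).
  - by move=> s _; exact: (C0z (f, s)).
rewrite NcI; pose c : R := normal_peak 1 ^+ n.
have c0 : 0 <= c by rewrite exprn_ge0// normal_peak_ge0.
pose H v : \bar R := ((c * gd (lsubmx v) * `|\det (krM v)|) * \1_D (rsubmx v))%:E.
have gl : measurable_fun setT (fun v : 'rV[R]_(N + n) => gd (lsubmx v)).
  apply: (measurableT_comp (@measurable_gd R N)); apply: measurable_fun_rVP => i.
  by under eq_fun do rewrite mxE; exact: measurable_coord.
have mH : measurable_fun setT H.
  apply/measurable_EFinP; apply: measurable_funM; last first.
    exact: (measurableT_comp (measurable_indic mD)).
  apply: measurable_funM; first exact: measurable_funM.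
  by have /measurable_EFinP := measurable_absdet c11_kr.
have H0 v : (0 <= H v)%E by rewrite lee_fin !mulr_ge0// gd_ge0.
transitivity (\int[leb (N + n)]_v H v)%E.
  rewrite [LHS]integral_mkcond; apply: eq_integral => v _; rewrite patchE /H indicE.
  rewrite (_ : (v \in DD) = (rsubmx v \in D)); last by apply/idP/idP => /set_mem ?; apply/mem_set.
  by case: (_ \in D); rewrite ?mulr0// mulr1 -EFinM gd_kr.
rewrite (@integral_prodm_row_mx R (leb1 R) N n H)// fubini_tonelli2//; last first.
  exact: (measurableT_comp mH).
rewrite [RHS]integral_mkcond; apply: eq_integral => x _.
rewrite patchE /fubini_G /H /=; case: ifPn => xD.
  rewrite -ge0_integralZl_EFin//.
  - apply: eq_integral => g _; rewrite row_mxKr row_mxKl indicE xD mulr1 det_krM.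
    by rewrite row_mxKr row_mxKl -EFinM mulrA.
  - by move=> g _; rewrite lee_fin mulr_ge0// gd_ge0.
  - apply/measurable_EFinP; apply: measurable_funM; first exact: measurable_gd.
    have /measurable_EFinP ma := measurable_absdet c11_kr.
    have /(measurableT_comp ma) := measurable_fun_pair1 x mrow.
    apply: eq_measurable_fun => g _ /=; by rewrite det_krM row_mxKr row_mxKl.
by under eq_integral do rewrite row_mxKr indicE (negbTE xD) mulr0; exact: integral0.
Qed.

End kac_rice.

(** * Gaussian means and Gram matrices *)

Section orthogonal.
Context (R : realType).

Lemma tr_mul_self_gt0 p (w : 'cV[R]_p) : w != 0 -> 0 < (w^T *m w) 0 0.
Proof.
move=> w0; rewrite mxE lt_def sumr_ge0 ?andbT => [|i _]; last by rewrite mxE -expr2 sqr_ge0.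
apply: contra_neq w0 => w0; apply/colP => i; rewrite mxE.
have : (w^T) 0 i * w i 0 = 0.
  by move: w0 => /psumr_eq0P; apply => // j _; rewrite mxE -expr2 sqr_ge0.
by rewrite mxE => /eqP; rewrite -expr2 sqrf_eq0 => /eqP.
Qed.

(** The reflection in the hyperplane orthogonal to [v - v']. It fixes exactly the vectors orthogonal
    to [v - v'], which are those with equal products with [v] and [v']. *)
Lemma householder p (v v' : 'cV[R]_p) : v^T *m v = v'^T *m v' ->
  exists H : 'M[R]_p, [/\ H *m H^T = 1%:M, H *m v = v' &
    forall u : 'cV[R]_p, v^T *m u = v'^T *m u -> H *m u = u].
Proof.
move=> vv; have [w0|w0] := eqVneq (v - v') 0.
  exists 1%:M; split => [||u _]; rewrite ?trmx1 ?mul1mx//.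
  by apply/eqP; rewrite -subr_eq0 w0.
set w := v - v' in w0; pose c := (w^T *m w) 0 0.
have c0 : c != 0 by rewrite gt_eqF// tr_mul_self_gt0.
have wwE : w^T *m w = c%:M by rewrite [LHS]mx11_scalar.
pose H : 'M[R]_p := 1%:M - (2 / c) *: (w *m w^T).
have HT : H^T = H by rewrite /H linearB /= trmx1 linearZ /= trmx_mul trmxK.
have Hu u : H *m u = u - (2 / c) *: (w *m (w^T *m u)).
  by rewrite /H mulmxBl mul1mx -scalemxAl mulmxA.
exists H; split.
- rewrite HT Hu /H mulmxBr mulmx1 -scalemxAr mulmxA wwE mul_scalar_mx.
  rewrite mulmxBr -scalemxAr -scalemxAr !scalerA mulfVK//.
  by rewrite [2 *: _]scaler_nat mulr2n opprD addNKr scalerN opprK subrK.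
(* Because [v] and [v'] have equal norms, [v] has product [c / 2] with [w], so the reflection
   subtracts exactly [w] from [v]. *)
- have wv : 2 *: (w^T *m v) = c%:M.
    rewrite -wwE {2}/w mulmxBr; apply/eqP; rewrite -subr_eq0 opprB addrCA; apply/eqP.
    rewrite (_ : 2 = 1 + 1)// scalerDl scale1r addrK -mulmxDr /w linearB /= mulmxBl !mulmxDr.
    have -> : v'^T *m v = v^T *m v'.
      by apply/matrixP => i j; rewrite !ord1 !mxE; apply: eq_bigr => k _; rewrite !mxE mulrC.
    by rewrite vv [X in _ - X]addrC subrr.
  rewrite Hu mulrC -scalerA scalemxAr wv mul_mx_scalar scalerA mulVf// scale1r.
  by rewrite /w opprB addrC subrK.
- move=> u vu; have wu : w^T *m u = 0 by rewrite /w linearB /= mulmxBl vu subrr.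
  by rewrite Hu wu mulmx0 scaler0 subr0.
Qed.

Lemma col_mulmx m p k (Q : 'M[R]_(m, p)) (A : 'M[R]_(p, k)) j :
  col j (Q *m A) = Q *m col j A.
Proof. by rewrite !colE mulmxA. Qed.

(** The columns are aligned one at a time, each by a reflection. Equality of the Gram matrices gives
    the next column equal norms, and gives the columns already aligned equal products with both
    vectors, so the reflection leaves them in place. *)
Lemma gram_orthogonal p k (A B : 'M[R]_(p, k)) : A^T *m A = B^T *m B ->
  exists2 Q : 'M[R]_p, Q *m Q^T = 1%:M & Q *m A = B.
Proof.
move=> AB.
suff /(_ k)[Q QQ QA] : forall m, exists2 Q : 'M[R]_p, Q *m Q^T = 1%:M &
    forall j : 'I_k, (j < m)%N -> Q *m col j A = col j B.
  exists Q => //; apply/matrixP => i j; have /colP/(_ i) := QA j (ltn_ord j).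
  by rewrite -col_mulmx !mxE.
have gram i j : (col i A)^T *m col j A = (col i B)^T *m col j B.
  have := congr1 (fun M : 'M[R]_k => col j (row i M)) AB.
  by rewrite !row_mul !col_mulmx !tr_col.
elim=> [|m [Q QQ QA]]; first by exists 1%:M; rewrite ?trmx1 ?mul1mx.
have [km|mk] := leqP k m.
  by exists Q => // j _; apply: QA; exact: leq_trans (ltn_ord j) km.
have QTQ : Q^T *m Q = 1%:M by apply: mulmx1C.
have QG i j : (Q *m col i A)^T *m (Q *m col j A) = (col i A)^T *m col j A.
  by rewrite trmx_mul -mulmxA [Q^T *m _]mulmxA QTQ mul1mx.
pose j0 := Ordinal mk.
have [H [HH Hv Hu]] := @householder p (Q *m col j0 A) (col j0 B) (etrans (QG _ _) (gram _ _)).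
exists (H *m Q) => [|j].
  by rewrite trmx_mul mulmxA -[H *m Q *m _]mulmxA QQ mulmx1.
rewrite ltnS leq_eqVlt => /orP[/eqP jm|jm]; rewrite -mulmxA.
  by rewrite (_ : j = j0)//; exact: val_inj.
rewrite QA// Hu// -{1}(QA _ jm) QG; exact: gram.
Qed.

End orthogonal.

Section gaussian_law.
Context (R : realType).

Lemma gd_orthogonal p (Q : 'M[R]_p) v : Q *m Q^T = 1%:M -> gd (v *m Q) = gd v.
Proof. by move=> QQ; rewrite !gdE trmx_mul mulmxA -[v *m Q *m _]mulmxA QQ mulmx1. Qed.

Lemma measurable_gdE p : measurable_fun setT (fun v : 'rV[R]_p => (gd v)%:E).
Proof. by apply/measurable_EFinP; exact: measurable_gd. Qed.

Lemma gdE_ge0 p (v : 'rV[R]_p) : (0 <= (gd v)%:E)%E.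
Proof. by rewrite lee_fin gd_ge0. Qed.

Lemma integral_gd_orthogonal p (Q : 'M[R]_p) (h : 'rV[R]_p -> \bar R) :
  Q *m Q^T = 1%:M -> measurable_fun setT h -> (forall x, 0 <= h x)%E ->
  (\int[leb p]_v (h (v *m Q) * (gd v)%:E) = \int[leb p]_v (h v * (gd v)%:E))%E.
Proof.
move=> QQ mh h0.
under eq_integral => v _ do rewrite -(gd_orthogonal v QQ).
have /eqP dQ : `|\det Q| == 1.
  by rewrite -sqrp_eq1// -normrX ger0_norm ?sqr_ge0// expr2 -{2}det_tr -det_mulmx QQ det1.
rewrite (@integral_leb_mulmx R p Q (fun v => h v * (gd v)%:E)%E).
- by rewrite dQ invr1 mul1e.
- by rewrite unitmxE unitfE -normr_eq0 dQ oner_eq0.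
- by apply: emeasurable_funM => //; exact: measurable_gdE.
- by move=> v; rewrite mule_ge0 ?gdE_ge0.
Qed.

(** Zero rows correspond to Gaussian coordinates that do not enter [h] and integrate to 1. Padding
    brings matrices with different numbers of rows to one size. *)
Lemma integral_gd_padl m n k (A : 'M[R]_(m, k)) (h : 'rV[R]_k -> \bar R) :
  measurable_fun setT h -> (forall x, 0 <= h x)%E ->
  (\int[leb (m + n)]_v (h (v *m col_mx A (0%R : 'M[R]_(n, k))) * (gd v)%:E) =
   \int[leb m]_g (h (g *m A) * (gd g)%:E))%E.
Proof.
move=> mh h0; set H := fun v : 'rV[R]_(m + n) => (h (v *m col_mx A 0) * (gd v)%:E)%E.
have mH : measurable_fun setT H.
  apply: emeasurable_funM; last exact: measurable_gdE.
  by apply: (measurableT_comp mh); exact: measurable_mulmx.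
have H0 v : (0 <= H v)%E by rewrite mule_ge0 ?gdE_ge0.
rewrite (@integral_prodm_row_mx R (leb1 R) m n H)// fubini_tonelli1//; last first.
  by apply: (measurableT_comp mH); exact: (@measurable_row_mx R m n).
apply: eq_integral => g _; rewrite /fubini_F /=.
transitivity (\int[leb n]_y ((h (g *m A) * (gd g)%:E) * (gd y)%:E))%E.
  apply: eq_integral => y _.
  by rewrite /H mul_row_col mulmx0 addr0 gd_row_mx EFinM muleA.
have hg0 : (0 <= h (g *m A) * (gd g)%:E)%E by rewrite mule_ge0 ?gdE_ge0.
rewrite (ge0_integralZl (leb n) measurableT (@measurable_gdE n) (fun s _ => @gdE_ge0 n s) hg0).
by rewrite integral_gd mule1.
Qed.

Lemma integral_gd_padr m n k (A : 'M[R]_(n, k)) (h : 'rV[R]_k -> \bar R) :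
  measurable_fun setT h -> (forall x, 0 <= h x)%E ->
  (\int[leb (m + n)]_v (h (v *m col_mx (0%R : 'M[R]_(m, k)) A) * (gd v)%:E) =
   \int[leb n]_g (h (g *m A) * (gd g)%:E))%E.
Proof.
move=> mh h0; set H := fun v : 'rV[R]_(m + n) => (h (v *m col_mx 0 A) * (gd v)%:E)%E.
have mH : measurable_fun setT H.
  apply: emeasurable_funM; last exact: measurable_gdE.
  by apply: (measurableT_comp mh); exact: measurable_mulmx.
have H0 v : (0 <= H v)%E by rewrite mule_ge0 ?gdE_ge0.
rewrite (@integral_prodm_row_mx R (leb1 R) m n H)// fubini_tonelli2//; last first.
  by apply: (measurableT_comp mH); exact: (@measurable_row_mx R m n).
apply: eq_integral => g _; rewrite /fubini_G /=.
transitivity (\int[leb m]_y ((h (g *m A) * (gd g)%:E) * (gd y)%:E))%E.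
  apply: eq_integral => y _.
  by rewrite /H mul_row_col mulmx0 add0r gd_row_mx mulrC EFinM muleA.
have hg0 : (0 <= h (g *m A) * (gd g)%:E)%E by rewrite mule_ge0 ?gdE_ge0.
rewrite (ge0_integralZl (leb m) measurableT (@measurable_gdE m) (fun s _ => @gdE_ge0 m s) hg0).
by rewrite integral_gd mule1.
Qed.

(** The law of [g *m A] depends only on [A^T *m A]: once padded to [m + n] rows, [A] and [B] differ
    by an orthogonal factor, under which [gd] is invariant. *)
Lemma integral_gd_gram m n k (A : 'M[R]_(m, k)) (B : 'M[R]_(n, k)) (h : 'rV[R]_k -> \bar R) :
  A^T *m A = B^T *m B -> measurable_fun setT h -> (forall x, 0 <= h x)%E ->
  (\int[leb m]_g (h (g *m A) * (gd g)%:E) = \int[leb n]_g (h (g *m B) * (gd g)%:E))%E.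
Proof.
move=> AB mh h0; rewrite -(@integral_gd_padl m n)// -(@integral_gd_padr m n)//.
have [|Q QQ QA] := @gram_orthogonal R (m + n) k (col_mx 0 B) (col_mx A 0).
  by rewrite !tr_col_mx !mul_row_col !trmx0 !mul0mx add0r addr0.
rewrite -QA; under eq_integral do rewrite mulmxA.
rewrite (@integral_gd_orthogonal _ Q (fun v => h (v *m col_mx 0 B)))//.
by apply: (measurableT_comp mh); exact: measurable_mulmx.
Qed.

Definition rowsmx N n (W : 'I_n -> 'M[R]_(N, n)) (g : 'rV[R]_N) : 'M[R]_n :=
  \matrix_(j, i) (g *m W j) 0 i.

(** Flattened, the matrices [W j] form one matrix with a column for each pair [(j, i)], and the
    determinant is a function of the resulting Gaussian vector. The hypothesis says that [W'] has
    the Gram matrix of the family [V], which is [W] with column [i] scaled by [c i]; the scalings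
    leave the determinant as factors. *)
Lemma integral_absdet_gram N N' n (W : 'I_n -> 'M[R]_(N, n)) (W' : 'I_n -> 'M[R]_(N', n))
    (c : 'I_n -> R) :
  (forall j j' i i', \sum_k W' j k i * W' j' k i' = c i * c i' * \sum_k W j k i * W j' k i') ->
  (\int[leb N']_g (gd g * `|\det (rowsmx W' g)|)%:E =
   `|\prod_i c i|%:E * \int[leb N]_g (gd g * `|\det (rowsmx W g)|)%:E)%E.
Proof.
move=> WW.
pose A M (V : 'I_n -> 'M[R]_(M, n)) : 'M[R]_(M, n * n) :=
  \matrix_k mxvec (\matrix_(j, i) V j k i).
have AE M (V : 'I_n -> 'M[R]_(M, n)) g : rowsmx V g = vec_mx (g *m A M V).
  rewrite -[LHS]mxvecK; congr vec_mx; rewrite mulmx_sum_row; apply/rowP => q.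
  case/mxvec_indexP: q => j i; rewrite mxvecE !mxE summxE; apply: eq_bigr => k _.
  by rewrite rowK [in RHS]mxE mxvecE mxE.
pose h (y : 'rV[R]_(n * n)) : \bar R := `|\det (vec_mx y)|%:E.
have h0 y : (0 <= h y)%E by rewrite lee_fin.
have mh : measurable_fun setT h.
  apply/measurable_EFinP; apply: (measurableT_comp (@normr_measurable R setT)).
  apply: measurable_sum => s; apply: measurable_funM; first exact: measurable_cst.
  apply: measurable_prod => i _; under eq_fun do rewrite mxE.
  exact: measurable_coord.
have hE M (V : 'I_n -> 'M[R]_(M, n)) : (\int[leb M]_g (gd g * `|\det (rowsmx V g)|)%:E =
    \int[leb M]_g (h (g *m A M V) * (gd g)%:E))%E.
  by apply: eq_integral => g _; rewrite AE mulrC EFinM.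
pose V j : 'M[R]_(N, n) := W j *m diag_mx (\row_i c i).
have VE j k i : V j k i = W j k i * c i by rewrite /V mul_mx_diag !mxE.
transitivity (\int[leb N]_g (gd g * `|\det (rowsmx V g)|)%:E)%E.
  rewrite !hE; apply: integral_gd_gram => //; apply/matrixP => q q'.
  case/mxvec_indexP: q => j i; case/mxvec_indexP: q' => j' i'.
  rewrite !mxE.
  transitivity (\sum_k W' j k i * W' j' k i').
    by apply: eq_bigr => k _; rewrite !mxE !mxvecE !mxE.
  rewrite WW mulr_sumr; apply: eq_bigr => k _.
  by rewrite [A N V k]/= !mxE !mxvecE ![(\matrix_(_, _) _) _ _]mxE !VE; ring.
have dV g : \det (rowsmx V g) = \prod_i c i * \det (rowsmx W g).
  rewrite (_ : rowsmx V g = rowsmx W g *m diag_mx (\row_i c i)).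
    by rewrite det_mulmx det_diag mulrC; congr (_ * _); apply: eq_bigr => i _; rewrite mxE.
  by apply/matrixP => j i; rewrite mul_mx_diag !mxE mulr_suml; apply: eq_bigr => k _;
    rewrite VE mulrA.
rewrite -ge0_integralZl_EFin//.
- by apply: eq_integral => g _; rewrite dV normrM -EFinM mulrCA.
- by move=> g _; rewrite lee_fin mulr_ge0 ?gd_ge0.
- apply/measurable_EFinP; apply: measurable_funM; first exact: measurable_gd.
  under eq_fun do rewrite AE.
  have /measurable_EFinP := mh => /measurableT_comp; apply.
  exact: measurable_mulmx.
Qed.

End gaussian_law.

(** * Exponential sums *)

Section lower_integral.
Context d (T : measurableType d) (R : realType) (mu : {measure set T -> \bar R}).
Local Open Scope ereal_scope.

(* The library integral of a nonnegative function is a lower integral, hence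
   monotone without any measurability assumption. *)
Lemma le_integral_nonmeas (f g : T -> \bar R) : (forall x, 0 <= f x) ->
  (forall x, f x <= g x) -> \int[mu]_x f x <= \int[mu]_x g x.
Proof.
move=> f0 fg; have g0 x : 0 <= g x := le_trans (f0 x) (fg x).
rewrite !ge0_integralTE//; apply: ereal_sup_le => _ [h hf <-]; exists h => // x.
exact: le_trans (hf x) (fg x).
Qed.

Lemma eq_integral_outside_null (Z : set T) (g h : T -> \bar R) :
  measurable Z -> mu Z = 0 -> measurable_fun setT h ->
  (forall x, 0 <= g x) -> (forall x, 0 <= h x) ->
  (forall x, ~ Z x -> g x = h x) -> \int[mu]_x g x = \int[mu]_x h x.
Proof.
move=> mZ Z0 mh g0 h0 gh.
have aeZ (k : T -> \bar R) : measurable_fun setT k -> (forall x, 0 <= k x) ->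
    (forall x, ~ Z x -> k x = h x) -> \int[mu]_x k x = \int[mu]_x h x.
  move=> mk k0 kh; apply: ge0_ae_eq_integral => //.
  exists Z; split => // x /= /not_implyP[_ kx]; apply: contrapT => Zx; apply: kx.
  exact: kh.
have iZ x : Z x -> (\1_Z x = 1 :> R)%R by move=> Zx; rewrite indicE mem_set.
have iC x : ~ Z x -> (\1_Z x = 0 :> R)%R by move=> Zx; rewrite indicE memNset.
have jZ x : Z x -> (\1_(~` Z) x = 0 :> R)%R by move=> Zx; rewrite indicE memNset//; exact.
have jC x : ~ Z x -> (\1_(~` Z) x = 1 :> R)%R by move=> Zx; rewrite indicE mem_set.
apply/eqP; rewrite eq_le; apply/andP; split.
  pose k x := h x + +oo * (\1_Z x)%:E.
  have k0 x : 0 <= k x by rewrite adde_ge0// mule_ge0// lee_fin.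
  rewrite -(aeZ k)//.
  - apply: le_integral_nonmeas => // x; rewrite /k; have [Zx|Zx] := pselect (Z x).
      by rewrite iZ// mule1 addey ?leey// gt_eqF// (lt_le_trans _ (h0 x))// ltNyr.
    by rewrite iC// mule0 adde0 gh.
  - apply: emeasurable_funD => //; apply: measurable_funeM.
    exact/measurable_EFinP/measurable_indic.
  - by move=> x Zx; rewrite /k iC// mule0 adde0.
pose k x := h x * (\1_(~` Z) x)%:E.
have k0 x : 0 <= k x by rewrite mule_ge0// lee_fin.
rewrite -(aeZ k)//.
- apply: le_integral_nonmeas => // x; rewrite /k; have [Zx|Zx] := pselect (Z x).
    by rewrite jZ// mule0.
  by rewrite jC// mule1 gh.
- apply: emeasurable_funM => //.
  by apply/measurable_EFinP/measurable_indic; exact: measurableC.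
- by move=> x Zx; rewrite /k jC// mule1.
Qed.

End lower_integral.

(** * Moments and covariances of a space of exponential sums *)

Section exponential_spaces.
Context (R : realType) (n : nat).
Implicit Types (F G : espace n R) (a b c : 'rV[int]_n) (x : 'rV[R]_n) (psi : 'rV[int]_n -> R).

Definition mom F psi : R := \sum_(a <- supp F) coef F a ^+ 2 * psi a.

(** Squaring removes the root in the coefficients of the product, and each pair [(b, c)] is counted
    once, at [a = b + c]: the squared coefficients are convolved. *)
Lemma mom_esmul F G psi : mom (esmul F G) psi =
  \sum_(b <- supp F) \sum_(c <- supp G) coef F b ^+ 2 * coef G c ^+ 2 * psi (b + c).
Proof.
rewrite /mom /=; set L := undup _.
transitivity (\sum_(a <- L) \sum_(b <- supp F) \sum_(c <- supp G)
   if b + c == a then coef F b ^+ 2 * coef G c ^+ 2 * psi a else 0).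
  apply: eq_bigr => a _; rewrite sqr_sqrtr; last first.
    by do 2 (apply: sumr_ge0 => ? _); rewrite mulr_ge0 ?sqr_ge0.
  by rewrite mulr_suml; apply: eq_bigr => b _; rewrite mulr_suml big_mkcond.
rewrite exchange_big /= big_seq [RHS]big_seq; apply: eq_bigr => b bF.
rewrite exchange_big /= big_seq [RHS]big_seq; apply: eq_bigr => c cG.
rewrite (bigD1_seq (b + c)) ?undup_uniq//=; last first.
  by rewrite mem_undup; apply/allpairsP; exists (b, c).
by rewrite eqxx big1 ?addr0// => a /negbTE ab; rewrite eq_sym ab.
Qed.

(** If [psi (b + c)] is a finite sum of products, the double sum factors. The list [L] holds these
    products, and the moments of order 0, 1 and 2 need one, two and four of them. *)
Lemma mom_esmul_bilinear F G psi
    (L : seq (('rV[int]_n -> R) * ('rV[int]_n -> R))) :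
  (forall b c, psi (b + c) = \sum_(l <- L) l.1 b * l.2 c) ->
  mom (esmul F G) psi = \sum_(l <- L) mom F l.1 * mom G l.2.
Proof.
move=> psiE; rewrite mom_esmul.
under eq_bigr do under eq_bigr do rewrite psiE mulr_sumr.
under eq_bigr do rewrite exchange_big.
rewrite exchange_big /=; apply: eq_bigr => l _; rewrite /mom mulr_suml.
apply: eq_bigr => b _; rewrite mulr_sumr; apply: eq_bigr => c _; ring.
Qed.

Lemma espace_valid_esmul F G : espace_valid F -> espace_valid G -> espace_valid (esmul F G).
Proof.
move=> [_ F0 cF] [_ G0 cG]; split => /=; first exact: undup_uniq.
  case: (supp F) F0 cF => // b s _ _; case: (supp G) G0 cG => // c t _ _.
  apply/eqP => /(congr1 (fun r => b + c \in r)).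
  by rewrite mem_undup in_nil => /negP; apply; apply/allpairsP; exists (b, c); rewrite !mem_head.
move=> a; rewrite mem_undup => /allpairsP[[b c] /= [bF cG' ->]].
rewrite sqrtr_gt0 (big_rem b)//= (big_rem c)//= eqxx.
rewrite -addrA ltr_pwDl//.
  by rewrite mulr_gt0// exprn_gt0 ?cF ?cG.
by rewrite addr_ge0// sumr_ge0// => i _; rewrite ?sumr_ge0// => *; rewrite mulr_ge0 ?sqr_ge0.
Qed.

Lemma espace_valid_espow F d : espace_valid F -> espace_valid (espow F d).
Proof. by move=> vF; rewrite /espow; elim: d.-1 => //= k IH; exact: espace_valid_esmul. Qed.

Definition dot a x : R := \sum_i (a 0 i)%:~R * x 0 i.

Lemma dotD a b x : dot (a + b) x = dot a x + dot b x.
Proof. by rewrite /dot -big_split; apply: eq_bigr => i _; rewrite mxE intrD mulrDl. Qed.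

Definition ew a x : R := expR (dot a x).

Lemma ew_gt0 a x : 0 < ew a x. Proof. exact: expR_gt0. Qed.

Lemma ewD a b x : ew (a + b) x = ew a x * ew b x.
Proof. by rewrite /ew dotD expRD. Qed.

(** The variance at [x] of the random sum of [F]; [mom1] and [mom2] are the corresponding
    unnormalised first and second moments of the exponents. *)
Definition mom0 F x := mom F (fun a => ew a x ^+ 2).
Definition mom1 F x (j : 'I_n) := mom F (fun a => ew a x ^+ 2 * (a 0 j)%:~R).
Definition mom2 F x (j l : 'I_n) :=
  mom F (fun a => ew a x ^+ 2 * (a 0 j)%:~R * (a 0 l)%:~R).

(* Covariance of the exponents under the probability weights
   [coef F a ^+ 2 * ew a x ^+ 2 / mom0 F x]. *)
Definition cov F x j l := mom2 F x j l / mom0 F x - mom1 F x j * mom1 F x l / mom0 F x ^+ 2.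

Lemma mom0_gt0 F x : espace_valid F -> 0 < mom0 F x.
Proof.
move=> [_ F0 cF]; rewrite /mom0 /mom; case: (supp F) F0 cF => // a s _ cF.
rewrite big_cons ltr_pwDl// ?sumr_ge0//.
  by rewrite mulr_gt0 ?exprn_gt0 ?ew_gt0// cF ?mem_head.
by move=> b _; rewrite mulr_ge0 ?sqr_ge0.
Qed.

Lemma cov_esmul F G x j l : espace_valid F -> espace_valid G ->
  cov (esmul F G) x j l = cov F x j l + cov G x j l.
Proof.
move=> /(mom0_gt0 x) F0 /(mom0_gt0 x) G0.
pose e a := ew a x ^+ 2; pose e1 j a := e a * (a 0 j)%:~R.
pose e2 a := e a * (a 0 j)%:~R * (a 0 l)%:~R.
have E0 : mom0 (esmul F G) x = mom0 F x * mom0 G x.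
  rewrite {1}/mom0 (@mom_esmul_bilinear _ _ _ [:: (e, e)]) ?big_seq1// => b c.
  by rewrite big_seq1 /= /e ewD exprMn.
have E1 i : mom1 (esmul F G) x i = mom1 F x i * mom0 G x + mom0 F x * mom1 G x i.
  rewrite {1}/mom1 (@mom_esmul_bilinear _ _ _ [:: (e1 i, e); (e, e1 i)]) => [|b c].
    by rewrite big_cons big_seq1.
  by rewrite big_cons big_seq1 /= /e1 /e ewD mxE intrD; ring.
have E2 : mom2 (esmul F G) x j l = mom2 F x j l * mom0 G x + mom1 F x j * mom1 G x l
    + mom1 F x l * mom1 G x j + mom0 F x * mom2 G x j l.
  rewrite {1}/mom2
    (@mom_esmul_bilinear _ _ _ [:: (e2, e); (e1 j, e1 l); (e1 l, e1 j); (e, e2)]) => [|b c].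
    by rewrite !big_cons big_nil addr0 !addrA.
  by rewrite !big_cons big_nil /= /e2 /e1 /e ewD !mxE !intrD; ring.
(* The mixed terms of [E2] cancel against those in the product of the two instances of [E1]. *)
by rewrite /cov E0 !E1 E2; field; rewrite !gt_eqF.
Qed.

Lemma cov_espow F d x j l : espace_valid F -> (0 < d)%N ->
  cov (espow F d) x j l = d%:R * cov F x j l.
Proof.
(* [espow] multiplies [d.-1] times, so the induction starts at exponent 1. *)
move=> vF; case: d => // d _; elim: d => [|d IH]; first by rewrite mul1r.
rewrite (_ : espow F d.+2 = esmul F (espow F d.+1))// cov_esmul// ?IH.
  by rewrite [in RHS]mulrS mulrDl mul1r.
exact: espace_valid_espow.
Qed.

Lemma sc11_dot a : sc11 (dot a) (fun j _ => (a 0 j)%:~R).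
Proof.
apply: (@eq_sc11 _ _ (fun x => \sum_i (a 0 i)%:~R * x 0 i) _
  (fun j x => \sum_i (0 * x 0 i + (a 0 i)%:~R * (j == i)%:R))) => //.
  move=> j x; rewrite (bigD1 j)//= big1 => [|i /negbTE ij].
    by rewrite eqxx mul0r add0r mulr1 addr0.
  by rewrite eq_sym ij mul0r mulr0 addr0.
by apply: sc11_sum => i; apply: sc11M; [exact: sc11_cst|exact: sc11_coord].
Qed.

Lemma sc11_ew a : sc11 (ew a) (fun j x => ew a x * (a 0 j)%:~R).
Proof. exact: sc11_expR (sc11_dot a). Qed.

Lemma sc11_mom0 F : sc11 (mom0 F) (fun j x => 2 * mom1 F x j).
Proof.
apply: (@eq_sc11 _ _ (fun x => \sum_(a <- supp F) coef F a ^+ 2 * (ew a x * ew a x)) _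
  (fun j x => \sum_(a <- supp F) (0 * (ew a x * ew a x) + coef F a ^+ 2 *
     (ew a x * (a 0 j)%:~R * ew a x + ew a x * (ew a x * (a 0 j)%:~R))))).
- by move=> x; apply: eq_bigr => a _; rewrite expr2.
- by move=> j x; rewrite /mom1 /mom mulr_sumr; apply: eq_bigr => a _; ring.
- apply: sc11_sum => a; apply: sc11M; first exact: sc11_cst.
  by apply: sc11M; exact: sc11_ew.
Qed.

Definition uvec F a x : R := coef F a * ew a x * (Num.sqrt (mom0 F x))^-1.

(** The logarithmic derivative of [ew a] is the exponent, and that of the root of [mom0] is
    [mom1 / mom0], the mean exponent. The gradient is thus [uvec] times a centred exponent. *)
Lemma sc11_uvec F a : espace_valid F ->
  sc11 (uvec F a) (fun j x => uvec F a x * ((a 0 j)%:~R - mom1 F x j / mom0 F x)).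
Proof.
move=> vF; have m0 x := @mom0_gt0 F x vF.
have s0 x : 0 < Num.sqrt (mom0 F x) by rewrite sqrtr_gt0.
have := sc11M (sc11M (@sc11_cst R n (coef F a)) (sc11_ew a))
  (sc11_inv (sc11_sqrt (sc11_mom0 F) m0) s0).
apply: eq_sc11 => // j x; rewrite /uvec; move: (s0 x) (sqr_sqrtr (ltW (m0 x))).
set s := Num.sqrt (mom0 F x); move: s => s s00 <-.
by field; rewrite gt_eqF.
Qed.

Lemma sum_uvec2 F x psi : espace_valid F ->
  \sum_(a <- supp F) uvec F a x ^+ 2 * psi a =
  mom F (fun a => ew a x ^+ 2 * psi a) / mom0 F x.
Proof.
move=> /(mom0_gt0 x) m0; rewrite /mom mulr_suml; apply: eq_bigr => a _.
by rewrite /uvec !exprMn exprVn sqr_sqrtr ?(ltW m0)//; ring.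
Qed.

End exponential_spaces.

(** * The random system and the law of its coefficients *)

Section system.
Context (R : realType) (n : nat) (F : 'I_n -> espace n R).

Definition keys : seq ('I_n * 'rV[int]_n) := [seq (i, a) | i <- enum 'I_n, a <- supp (F i)].

Definition nkeys := size keys.

Definition key (k : 'I_nkeys) := tnth (in_tuple keys) k.

Lemma sum_keys (G : 'I_n * 'rV[int]_n -> R) :
  \sum_k G (key k) = \sum_i \sum_(a <- supp (F i)) G (i, a).
Proof. by rewrite -(big_tnth _ _ keys xpredT G) big_allpairs_dep big_enum. Qed.

Lemma sum_keys_row i (G : 'I_n * 'rV[int]_n -> R) :
  \sum_k ((key k).1 == i)%:R * G (key k) = \sum_(a <- supp (F i)) G (i, a).
Proof.
rewrite (sum_keys (fun p => (p.1 == i)%:R * G p)) (bigD1 i)//= [X in _ + X]big1 => [|l /negbTE li].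
  by rewrite addr0; apply: eq_bigr => a _; rewrite eqxx mul1r.
by rewrite big1 // => a _; rewrite li mul0r.
Qed.

(** Column [i] is the unit coefficient vector of the [i]-th equation at [x], placed on the keys of
    that equation; different columns share no key and are therefore orthogonal. *)
Definition eU (x : 'rV[R]_n) : 'M[R]_(nkeys, n) :=
  \matrix_(k, i) (((key k).1 == i)%:R * uvec (F (key k).1) (key k).2 x).

Definition edU (j : 'I_n) (x : 'rV[R]_n) : 'M[R]_(nkeys, n) :=
  \matrix_(k, i) (((key k).1 == i)%:R * (uvec (F (key k).1) (key k).2 x *
    (((key k).2 0 j)%:~R - mom1 (F (key k).1) x j / mom0 (F (key k).1) x))).

Lemma sum_keys2 i l (G H : 'I_n * 'rV[int]_n -> R) :
  \sum_k (((key k).1 == i)%:R * G (key k)) * (((key k).1 == l)%:R * H (key k)) =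
  (i == l)%:R * \sum_(a <- supp (F i)) G (i, a) * H (i, a).
Proof.
transitivity (\sum_k ((key k).1 == i)%:R * (((key k).1 == l)%:R * (G (key k) * H (key k)))).
  by apply: eq_bigr => k _; ring.
rewrite (sum_keys_row i (fun p => (p.1 == l)%:R * (G p * H p))) mulr_sumr.
by [].
Qed.

Hypothesis vF : forall i, espace_valid (F i).

Lemma sc11_eU k i : sc11 (fun x => eU x k i) (fun j x => edU j x k i).
Proof.
have := sc11M (@sc11_cst R n ((key k).1 == i)%:R) (sc11_uvec (key k).2 (vF (key k).1)).
by apply: eq_sc11 => [x|j x]; rewrite !mxE// mul0r add0r.
Qed.

Lemma eU_orthonormal x : (eU x)^T *m eU x = 1%:M.
Proof.
apply/matrixP => i l; rewrite !mxE; under eq_bigr do rewrite !mxE.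
rewrite (sum_keys2 i l (fun p => uvec (F p.1) p.2 x) (fun p => uvec (F p.1) p.2 x)) /=.
have -> : \sum_(a <- supp (F i)) uvec (F i) a x * uvec (F i) a x =
    \sum_(a <- supp (F i)) uvec (F i) a x ^+ 2 * 1.
  by apply: eq_bigr => a _; rewrite mulr1.
rewrite sum_uvec2// (_ : mom _ _ = mom0 (F i) x).
  by rewrite divff ?mulr1// gt_eqF// mom0_gt0.
by apply: eq_bigr => a _; rewrite mulr1.
Qed.

(** The squares of [uvec] are probability weights on the support, and a centred variable has mean 0.
    This yields the orthogonality of [edU j x] and [eU x] that [det_krM] requires. *)
Lemma sum_uvec_centered i j x :
  \sum_(a <- supp (F i)) uvec (F i) a x ^+ 2 * ((a 0 j)%:~R - mom1 (F i) x j / mom0 (F i) x) = 0.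
Proof.
have m0 := mom0_gt0 x (vF i); rewrite sum_uvec2//.
rewrite (_ : mom _ _ = mom1 (F i) x j - mom1 (F i) x j / mom0 (F i) x * mom0 (F i) x).
  by rewrite divfK ?gt_eqF// subrr mul0r.
rewrite /mom1 /mom0 {1 2 5}/mom mulr_sumr -sumrB; apply: eq_bigr => a _; ring.
Qed.

Lemma edU_orthogonal j x : (edU j x)^T *m eU x = 0.
Proof.
apply/matrixP => i l; rewrite !mxE; under eq_bigr do rewrite !mxE.
rewrite (sum_keys2 i l (fun p => uvec (F p.1) p.2 x * ((p.2 0 j)%:~R
   - mom1 (F p.1) x j / mom0 (F p.1) x)) (fun p => uvec (F p.1) p.2 x)) /=.
have := sum_uvec_centered i j x; set S := \sum_(a <- _) _ => S0.
transitivity ((i == l)%:R * S); last by rewrite S0 mulr0.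
by congr (_ * _); apply: eq_bigr => a _; ring.
Qed.

Lemma gram_edU j j' i i' x :
  \sum_k edU j x k i * edU j' x k i' = (i == i')%:R * cov (F i) x j j'.
Proof.
under eq_bigr do rewrite !mxE.
rewrite (sum_keys2 i i' (fun p => uvec (F p.1) p.2 x * ((p.2 0 j)%:~R
   - mom1 (F p.1) x j / mom0 (F p.1) x)) (fun p => uvec (F p.1) p.2 x * ((p.2 0 j')%:~R
   - mom1 (F p.1) x j' / mom0 (F p.1) x))) /=; congr (_ * _).
have m0 := mom0_gt0 x (vF i).
pose m l := mom1 (F i) x l / mom0 (F i) x.
(* Only the first centred factor is expanded fully, so that the last sum is again a centred mean and
   vanishes. *)
transitivity (\sum_(a <- supp (F i)) uvec (F i) a x ^+ 2 * ((a 0 j)%:~R * (a 0 j')%:~R)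
   - m j' * \sum_(a <- supp (F i)) uvec (F i) a x ^+ 2 * (a 0 j)%:~R
   - m j * \sum_(a <- supp (F i)) uvec (F i) a x ^+ 2 * ((a 0 j')%:~R - m j')).
  by rewrite !mulr_sumr -!sumrB; apply: eq_bigr => a _; rewrite /m; ring.
rewrite sum_uvec_centered mulr0 subr0 !sum_uvec2// /cov /m -/(mom1 _ _ _).
rewrite (_ : mom _ _ = mom2 (F i) x j j'); first by field; rewrite gt_eqF.
by apply: eq_bigr => a _; rewrite !mulrA.
Qed.

Lemma uniq_keys : uniq keys.
Proof.
apply: allpairs_uniq_dep; first exact: enum_uniq.
  by move=> i _; case: (vF i).
by move=> [i a] [j b] _ _ /= [-> ->].
Qed.

Lemma all_keys : all (fun p => in_supp F p.1 p.2) keys.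
Proof. by apply/allP => p /allpairsPdep[i [a [_ aF ->]]]. Qed.

Lemma key_in k : in_supp F (key k).1 (key k).2.
Proof. by have /allP/(_ (key k)) := all_keys; apply; exact: mem_tnth. Qed.

Definition tup (x : 'rV[R]_n) : n.-tuple R := [tuple x ord0 i | i < n].

Lemma measurable_tup : measurable_fun setT tup.
Proof.
apply/measurable_fun_tnthP => i.
rewrite (_ : _ \o _ = (fun x : 'rV[R]_n => x 0 i)); last first.
  by apply/funext => x /=; rewrite tnth_mktuple.
exact: measurable_coord.
Qed.

Section law.
Context d (T : measurableType d) (P : probability T R) (X : 'I_n -> 'rV[int]_n -> T -> R).
Hypothesis hX : iid_std_normal P (in_supp F) X.

Definition rowX (w : T) : 'rV[R]_nkeys := \row_k X (key k).1 (key k).2 w.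

Lemma measurable_rowX : measurable_fun setT rowX.
Proof.
apply: measurable_fun_rVP => k; under eq_fun do rewrite mxE.
by case: hX => mX _ _; apply: mX; exact: key_in.
Qed.

Lemma ex_normal1 : exists p : {sigma_finite_measure set R -> \bar R},
  forall A, p A = normal_prob 0 1 A.
Proof.
have mg : measurable_fun [set: R] (fun x : R => x : measurableTypeR R).
  by move=> _ B mB; rewrite setTI.
exact: (sigma_finite_pushforward (sigma_finiteT (@normal_prob R 0 1))
  (@measurable_fun_idTR R) mg (fun=> erefl)).
Qed.

Lemma rowX_rect (B : 'I_nkeys -> set R) : (forall k, measurable (B k)) ->
  P (rowX @^-1` rect B) = (\prod_k normal_prob 0 1 (B k))%E.
Proof.
move=> mB; have [_ nX iX] := hX.
(* Independence is stated for sets indexed by pairs. As the keys are distinct, [index] recovers the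
   position of a pair in the list; other pairs get the whole line. *)
pose B' p := if insub (index p keys) is Some k then B k else setT.
have B'E k : B' (key k) = B k.
  rewrite /B' /key (tnth_nth (key k)) index_uniq ?uniq_keys//= ?ltn_ord//.
  by rewrite valK.
have mB' p : measurable (B' p) by rewrite /B'; case: insubP => *.
rewrite (_ : _ @^-1` _ = \bigcap_(p in [set` keys]) (X p.1 p.2 @^-1` B' p)).
  rewrite iX// ?uniq_keys ?all_keys// big_tnth.
  by apply: eq_bigr => k _; rewrite -/(key k) B'E nX//; exact: key_in.
apply/seteqP; split => [w wB p /= /seq_tnthP[k ->]|w wB k].
  by rewrite -/(key k) B'E; have := wB k; rewrite mxE.
by rewrite mxE -B'E; apply: wB => /=; exact: mem_tnth.
Qed.

Lemma integral_rowX (h : 'rV[R]_nkeys -> \bar R) : measurable_fun setT h ->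
  (forall f, 0 <= h f)%E ->
  (\int[P]_w h (rowX w) = \int[leb nkeys]_f (h f * (gd f)%:E))%E.
Proof.
move=> mh h0; have [nu nuE] := ex_normal1.
rewrite -(integral_pushm P measurable_rowX mh h0).
rewrite -(integral_dens (leb nkeys) (@measurable_gdE R nkeys) (@gdE_ge0 R nkeys) mh h0).
apply: eq_measure_integral => A mA _.
rewrite [LHS](@prodm_unique _ nu nkeys (pushm P measurable_rowX))// => [|B mB].
  apply/esym/(@prodm_unique _ nu nkeys (dens _ _ _)) => // B mB.
  by rewrite densE integral_gd_rect//; apply: eq_bigr => k _; rewrite nuE.
rewrite [LHS]rowX_rect//; apply: eq_bigr => k _; by rewrite nuE.
Qed.

Lemma rowX_eU x w i : (rowX w *m eU x) 0 i = (Num.sqrt (mom0 (F i) x))^-1 *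
  \sum_(a <- supp (F i)) X i a w * coef (F i) a * expR (dotZ a (tup x)).
Proof.
rewrite mxE; under eq_bigr do rewrite !mxE mulrCA.
rewrite (sum_keys_row i (fun p => X p.1 p.2 w * uvec (F p.1) p.2 x)) mulr_sumr /=.
apply: eq_bigr => a _; rewrite /uvec (_ : dotZ a (tup x) = dot a x).
  by rewrite -/(ew a x); ring.
by apply: eq_bigr => l _; rewrite tnth_mktuple.
Qed.

(** [tup] is a bijection between rows and tuples, and by [rowX_eU] the normalised equations differ
    from the original ones by positive factors only. *)
Lemma nsolutions_zeros (D : set (n.-tuple R)) w :
  nsolutions F (fun i a => X i a w) D =
  (\esum_(x in zeros eU (tup @^-1` D) (rowX w)) 1)%E.
Proof.
rewrite /nsolutions (reindex_esum (zeros eU (tup @^-1` D) (rowX w)) _ tup)//; split.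
- move=> x [/= Dx /rowP z]; split => // i; have := z i; rewrite rowX_eU mxE => /eqP.
  by rewrite mulf_eq0 invr_eq0 gt_eqF ?sqrtr_gt0 ?mom0_gt0//= => /eqP.
- move=> x y _ _ /(congr1 (@tnth _ _)) xy; apply/rowP => i.
  by have := congr1 (@^~ i) xy; rewrite /= !tnth_mktuple.
- move=> t [Dt st]; have tE : tup (\row_i tnth t i) = t.
    by apply: eq_from_tnth => i; rewrite tnth_mktuple mxE.
  exists (\row_i tnth t i) => //; split; first by rewrite /= tE.
  by apply/rowP => i; rewrite rowX_eU tE st mulr0 mxE.
Qed.

(** The solution count agrees with the measurable function [C] of the coefficient row except when
    that row falls in [Z]; hence the detour through [eq_integral_outside_null]. *)
Theorem expected_nsolE (D : set (n.-tuple R)) : measurable D ->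
  (expected_nsol P F X D = \int[leb n]_(x in tup @^-1` D) ((normal_peak 1 ^+ n)%:E *
    \int[leb nkeys]_g (gd g * `|\det (rowsmx (edU^~ x) g)|)%:E))%E.
Proof.
move=> mD; have mD' : measurable (tup @^-1` D).
  by rewrite -[X in measurable X]setTI; exact: measurable_tup.
have [Z [C [mZ Z0 mC C0 [CE CI]]]] := kac_rice sc11_eU eU_orthonormal edU_orthogonal mD'.
rewrite -[RHS]CI -integral_rowX// /expected_nsol.
have mZ' : measurable (rowX @^-1` Z).
  by rewrite -[X in measurable X]setTI; exact: measurable_rowX.
apply: (@eq_integral_outside_null _ _ _ _ (rowX @^-1` Z)) => //.
(* The coefficient row has density [gd], so the preimage of the Lebesgue null set [Z] has
   probability 0. *)
- rewrite -(integralT_indic P mZ').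
  transitivity (\int[leb nkeys]_f ((\1_Z f)%:E * (gd f)%:E))%E.
    rewrite -integral_rowX//; exact/measurable_EFinP/measurable_indic.
  rewrite (ge0_ae_eq_integral measurableT (g := cst 0%E)) ?integral0//.
  - apply: emeasurable_funM; last exact: measurable_gdE.
    exact/measurable_EFinP/measurable_indic.
  - by move=> f _; rewrite mule_ge0 ?gdE_ge0// lee_fin.
  - exists Z; split => // f /= /not_implyP[_ kx]; apply: contrapT => Zf; apply: kx.
    by rewrite indicE memNset// mul0e.
- exact: (measurableT_comp mC measurable_rowX).
- by move=> w; exact: esum_ge0.
- by move=> w Zw; rewrite nsolutions_zeros CE.
Qed.

End law.

End system.

Lemma sqrt_prod (R : rcfType) (I : Type) (s : seq I) (f : I -> R) : (forall i, 0 <= f i) ->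
  Num.sqrt (\prod_(i <- s) f i) = \prod_(i <- s) Num.sqrt (f i).
Proof.
move=> f0; elim: s => [|i s IH]; first by rewrite !big_nil sqrtr1.
by rewrite !big_cons sqrtrM// IH.
Qed.

Theorem theorem1p3 (R : realType) (n : nat)
  (D : set (n.-tuple R)) (hD : measurable D)
  (F : 'I_n -> espace n R) (hF : forall i, espace_valid (F i))
  (dg : 'I_n -> nat) (hdg : forall i, (0 < dg i)%N)
  (d1 : measure_display) (T1 : measurableType d1) (P1 : probability T1 R)
  (X : 'I_n -> 'rV[int]_n -> T1 -> R)
  (hX : iid_std_normal P1 (in_supp (fun i => espow (F i) (dg i))) X)
  (d2 : measure_display) (T2 : measurableType d2) (P2 : probability T2 R)
  (Y : 'I_n -> 'rV[int]_n -> T2 -> R)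
  (hY : iid_std_normal P2 (in_supp F) Y) :
  expected_nsol P1 (fun i => espow (F i) (dg i)) X D =
  ((Num.sqrt (\prod_(i < n) (dg i)%:R : R))%:E * expected_nsol P2 F Y D)%E.
Proof.
have vE i : espace_valid (espow (F i) (dg i)) by exact: espace_valid_espow.
rewrite (expected_nsolE vE hX hD) (expected_nsolE hF hY hD).
set D' := @tup R n @^-1` D; set s := Num.sqrt _.
have mD' : measurable D' by rewrite -[X in measurable X]setTI; exact: measurable_tup.
have s0 : 0 <= s by exact: sqrtr_ge0.
have p0 : 0 <= normal_peak 1 ^+ n :> R by rewrite exprn_ge0// normal_peak_ge0.
rewrite -ge0_integralZl_EFin//.
- apply: eq_integral => x _; rewrite muleCA; congr (_ * _)%E.
  (* The Gram entries with [i = i'] are multiplied by [dg i = c i ^+ 2] and the others vanish on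
     both sides, which is the scaling by [c i * c i'] asked for by [integral_absdet_gram]. *)
  pose c i : R := Num.sqrt (dg i)%:R.
  rewrite (@integral_absdet_gram R _ _ n (edU F ^~ x) (edU (fun i => espow (F i) (dg i)) ^~ x) c).
    congr (_%:E * _)%E; rewrite /s sqrt_prod// ger0_norm//; apply: prodr_ge0 => i _.
    exact: sqrtr_ge0.
  move=> j j' i i'; rewrite !gram_edU// cov_espow//.
  have [->|_] := eqVneq i i'; last by rewrite !mul0r mulr0.
  by rewrite /c -expr2 sqr_sqrtr// !mul1r.
- move=> x _; rewrite mule_ge0 ?lee_fin//; apply: integral_ge0 => g _.
  by rewrite lee_fin mulr_ge0 ?gd_ge0.
- apply: measurable_funTS; apply: measurable_funeM.
  exact: (measurable_integral_krY (sc11_eU hF) (edU_orthogonal hF)).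
Qed.
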